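(* Let $K/\mathbb Q$ be imaginary quadratic, $p$ an odd prime, $E/\mathbb Q_p$ a finite extension (large enough that $K$ embeds in $E$), $\chi:G_K\to\mathcal O_E^\times$ a continuous character with weights $a,b\in E$ at $p$, and $r\in\mathbb Z$. Fix a parametrization family, with attached constants $A,B\in\mathcal O_E^\times$ and depth $h$. Let $\mathbb D_{x,y}=\operatorname{Sp}E\langle\frac{x-1}{p^h},\frac{y-1}{p^h}\rangle$ be the closed product bidisc with $E$-points $(1+p^h\mathcal O_E)^2$, write $\mathbb D_{x,y,L}$ for its base change to a finite extension $L/E$, and put $$\Phi(x,y)=Ax^ay^b+Bx^by^a-r,$$ an analytic function on $\mathbb D_{x,y}$. Assume $r\ne0$ and $(a,b)\ne(0,0)$. Let $L/E$ be finite, let $C\subset\mathbb A^2_L$ be an irreducible algebraic curve, and suppose that $\Phi$ vanishes on a nonempty admissible open $\Omega\subset C^{\mathrm{an}}\cap\mathbb D_{x,y,L}$. Then at least one of the following holds: (i) $a,b\in\mathbb Q$; (ii) $a+b=0$ and the rational function $x/y$ is constant on $C$; (iii) $a-b=0$ and the rational function $xy$ is constant on $C$.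
   Context: A rational function on an integral curve over $L$ is called constant if it is algebraic over $L$ inside the function field (equivalently, in characteristic zero, its differential over $L$ vanishes). $C^{\mathrm{an}}$ is the rigid analytification of $C$. Powers are $t^s=\exp(s\log t)$. Weights. Let $c$ be the nontrivial automorphism of $K$ (also denoted by a bar on ideals) and $K_p=K\otimes_{\mathbb Q}\mathbb Q_p=\prod_{\mathfrak p\mid p}K_{\mathfrak p}$. Local reciprocity sends uniformizers to arithmetic Frobenius. Let $\lambda_{\mathfrak p}:K_{\mathfrak p}^\times\to\mathcal O_E^\times$ be the character attached to $\chi|_{G_{K_{\mathfrak p}}}$ by local reciprocity, and $\lambda_p:K_p^\times\to\mathcal O_E^\times$ their product. There is a unique $\kappa\in\operatorname{Hom}_{\mathbb Q_p}(K_p,E)$ with $\lambda_p(u)=\exp(-\kappa(\log u))$ for $u$ in a sufficiently deep principal-unit subgroup. Fix an embedding $\tau:K\hookrightarrow E\subset\overline{\mathbb Q}_p$, put $\tau^c=\tau\circ c$, extend both $\mathbb Q_p$-linearly to $K_p$; the weights $a,b\in E$ are defined by $\kappa=a\tau+b\tau^c$. Parametrization families. Let $\Psi$ be the multiplicative character on fractional ideals prime to the (finite) ramification set of $\chi$ with $\Psi(\mathfrak q)=\chi(\operatorname{Frob}_{\mathfrak q})$ (arithmetic Frobenius) for unramified primes $\mathfrak q$. Fix an integral modulus $\mathfrak m$ (ideal of $\mathcal O_K$) prime to $p$ with $\overline{\mathfrak m}=\mathfrak m$, divisible by every prime away from $p$ at which $\chi$ ramifies, and such that for every $v\mid\mathfrak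 m$ the local character of $\chi$ at $v$ is trivial on $1+\mathfrak m\mathcal O_{K_v}$. Let $I_{\mathfrak m}^{(p)}$ be the group of fractional ideals prime to $p\mathfrak m$ and $P_{\mathfrak m}^{(p)}$ the subgroup of principal ideals $(\alpha)$ with $\alpha\equiv1\pmod{\mathfrak m}$ and $v_{\mathfrak p}(\alpha)=0$ for all $\mathfrak p\mid p$; the quotient is finite. Fix a finite list of fractional ideals $\mathfrak a_1,\dots,\mathfrak a_J$ prime to $p\mathfrak m$, containing a representative of every class and stable under conjugation. An admissible generator for $\mathfrak a_j$ is an $\alpha\in K^\times$ with $\alpha\equiv1\pmod{\mathfrak m}$, $v_{\mathfrak p}(\alpha)=0$ for $\mathfrak p\mid p$, and $(\alpha)=\mathfrak l\mathfrak a_j^{-1}$ for some prime $\mathfrak l$ of $K$ prime to $p\mathfrak m$ above a rational prime $\ell$ that splits in $K$ and at which $\rho=\operatorname{Ind}_{G_K}^{G_{\mathbb Q}}\chi$ is unramified. Fix $h$ sufficiently large that $\lambda_p(u)=\exp(-\kappa(\log u))$ on $1+p^h(\mathcal O_K\otimes\mathbb Z_p)$ and that the logarithm, exponential and all analytic powers occurring (exponents $a,b,(a\pm b)/2$) are defined by convergent series, with logarithm and exponential injective, on the closed disc $|t-1|\le|p^h|$. A parametrization family is a pair consisting of a representative $\mathfrak a_j$ and a nonempty class of admissible generators for $\mathfrak a_j$ modulo $1+p^h(\mathcal O_K\otimes\mathbb Z_p)$ (a class in $(\mathcal O_K\otimes\mathbb Z_p)^\times/(1+p^h(\mathcal O_K\otimes\mathbb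 Z_p))$). For each family fix one admissible generator $\alpha_0$ in the class, and set $A=\Psi(\mathfrak a_j)\lambda_p(\alpha_0)^{-1}$, $B=\Psi(\overline{\mathfrak a_j})\lambda_p(c(\alpha_0))^{-1}$. *)

(* Defs.v *)
From HB Require Import structures.
From mathcomp Require Import all_boot all_order all_algebra all_fingroup all_field.
From mathcomp Require Import boolp classical_sets reals.

Set Implicit Arguments.
Unset Strict Implicit.
Unset Printing Implicit Defensive.

Import Order.TTheory GRing.Theory Num.Theory.
Local Open Scope classical_set_scope.
Local Open Scope ring_scope.

Record nonarchAbs (R : realType) (F : fieldType) := NonarchAbs {
  nabs :> F -> R;
  nabs_ge0 : forall x, 0 <= nabs x;
  nabs_eq0 : forall x, nabs x = 0 <-> x = 0;
  nabsM : forall x y, nabs (x * y) = nabs x * nabs y;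
  nabsD : forall x y, nabs (x + y) <= Num.max (nabs x) (nabs y) }.

Section AbsoluteValues.
Variables (R : realType) (F : fieldType) (v : nonarchAbs R F).

Definition abs_cvg (u : nat -> F) (l : F) : Prop :=
  forall e : R, 0 < e -> exists N, forall n, (N <= n)%N -> v (u n - l) < e.

Definition abs_cauchy (u : nat -> F) : Prop :=
  forall e : R, 0 < e ->
    exists N, forall m n, (N <= m)%N -> (N <= n)%N -> v (u m - u n) < e.

Definition abs_complete : Prop :=
  forall u, abs_cauchy u -> exists l, abs_cvg u l.

(* junk value 0 when the sequence diverges *)
Definition abs_lim (u : nat -> F) : F := xget 0 [set l | abs_cvg u l].

Definition abs_dense (G : Type) (f : G -> F) : Prop :=
  forall (x : F) (e : R), 0 < e -> exists y, v (x - f y) < e.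

Definition val_ring : set F := [set x | v x <= 1].
Definition val_max : set F := [set x | v x < 1].

Definition uniformizer (w : F) : Prop :=
  [/\ w != 0, v w < 1 & forall x, v x < 1 -> v x <= v w].

Definition log_sums (t : F) (N : nat) : F :=
  \sum_(1 <= n < N) (-1) ^+ n.+1 / n%:R * (t - 1) ^+ n.
Definition exp_sums (z : F) (N : nat) : F :=
  \sum_(0 <= n < N) z ^+ n / n`!%:R.

Definition abs_log (t : F) : F := abs_lim (log_sums t).
Definition abs_exp (z : F) : F := abs_lim (exp_sums z).

End AbsoluteValues.

Definition abs_extends (R : realType) (F G : fieldType) (i : F -> G)
    (v : nonarchAbs R F) (w : nonarchAbs R G) : Prop :=
  forall x, w (i x) = v x.

(* the field of p-adic numbers, as the completion of the rationals; all such
   completions are canonically isomorphic *)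
Record padicField (R : realType) (p : nat) := PadicField {
  padic_sort :> fieldType;
  padic_abs : nonarchAbs R padic_sort;
  padic_absp : padic_abs p%:R = p%:R^-1;
  padic_complete : abs_complete padic_abs;
  padic_dense : abs_dense padic_abs (@ratr padic_sort) }.

Definition integers (F : fieldType) : set F :=
  [set x | integralOver (intr : int -> F) x].
Arguments integers F : clear implicits.

Section Ideals.
Variables (F : comNzRingType) (O : set F).

Definition is_submod (I : set F) : Prop :=
  [/\ I 0, forall x y, I x -> I y -> I (x + y)
    & forall x y, O x -> I y -> I (x * y)].

Definition is_ideal (I : set F) : Prop := I `<=` O /\ is_submod I.

Definition is_prime_ideal (P : set F) : Prop :=
  [/\ is_ideal P, ~ P 1
    & forall x y, O x -> O y -> P (x * y) -> P x \/ P y].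

Definition is_maximal_ideal (M : set F) : Prop :=
  [/\ is_ideal M, ~ M 1
    & forall J, is_ideal J -> M `<=` J -> J = M \/ J 1].

Definition ideal_mul (I J : set F) : set F :=
  [set z | exists n (x y : 'I_n -> F),
     [/\ forall k, I (x k), forall k, J (y k) & z = \sum_(k < n) x k * y k]].

Definition ideal_inv (I : set F) : set F :=
  [set x | forall y, I y -> O (x * y)].

Definition principal_ideal (x : F) : set F := [set y | exists2 o, O o & y = x * o].

(* the residue ring of O by the additive subgroup M has exactly q elements *)
Definition quot_card (M : set F) (q : nat) : Prop :=
  exists s : 'I_q -> F, (forall i, O (s i)) /\
    forall x, O x -> exists i, unique (fun i => M (x - s i)) i.

End Ideals.

Section NumberField.
Variable K : fieldType.

Notation OK := (integers K).

Definition nonzero_set (I : set K) : Prop := exists2 x, I x & x != 0.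

Definition is_prime (P : set K) : Prop := is_prime_ideal OK P /\ nonzero_set P.

Definition is_integral_ideal (I : set K) : Prop := is_ideal OK I /\ nonzero_set I.

Definition is_frac_ideal (I : set K) : Prop :=
  [/\ is_submod OK I, nonzero_set I
    & exists2 d, d != 0 & forall x, I x -> OK (d * x)].

Definition ideal_div (I J : set K) : set K := ideal_mul I (ideal_inv OK J).

(* I is prime to P, i.e. has P-adic valuation 0 *)
Definition prime_to (P I : set K) : Prop :=
  exists J1 J2 : set K,
    [/\ is_integral_ideal J1, is_integral_ideal J2, ~ J1 `<=` P, ~ J2 `<=` P
      & I = ideal_div J1 J2].

Definition divides_pm (p : nat) (m P : set K) : Prop := P p%:R \/ m `<=` P.

Definition prime_to_pm (p : nat) (m I : set K) : Prop :=
  forall P, is_prime P -> divides_pm p m P -> prime_to P I.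

(* multiplicative congruence x = 1 mod m for x not necessarily integral:
   x - 1 lies in the localization of m away from the primes dividing m *)
Definition congr1 (m : set K) (x : K) : Prop :=
  exists s, [/\ OK s, forall P, is_prime P -> m `<=` P -> ~ P s & m (s * (x - 1))].

(* (x) lies in the ray subgroup P_m^(p) and x is the chosen ray generator *)
Definition ray_generator (p : nat) (m : set K) (x : K) : Prop :=
  [/\ x != 0, congr1 m x
    & forall P, is_prime P -> P p%:R -> prime_to P (principal_ideal OK x)].

Definition splits_at (l : nat) : Prop :=
  exists P1 P2, [/\ is_prime P1, is_prime P2, P1 l%:R, P2 l%:R & P1 <> P2].

End NumberField.

Definition imaginary_quadratic (R : realType) (K : fieldExtType rat) : Prop :=
  \dim {:K} = 2%N /\ ({rmorphism K -> R} -> False).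

Definition absGal (F Omega : fieldType) (i : F -> Omega) : set (Omega -> Omega) :=
  [set s : Omega -> Omega |
    [/\ exists f : {rmorphism Omega -> Omega}, s = f :> (Omega -> Omega), bijective s
             & forall x, s (i x) = i x]].

Definition GalQ : set (algC -> algC) := absGal (ratr : rat -> algC).

Section Characters.
Variables (R : realType) (K : fieldType) (iK : {rmorphism K -> algC}).

Notation GK := (absGal iK).
Notation OK := (integers K).
Notation Zbar := (integers algC).

(* a prime Q of the ring of algebraic integers lying above q *)
Definition lies_above (Q : set algC) (q : set K) : Prop :=
  is_prime_ideal Zbar Q /\ forall x, OK x -> (Q (iK x) <-> q x).

Definition inertia (Q : set algC) : set (algC -> algC) :=
  [set s | forall z, Zbar z -> Q (s z - z)].

(* arithmetic Frobenius elements at Q above q *)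
Definition frobenius (q : set K) (Q : set algC) : set (algC -> algC) :=
  [set s | GK s /\ exists2 N, quot_card OK q N
                            & forall z, Zbar z -> Q (s z - z ^+ N)].

Variables (E : fieldType) (vE : nonarchAbs R E) (chi : (algC -> algC) -> E).

(* a continuous character of G_K (with its Krull topology) with values in the
   units of the valuation ring; the values of chi outside G_K are irrelevant *)
Definition is_galois_character : Prop :=
  [/\ forall s t, GK s -> GK t -> chi (s \o t) = chi s * chi t,
      forall s, GK s -> vE (chi s) = 1
    & forall s, GK s -> forall e : R, 0 < e -> exists S : seq algC,
        forall t, GK t -> {in S, t =1 s} -> vE (chi t - chi s) < e].

Definition unramified_at (q : set K) : Prop :=
  forall Q, lies_above Q q -> forall s, GK s -> inertia Q s -> chi s = 1.

(* the space of the induced representation, with (g f)(x) = f (x g) *)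
Definition Ind_space : set ((algC -> algC) -> E) :=
  [set f | forall s g, GK s -> GalQ g -> f (s \o g) = chi s * f g].

Definition Ind_unramified_at (l : nat) : Prop :=
  forall Q, is_prime_ideal Zbar Q -> Q l%:R ->
  forall s, GalQ s -> inertia Q s ->
  forall f, Ind_space f -> forall g, GalQ g -> f (g \o s) = f g.

Definition is_ideal_character (Psi : set K -> E) : Prop :=
  let good I := is_frac_ideal I /\
    forall q, is_prime q -> ~ unramified_at q -> prime_to q I in
  [/\ forall I, good I -> vE (Psi I) = 1,
      forall I J, good I -> good J -> Psi (ideal_mul I J) = Psi I * Psi J
    & forall q, is_prime q -> unramified_at q ->
      forall Q, lies_above Q q -> forall s, frobenius q Q s -> Psi q = chi s].

End Characters.

Section LocalFields.
Variables (R : realType) (K : fieldType) (iK : {rmorphism K -> algC}).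

Definition is_completion (q : set K) (F : fieldType) (v : nonarchAbs R F)
    (emb : K -> F) : Prop :=
  [/\ abs_complete v, abs_dense v emb
    & forall x, integers K x -> (v (emb x) < 1 <-> q x)].

(* The local Artin map F^* -> Gal(F^ab/F) (characterized as in local class field
   theory), given through an arbitrary lift of each value to Gal(Omega/F); only
   the action on finite abelian extensions of F is meaningful. The arithmetic
   normalization is used: acting as the q-power map on the residue field of
   Omega amounts to restricting to the Frobenius of the maximal unramified
   extension. *)
Definition is_local_artin (F : fieldType) (v : nonarchAbs R F)
    (Omega : closedFieldType) (i : {rmorphism F -> Omega})
    (w : nonarchAbs R Omega) (q : nat) (art : F -> Omega -> Omega) : Prop :=
  [/\ forall x, x != 0 -> absGal i (art x),
      forall u, uniformizer v u ->
        forall z, w z <= 1 -> w (art u z - z ^+ q) < 1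
    & forall (M : splittingFieldType F) (j : {rmorphism M -> Omega}),
        (forall x : F, j x%:A = i x) ->
        galois 1 {:M} -> abelian 'Gal({:M} / 1) ->
        [/\ forall x y, x != 0 -> y != 0 ->
              forall z, art (x * y) (j z) = art x (art y (j z)),
            forall x, x != 0 ->
              ((forall z, art x (j z) = j z) <->
               exists y : M, galNorm 1 {:M} y = x%:A)
          & forall g, g \in 'Gal({:M} / 1)%g ->
              exists2 x, x != 0 & forall z, art x (j z) = j (g z)]].

(* an algebraic closure of F, a place of the algebraic numbers above F, and the
   local Artin map of F *)
Record localCFT (F : fieldType) (v : nonarchAbs R F) (emb : K -> F) := LocalCFT {
  lc_clos : closedFieldType;
  lc_inc : {rmorphism F -> lc_clos};
  lc_alg : forall z, algebraicOver lc_inc z;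
  lc_abs : nonarchAbs R lc_clos;
  lc_absE : abs_extends lc_inc v lc_abs;
  lc_glob : {rmorphism algC -> lc_clos};
  lc_globE : forall x, lc_glob (iK x) = lc_inc (emb x);
  lc_card : nat;
  lc_cardP : quot_card (val_ring v) (val_max v) lc_card;
  lc_art : F -> lc_clos -> lc_clos;
  lc_artP : is_local_artin v lc_inc lc_abs lc_card lc_art }.
Arguments lc_glob [F v emb] D : rename.
Arguments lc_art [F v emb] D : rename.

(* lam is the character of F^* attached to the restriction of chi to the local
   Galois group; s is the restriction of the automorphism lc_art D x to algC *)
Definition attached_char (E : fieldType) (chi : (algC -> algC) -> E)
    (F : fieldType) (v : nonarchAbs R F) (emb : K -> F)
    (D : localCFT v emb) (lam : F -> E) : Prop :=
  forall x, x != 0 -> exists s, [/\ absGal iK s,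
    forall z, lc_glob D (s z) = lc_art D x (lc_glob D z) & lam x = chi s].

(* the local character of chi at q is trivial on 1 + m O_q *)
Definition local_char_trivial (E : fieldType) (chi : (algC -> algC) -> E)
    (m q : set K) : Prop :=
  forall (F : fieldType) (v : nonarchAbs R F) (emb : {rmorphism K -> F}),
    is_completion q v emb ->
  forall (D : localCFT v emb) (lam : F -> E), attached_char chi D lam ->
  forall u, ideal_mul (emb @` m) (val_ring v) (u - 1) -> lam u = 1.

Definition is_modulus (p : nat) (c : K -> K) (E : fieldType)
    (chi : (algC -> algC) -> E) (m : set K) : Prop :=
  [/\ is_integral_ideal m,
      forall P, is_prime P -> P p%:R -> ~ m `<=` P,
      c @` m = m,
      forall P, is_prime P -> ~ P p%:R -> ~ unramified_at iK chi P -> m `<=` P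
    & forall P, is_prime P -> m `<=` P -> local_char_trivial chi m P].

End LocalFields.

(* the primes of K above p, with their completions; K_p is the product of the
   fields pl_fld i *)
Record pPlaces (R : realType) (p : nat) (Qp : padicField R p)
    (K : fieldType) (iK : {rmorphism K -> algC}) := PPlaces {
  pl_idx : finType;
  pl_prime : pl_idx -> set K;
  pl_inj : injective pl_prime;
  pl_all : forall P, (is_prime P /\ P p%:R) <-> exists i, P = pl_prime i;
  pl_fld : pl_idx -> fieldExtType Qp;
  pl_abs : forall i, nonarchAbs R (pl_fld i);
  pl_absE : forall i,
    abs_extends (fun x : Qp => x%:A : pl_fld i) (padic_abs Qp) (pl_abs i);
  pl_emb : forall i, {rmorphism K -> pl_fld i};
  pl_cpl : forall i, is_completion (pl_prime i) (pl_abs i) (pl_emb i);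
  pl_cft : forall i, localCFT iK (pl_abs i) (pl_emb i) }.
Arguments pl_fld [R p Qp K iK] V i : rename.
Arguments pl_abs [R p Qp K iK] V i : rename.
Arguments pl_emb [R p Qp K iK] V i : rename.
Arguments pl_cft [R p Qp K iK] V i : rename.

Section Weights.
Variables (R : realType) (p : nat) (Qp : padicField R p).
Variables (K : fieldType) (iK : {rmorphism K -> algC}) (V : pPlaces Qp iK).
Variables (E : fieldExtType Qp) (vE : nonarchAbs R E).

(* elements of K_p, and Q_p-linear maps K_p -> E, given by their components *)
Definition Kp := forall i : pl_idx V, pl_fld V i.
Definition KpHom := forall i : pl_idx V, {linear pl_fld V i -> E}.

Definition diagKp (x : K) : Kp := fun i => pl_emb V i x.
Definition logKp (u : Kp) : Kp := fun i => abs_log (pl_abs V i) (u i).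
Definition evalKp (k : KpHom) (u : Kp) : E := \sum_i k i (u i).

(* u in 1 + p^n (O_K tensor Z_p) *)
Definition deep_unit (n : nat) (u : Kp) : Prop :=
  forall i, pl_abs V i (u i - 1) <= pl_abs V i (p%:R ^+ n).

Definition prod_char (lam : forall i : pl_idx V, pl_fld V i -> E) (u : Kp) : E :=
  \prod_i lam i (u i).

Definition exp_formula (lamp : Kp -> E) (k : KpHom) (n : nat) : Prop :=
  forall u, deep_unit n u -> lamp u = abs_exp vE (- evalKp k (logKp u)).

(* T is the Q_p-linear extension of tau to K_p *)
Definition linear_extension (tau : K -> E) (T : KpHom) : Prop :=
  forall x, evalKp T (diagKp x) = tau x.

Definition has_weights (tau : K -> E) (c : K -> K) (k : KpHom) (a b : E) : Prop :=
  exists T Tc : KpHom,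
    [/\ linear_extension tau T, linear_extension (tau \o c) Tc
      & forall u, evalKp k u = a * evalKp T u + b * evalKp Tc u].

(* convergence and injectivity conditions on the closed rigid disc
   |t - 1| <= |p^h|, i.e. on its points over all finite extensions of E *)
Definition depth_cvg (h : nat) (a b : E) : Prop :=
  forall (M : fieldExtType E) (w : nonarchAbs R M),
    abs_extends (fun x : E => x%:A : M) vE w ->
  let disc1 := [set t : M | w (t - 1) <= w (p%:R ^+ h)] in
  let disc0 := [set z : M | w z <= w (p%:R ^+ h)] in
  [/\ forall t, disc1 t -> exists l, abs_cvg w (log_sums t) l,
      forall z, disc0 z -> exists l, abs_cvg w (exp_sums z) l,
      {in disc1 &, injective (abs_log w)},
      {in disc0 &, injective (abs_exp w)}
    & forall s, s \in [:: a; b; (a + b) / 2%:R; (a - b) / 2%:R] ->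
        forall t, disc1 t -> exists l, abs_cvg w (exp_sums (s *: abs_log w t)) l].

End Weights.

Arguments diagKp [R p Qp K iK] V x i.

Section Families.
Variables (R : realType) (p : nat) (Qp : padicField R p).
Variables (K : fieldType) (iK : {rmorphism K -> algC}) (V : pPlaces Qp iK).
Variables (E : fieldExtType Qp) (chi : (algC -> algC) -> E).
Variables (c : K -> K) (m : set K).

Definition is_representative_list (J : nat) (aid : 'I_J -> set K) : Prop :=
  [/\ forall j, is_frac_ideal (aid j) /\ prime_to_pm p m (aid j),
      forall I, is_frac_ideal I -> prime_to_pm p m I ->
        exists j x, ray_generator p m x /\
          I = ideal_mul (principal_ideal (integers K) x) (aid j)
    & forall j, exists j', c @` aid j = aid j'].

Definition admissible_generator (I : set K) (x : K) : Prop :=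
  ray_generator p m x /\
  exists (l : nat) (P : set K),
    [/\ [/\ prime l, splits_at K l & Ind_unramified_at iK chi l],
        is_prime P, P l%:R, ~ divides_pm p m P
      & principal_ideal (integers K) x = ideal_div P I].

(* X is the class of admissible generators for I modulo
   1 + p^h (O_K tensor Z_p) that contains x0 *)
Definition generator_class (h : nat) (I : set K) (X : set K) (x0 : K) : Prop :=
  X x0 /\ forall x, X x <->
    [/\ admissible_generator I x, admissible_generator I x0
      & deep_unit h (diagKp V (x / x0))].

End Families.

Section Affinoid.
Variables (R : realType) (L : fieldType) (v : nonarchAbs R L).

(* formal power series in n variables, by multi-indexed coefficients *)
Definition mindex (n : nat) := {ffun 'I_n -> nat}.
Definition series (n : nat) := mindex n -> L.
Definition mdegree n (nu : mindex n) : nat := (\sum_i nu i)%N.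

(* membership in the Tate algebra *)
Definition restricted n (s : series n) : Prop :=
  forall e : R, 0 < e -> exists N, forall nu, (N <= mdegree nu)%N -> v (s nu) < e.

Definition series_one n : series n := fun nu => (nu == [ffun=> 0%N])%:R.

(* Cauchy product *)
Definition series_mul n (s t : series n) : series n := fun nu =>
  \sum_(mu : {ffun 'I_n -> 'I_(mdegree nu).+1} | [forall i, (mu i <= nu i)%N])
     s [ffun i => mu i : nat] * t [ffun i => (nu i - mu i)%N].

(* phi restricts to a surjective homomorphism of L-algebras from the Tate algebra
   in n variables onto A; its values on other series are irrelevant *)
Definition tate_presentation n (A : comAlgType L) (phi : series n -> A) : Prop :=
  [/\ phi (@series_one n) = 1,
      forall x s t, restricted s -> restricted t ->
        phi (fun nu => x * s nu + t nu) = x *: phi s + phi t,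
      forall s t, restricted s -> restricted t ->
        phi (series_mul s t) = phi s * phi t
    & forall y, exists2 s, restricted s & phi s = y].

Definition is_affinoid (A : comAlgType L) : Prop :=
  exists n (phi : series n -> A), tate_presentation phi.

(* the points of Sp A; the map Sp B -> Sp A induced by f : A -> B is M |-> f @^-1` M *)
Definition Sp (A : comAlgType L) : set (set A) := [set M | is_maximal_ideal setT M].

(* U is the affinoid subdomain of Sp A represented by f : A -> A' *)
Definition represents_subdomain (A : comAlgType L) (U : set (set A))
    (A' : comAlgType L) (f : {lrmorphism A -> A'}) : Prop :=
  [/\ is_affinoid A',
      forall M, Sp M -> U (f @^-1` M)
    & forall (B : comAlgType L) (g : {lrmorphism A -> B}), is_affinoid B ->
        (forall M, Sp M -> U (g @^-1` M)) ->
        exists2 k : {lrmorphism A' -> B}, (forall x, k (f x) = g x)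
          & forall k' : {lrmorphism A' -> B}, (forall x, k' (f x) = g x) -> k' =1 k].

Definition affinoid_subdomain (A : comAlgType L) (U : set (set A)) : Prop :=
  U `<=` @Sp A /\
  exists (A' : comAlgType L) (f : {lrmorphism A -> A'}), represents_subdomain U f.

(* admissible open subsets of the affinoid space Sp A (strong G-topology) *)
Definition admissible_open (A : comAlgType L) (W : set (set A)) : Prop :=
  exists CU : set (set (set A)),
    [/\ forall U, CU U -> affinoid_subdomain U,
        W = [set M | exists2 U, CU U & U M]
      & forall (B : comAlgType L) (g : {lrmorphism A -> B}), is_affinoid B ->
          (forall M, Sp M -> W (g @^-1` M)) ->
          exists n (D : 'I_n -> set (set B)),
            [/\ forall i, affinoid_subdomain (D i),
                forall M, @Sp B M -> exists i, D i M
              & forall i, exists2 U, CU U & forall M, D i M -> U (g @^-1` M)]].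

(* the restriction of x to W is the zero section of the structure sheaf *)
Definition vanishes_on (A : comAlgType L) (W : set (set A)) (x : A) : Prop :=
  forall (U : set (set A)) (A' : comAlgType L) (f : {lrmorphism A -> A'}),
    U `<=` @Sp A -> represents_subdomain U f -> U `<=` W -> f x = 0.

End Affinoid.

Section PlaneCurves.
Variable L : fieldType.

(* {poly {poly L}} is L[x][y]: the outer variable is y *)
Definition eval2 (A : comNzRingType) (i : {rmorphism L -> A}) (x y : A)
    (g : {poly {poly L}}) : A :=
  (map_poly (fun u => (map_poly i u).[x]) g).[y].

Definition irreducible_elt (D : idomainType) (g : D) : Prop :=
  [/\ g != 0, g \isn't a GRing.unit
    & forall u w, g = u * w -> u \is a GRing.unit \/ w \is a GRing.unit].

(* the function field of the integral curve f = 0, i.e. the fraction field of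
   L[x,y]/(f), with its coordinate functions *)
Record functionField (f : {poly {poly L}}) := FunctionField {
  ff_sort :> fieldType;
  ff_inc : {rmorphism L -> ff_sort};
  ff_x : ff_sort;
  ff_y : ff_sort;
  ff_ker : forall g, eval2 ff_inc ff_x ff_y g = 0 <-> exists k, g = f * k;
  ff_frac : forall z, exists g k, eval2 ff_inc ff_x ff_y k != 0 /\
    z = eval2 ff_inc ff_x ff_y g / eval2 ff_inc ff_x ff_y k }.

Definition constant_on_curve f (FC : functionField f) (z : FC) : Prop :=
  algebraicOver (ff_inc FC) z.

(* the polynomial f in the coordinates X = (x - 1)/d, Y = (y - 1)/d of the bidisc *)
Definition bidisc_series (d : L) (f : {poly {poly L}}) : series L 2 :=
  fun nu =>
    ((map_poly (fun u => u \Po (1 + d *: 'X)) f \Po (1 + d%:P *: 'X))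
       `_(nu ord_max))`_(nu ord0).

(* A is the affinoid algebra of the intersection of the analytification of f = 0
   with the bidisc, presented as the quotient of the Tate algebra in X, Y by f *)
Definition curve_bidisc_algebra (R : realType) (v : nonarchAbs R L) (d : L)
    (f : {poly {poly L}}) (A : comAlgType L) (phi : series L 2 -> A) : Prop :=
  tate_presentation v phi /\
  forall s, restricted v s ->
    (phi s = 0 <->
     exists2 t, restricted v t & s = series_mul (bidisc_series d f) t).

End PlaneCurves.

Section Phi.
Variable E : fieldType.

(* coefficient of T^k in (1 + T)^s = exp (s log (1 + T)); log (1 + T) may be
   truncated after degree k *)
Definition log_poly (k : nat) : {poly E} :=
  \sum_(1 <= n < k.+1) ((-1) ^+ n.+1 / n%:R) *: 'X^n.
Definition pow_coef (s : E) (k : nat) : E :=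
  \sum_(0 <= n < k.+1) ((s *: log_poly k) ^+ n)`_k / n`!%:R.

(* A x^a y^b + B x^b y^a - r expanded in X = (x - 1)/d, Y = (y - 1)/d *)
Definition Phi_series (A B a b : E) (r : int) (d : E) : series E 2 := fun nu =>
  let i := nu ord0 in let j := nu ord_max in
  d ^+ (i + j) * (A * pow_coef a i * pow_coef b j + B * pow_coef b i * pow_coef a j)
  - r%:~R * series_one E nu.

Definition is_rational (x : E) : Prop := exists q : rat, x = ratr q.

End Phi.

Definition series_base_change (E : fieldType) (L : fieldExtType E) (n : nat)
  (s : series E n) : series L n := fun nu => (s nu)%:A.

(* Main.v *)
(** Put x = 1 + dX, y = 1 + dY with d = p^h, and let U = x^a y^b, W = x^b y^a in
    the Tate algebra T, so that A U + B W = r on Omega.  At a point M of Omega the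
    identity holds modulo all powers of M, since Sp (O / M^N) is a single point.  The
    derivation D = f_y d/dx - f_x d/dy preserves the resulting ideal q of T, and
    differentiating A U + B W = r once gives a linear system that determines U and W
    as rational functions of x and y modulo q, unless
    E1 = a y f_y - b x f_x and E2 = b y f_y - a x f_x agree on C; differentiating
    these expressions again gives identities between polynomials modulo q.  A
    polynomial in q is divisible by f: otherwise q would contain nonzero polynomials
    in x alone and in y alone, which the leading form of f at M forbids.

    So in the function field of C the quantities u/w and uw (up to constants)
    satisfy D(u/w)/(u/w) = (a - b) D(x/y)/(x/y) and D(uw)/(uw) = (a + b) D(xy)/(xy).
    If q'/q = s v'/v with v transcendental over L and q algebraic over L(v), then s is
    rational: the constant term c of the minimal polynomial of q, of degree n, satisfies
    c'/c = n s v'/v, and one compares orders of vanishing at v = 0.  In the remaining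
    cases E1 = E2 = 0 on C, and x/y or xy has derivative zero. *)

Require Import Defs.
From HB Require Import structures.
From mathcomp Require Import all_boot all_order all_algebra all_fingroup all_field.
From mathcomp Require Import boolp classical_sets reals.
From mathcomp Require Import ring zify.
Import Order.TTheory GRing.Theory Num.Theory.
Local Open Scope classical_set_scope.
Local Open Scope ring_scope.

Set Implicit Arguments.
Unset Strict Implicit.
Unset Printing Implicit Defensive.

(** * Derivations and evaluation of bivariate polynomials *)

(** The curve may be singular or have several branches at M, and the residue ring there may be
    larger than L. So q ([local_zero]) is not known to be prime, no function field of the germ is
    formed, and U and W are never adjoined to the function field of C. They enter only through their
    differential equations x U_x = a U, y U_y = b U (and the exchanged ones for W) and their
    invertibility. Once they are eliminated, a polynomial identity modulo q becomes an exact
    identity on C, where r E2 / (A G) and - r E1 / (B G), with G = E2 - E1, play the roles of U and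
    W.

    The arithmetic data enter through the nonvanishing of A and B, whose factors have absolute value
    1 or are products of such values, and through the depth h. The depth conditions speak of exp (s
    log t), while membership in the Tate algebra is about binomial series. The conversion rests on
    |log (1 + p^h)| = |p^h|, which is where p must be odd. *)

Definition derivation (R : comNzRingType) (d : R -> R) : Prop :=
  {morph d : u v / u + v} /\ forall u v, d (u * v) = d u * v + u * d v.

Section Derivations.
Variables (R : comNzRingType) (d : R -> R).
Hypothesis dd : derivation d.

Lemma der0 : d 0 = 0.
Proof. by apply: (addrI (d 0)); rewrite -dd.1 !addr0. Qed.

Lemma der1 : d 1 = 0.
Proof. by apply: (addrI (d 1)); rewrite addr0 -{3}[1]mulr1 dd.2 mulr1 mul1r. Qed.

Lemma derN u : d (- u) = - d u.
Proof. by apply: (addrI (d u)); rewrite -dd.1 !subrr der0. Qed.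

Lemma derB u v : d (u - v) = d u - d v.
Proof. by rewrite dd.1 derN. Qed.

Lemma derX u n : d (u ^+ n) = n%:R * u ^+ n.-1 * d u.
Proof.
elim: n => [|n IH]; first by rewrite expr0 der1 mul0r mul0r.
rewrite exprS dd.2 IH -natr1; case: n {IH} => [|n] /=; first by rewrite !expr0; ring.
by rewrite exprS; ring.
Qed.

Lemma der_sum I (r : seq I) (P : pred I) (F : I -> R) :
  d (\sum_(i <- r | P i) F i) = \sum_(i <- r | P i) d (F i).
Proof. by apply: (big_morph d dd.1 der0). Qed.

Lemma der_nat n : d n%:R = 0.
Proof. by elim: n => [|n IH]; rewrite ?der0 // -natr1 dd.1 IH der1 addr0. Qed.

Lemma derivation_scale (a : R) : derivation (fun u => a * d u).
Proof. by split=> u v; rewrite ?dd.1 ?dd.2; ring. Qed.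

End Derivations.

Lemma derivation_comb (R : comNzRingType) (a b : R) (d e : R -> R) :
  derivation d -> derivation e -> derivation (fun u => a * d u + b * e u).
Proof.
by move=> dd de; split=> u v; rewrite ?dd.1 ?de.1 ?dd.2 ?de.2; ring.
Qed.

Lemma der_horner_map (L : fieldType) (A : comNzRingType) (i : {rmorphism L -> A})
    (d : A -> A) : derivation d -> (forall c, d (i c) = 0) ->
  forall u x, d (map_poly i u).[x] = d x * (map_poly i u^`()).[x].
Proof.
move=> dd di; elim/poly_ind => [|u c IHu] x.
  by rewrite deriv0 !raddf0 !horner0 mulr0 (der0 dd).
rewrite derivD derivM derivX derivC addr0 mulr1 !rmorphD !rmorphM /= map_polyX map_polyC /=.
by rewrite !hornerE /= dd.1 dd.2 IHu di; ring.
Qed.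

Section Eval2.
Variables (L : fieldType) (A : comNzRingType) (i : {rmorphism L -> A}) (x y : A).
Local Notation ev := (eval2 i x y).

Lemma eval2_is_zmod_morphism : zmod_morphism ev.
Proof.
pose h := horner_eval x \o map_poly i.
move=> g k; rewrite /eval2.
by rewrite (raddfB (map_poly h)) hornerD hornerN.
Qed.
Lemma eval2_is_monoid_morphism : monoid_morphism ev.
Proof.
pose h := horner_eval x \o map_poly i.
rewrite /eval2; split=> [|g k]; first by rewrite (rmorph1 (map_poly h)) hornerC.
by rewrite (rmorphM (map_poly h)) hornerM.
Qed.
HB.instance Definition _ := GRing.isZmodMorphism.Build _ _ ev eval2_is_zmod_morphism.
HB.instance Definition _ := GRing.isMonoidMorphism.Build _ _ ev eval2_is_monoid_morphism.

Lemma eval2D g k : ev (g + k) = ev g + ev k. Proof. exact: rmorphD. Qed.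
Lemma eval2B g k : ev (g - k) = ev g - ev k. Proof. exact: rmorphB. Qed.
Lemma eval2M g k : ev (g * k) = ev g * ev k. Proof. exact: rmorphM. Qed.
Lemma eval2N g : ev (- g) = - ev g. Proof. exact: rmorphN. Qed.
Lemma eval2_0 : ev 0 = 0. Proof. exact: rmorph0. Qed.
Lemma eval2_1 : ev 1 = 1. Proof. exact: rmorph1. Qed.

Lemma eval2_polyC u : ev u%:P = (map_poly i u).[x].
Proof.
pose h := horner_eval x \o map_poly i.
by rewrite /eval2 (map_polyC h) hornerC.
Qed.
Lemma eval2_const c : ev c%:P%:P = i c.
Proof. by rewrite eval2_polyC map_polyC hornerC. Qed.
Lemma eval2_X : ev 'X%:P = x.
Proof. by rewrite eval2_polyC map_polyX hornerX. Qed.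
Lemma eval2_Y : ev 'X = y.
Proof.
pose h := horner_eval x \o map_poly i.
by rewrite /eval2 (map_polyX h) hornerX.
Qed.
Lemma eval2_map_polyC (u : {poly L}) : ev (map_poly polyC u) = (map_poly i u).[y].
Proof.
pose h := horner_eval x \o map_poly i.
rewrite /eval2 -[map_poly _ _]/(map_poly h (map_poly polyC u)) -map_poly_comp.
by congr (_.[_]); apply: eq_map_poly => c /=; rewrite /h /= map_polyC /horner_eval hornerC.
Qed.
Lemma eval2_sum g : ev g = \sum_(j < size g) (map_poly i g`_j).[x] * y ^+ j.
Proof.
rewrite [in LHS](_ : g = \sum_(j < size g) g`_j *: 'X^j); last first.
  by rewrite -poly_def coefK.
rewrite rmorph_sum; apply: eq_bigr => j _.
by rewrite -mul_polyC rmorphM rmorphXn /= eval2_Y eval2_polyC.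
Qed.

Definition pderX (g : {poly {poly L}}) : {poly {poly L}} := map_poly (@deriv L) g.

Lemma pderX_derivation : derivation pderX.
Proof.
split=> g k; rewrite /pderX; first by rewrite raddfD.
apply/polyP => n; rewrite coefD coef_map /= !coefM -big_split raddf_sum /=.
by apply: eq_bigr => j _; rewrite derivM !coef_map.
Qed.

Lemma deriv_derivation (S : comNzRingType) : derivation (@deriv S).
Proof. by split=> g k; rewrite ?derivD ?derivM. Qed.

Lemma der_eval2 (d : A -> A) : derivation d -> (forall c, d (i c) = 0) ->
  forall g, d (ev g) = d x * ev (pderX g) + d y * ev g^`().
Proof.
move=> dd di; elim/poly_ind => [|g u IH].
  by rewrite deriv0 [pderX 0]raddf0 !(raddf0 ev) !mulr0 addr0 (der0 dd).
rewrite rmorphD rmorphM /= eval2_Y dd.1 dd.2 IH derivD derivM derivX derivC.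
rewrite addr0 mulr1 (pderX_derivation).1 (pderX_derivation).2.
have -> : pderX 'X = 0.
  by rewrite /pderX; apply/polyP=> k; rewrite coef_map coefX coef0 -(der_nat (deriv_derivation L) (k == 1%N)).
have -> : pderX u%:P = u^`()%:P by rewrite /pderX map_polyC.
rewrite mulr0 addr0 !rmorphD !rmorphM /= eval2_Y !eval2_polyC.
rewrite (der_horner_map dd di).
by ring.
Qed.

End Eval2.

Definition eval2E := (eval2B, eval2N, eval2D, eval2M, eval2_0, eval2_1).

Lemma rmorph_eval2 (L : fieldType) (A B : comNzRingType) (i : {rmorphism L -> A})
    (j : {rmorphism L -> B}) (h : {rmorphism A -> B}) x y g :
  (forall c, h (i c) = j c) -> h (eval2 i x y g) = eval2 j (h x) (h y) g.
Proof.
move=> hi; rewrite !eval2_sum rmorph_sum; apply: eq_bigr => k _.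
rewrite rmorphM rmorphXn -horner_map -map_poly_comp; congr (_.[_] * _).
exact: eq_map_poly.
Qed.

(** * Simple extensions and logarithmic derivatives *)

Section SimpleExtension.
Variables (L F : fieldType) (i : {rmorphism L -> F}) (z : F).
Local Notation "p .{ z }" := (map_poly i p).[z] (at level 2, left associativity).

(** The subfield L(z) of F, made into a field of its own so that minimal polynomials over it make
    sense. Denominators are required not to vanish at z, rather than to be nonzero, because z may be
    algebraic. *)
Definition simple_ext : {pred F} :=
  fun w => `[< exists P Q : {poly L}, Q.{z} != 0 /\ w = P.{z} / Q.{z} >].

Lemma simple_extP w : reflect
  (exists P Q : {poly L}, Q.{z} != 0 /\ w = P.{z} / Q.{z}) (w \in simple_ext).
Proof. exact: asboolP. Qed.

Lemma simple_ext_divring : divring_closed simple_ext.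
Proof.
split.
- by apply/simple_extP; exists 1, 1; rewrite rmorph1 hornerC oner_neq0 divr1.
- move=> _ _ /simple_extP[P [Q [Q0 ->]]] /simple_extP[P' [Q' [Q0' ->]]].
  apply/simple_extP; exists (P * Q' - P' * Q), (Q * Q').
  rewrite !rmorphB !rmorphM !hornerE mulf_neq0 //; split=> //.
  by field; rewrite Q0 Q0'.
- move=> _ _ /simple_extP[P [Q [Q0 ->]]] /simple_extP[P' [Q' [Q0' ->]]].
  have [P0|P0] := eqVneq P'.{z} 0.
    by apply/simple_extP; exists 0, 1; rewrite P0 (raddf0 (map_poly i)) rmorph1 !hornerE ?oner_neq0 !(mul0r, invr0, mulr0).
  apply/simple_extP; exists (P * Q'), (Q * P').
  rewrite !rmorphM !hornerE mulf_neq0 //; split=> //.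
  by field; rewrite Q0 Q0' P0.
Qed.

HB.instance Definition _ := GRing.isDivringClosed.Build F simple_ext simple_ext_divring.

Record ext_field := ExtField { ext_val : F; _ : ext_val \in simple_ext }.
HB.instance Definition _ := [isSub for ext_val].
HB.instance Definition _ := [Choice of ext_field by <:].
HB.instance Definition _ := [SubChoice_isSubComUnitRing of ext_field by <:].
HB.instance Definition _ := [SubComUnitRing_isSubIntegralDomain of ext_field by <:].
HB.instance Definition _ := [SubIntegralDomain_isSubField of ext_field by <:].

(** Locked, so that the inclusion is used only through [ext_incP] and [ext_of]. *)
Definition ext_inc : {rmorphism ext_field -> F} :=
  locked (val : {rmorphism ext_field -> F}).
Lemma ext_incP (w : ext_field) :
  exists P Q : {poly L}, Q.{z} != 0 /\ ext_inc w = P.{z} / Q.{z}.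
Proof. by rewrite /ext_inc -lock; apply/simple_extP; apply: valP. Qed.

Lemma ext_of (P Q : {poly L}) : Q.{z} != 0 -> exists w : ext_field, ext_inc w = P.{z} / Q.{z}.
Proof.
move=> Q0; have h : P.{z} / Q.{z} \in simple_ext by apply/simple_extP; exists P, Q.
by exists (ExtField h); rewrite /ext_inc -lock.
Qed.

Lemma ext_ofpoly (P : {poly L}) : exists w : ext_field, ext_inc w = P.{z}.
Proof.
by case: (@ext_of P 1); rewrite rmorph1 hornerC ?oner_neq0 // divr1 => w; exists w.
Qed.

End SimpleExtension.

Lemma algebraic_minpoly (F E : fieldType) (i : {rmorphism F -> E}) u :
  algebraicOver i u -> exists p, [/\ p \is monic, root (map_poly i p) u
    & forall q : {poly F}, (size q < size p)%N -> root (map_poly i q) u -> q = 0].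
Proof.
move=> [p0 p00 r0].
pose Q n := `[< exists p, [/\ p != 0, root (map_poly i p) u & size p = n] >].
have exQ : exists n, Q n by exists (size p0); apply/asboolP; exists p0.
case: (ex_minnP exQ) => n /asboolP[p [pn0 rp sp]] minn.
exists ((lead_coef p)^-1 *: p); split.
- by rewrite monicE lead_coefZ mulVf ?lead_coef_eq0.
- by rewrite map_polyZ rootE hornerZ (rootP rp) mulr0.
- move=> q; rewrite size_scale ?invr_eq0 ?lead_coef_eq0 // sp => sq rq.
  apply/eqP/negP => /negP q0; have : Q (size q) by apply/asboolP; exists q.
  by move/minn; rewrite leqNgt sq.
Qed.

Lemma size_deriv0 (S : idomainType) (p : {poly S}) :
  (forall n, n.+1%:R != 0 :> S) -> p^`() = 0 -> (size p <= 1)%N.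
Proof.
move=> S0 /polyP dp; rewrite leqNgt; apply/negP => sp.
have p0 : p != 0 by rewrite -size_poly_gt0 ltnW.
move: (dp (size p).-2); rewrite coef_deriv coef0 -subn2 -subSn // subn2 /= => /eqP.
by rewrite -mulr_natr mulf_eq0 -[_`_ _]/(lead_coef p) lead_coef_eq0 (negPf p0) -(subnKC sp) /= (negPf (S0 _)).
Qed.

Section CharZeroDerivations.
Variables (L F : fieldType) (i : {rmorphism L -> F}) (D : F -> F).
Hypotheses (L0 : forall n, n.+1%:R != 0 :> L) (dD : derivation D)
  (Di : forall c, D (i c) = 0).

(** Differentiating p(w) = 0 for the minimal polynomial p gives p'(w) D w = 0. If D w were nonzero,
    minimality would force p' = 0, so p would be constant in characteristic zero. *)
Lemma der_algebraic w : algebraicOver i w -> D w = 0.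
Proof.
move=> /algebraic_minpoly[p [pm rp minp]]; apply/eqP/negP => /negP Dw.
have := der_horner_map dD Di p w; rewrite (rootP rp) (der0 dD) => /esym/eqP.
rewrite mulf_eq0 (negPf Dw) /= => /(minp _ (lt_size_deriv (monic_neq0 pm))).
move/(size_deriv0 L0); rewrite leq_eqVlt ltnS leqn0 size_poly_eq0 (negPf (monic_neq0 pm)) orbF.
move=> /size_poly1P[c c0 pc]; move: rp; rewrite pc map_polyC rootC fmorph_eq0.
by rewrite (negPf c0).
Qed.

Section RationalExponent.
Variables (v q : F) (s : L).
Hypotheses (vt : ~ algebraicOver i v) (qa : algebraicOver (ext_inc i v) q)
  (q0 : q != 0) (Dv : D v != 0) (Dq : D q * v = i s * q * D v).

Let vt0 (P : {poly L}) : (map_poly i P).[v] = 0 -> P = 0.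
Proof. by move=> Pv; apply/eqP/negP => /negP P0; apply: vt; exists P => //; apply/eqP. Qed.

(** Normalised so that v has derivative 1: on L(v) this is formal differentiation with respect to
    v. *)
Let D' w := D w / D v.
Let dD' : derivation D'.
Proof. by split=> u w; rewrite /D' ?dD.1 ?dD.2; ring. Qed.

Let v0 : v != 0.
Proof. by apply/eqP => vz; apply: vt; rewrite vz; apply: algebraic0. Qed.

Lemma der_ext_closed (c : ext_field i v) : exists c' : ext_field i v, ext_inc i v c' = D' (ext_inc i v c).
Proof.
have [P [Q [Q0 cE]]] := ext_incP c.
have [|c' c'E] := @ext_of _ _ i v (P^`() * Q - P * Q^`()) (Q * Q).
  by rewrite rmorphM hornerM mulf_neq0.
exists c'; rewrite c'E cE.
have D'P (S : {poly L}) : D' (map_poly i S).[v] = (map_poly i S^`()).[v].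
  by rewrite /D' (der_horner_map dD Di) mulrAC divff // mul1r.
have E : D' ((map_poly i P).[v] / (map_poly i Q).[v]) * (map_poly i Q).[v] =
   (map_poly i P^`()).[v] - (map_poly i P).[v] / (map_poly i Q).[v] * (map_poly i Q^`()).[v].
  by rewrite -!D'P -[in RHS](divfK Q0 (map_poly i P).[v]) [in RHS]dD'.2 divfK // [X in _ = _ + X - _]mulrC; ring.
apply: (mulIf Q0); rewrite E rmorphB !rmorphM /= !hornerE.
by field.
Qed.

(** The denominator is the degree d of q over L(v), and the numerator is the order at v = 0 of the
    constant term of its minimal polynomial. *)
Lemma rational_exponent : exists (n : nat) (m : int), n.+1%:R * s = m%:~R.
Proof.
have [p [pm rp minp]] := algebraic_minpoly qa.
set j := ext_inc i v in rp minp.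
have [c' c'E] := choice der_ext_closed.
have sp1 : (1 < size p)%N.
  rewrite ltnNge; apply/negP => sp; have := size1_polyC sp => pE; move: rp.
  move: pm; rewrite pE map_polyC rootC fmorph_eq0 monicE lead_coefC => /eqP ->.
  by rewrite oner_eq0.
pose d := (size p).-1.
have [vi viE] := ext_ofpoly i v 'X; rewrite map_polyX hornerX in viE.
have [si siE] := ext_ofpoly i v s%:P; rewrite map_polyC hornerC in siE.
rewrite -/j in viE siE.
(* Since q^k has derivative k (s / v) q^k, r(q) is the derivative of p(q) = 0 minus d (s / v) p(q).
   The subtraction cancels the term of degree d, because p is monic, so minimality gives r = 0 and
   hence the equation for the constant term. *)
pose r := \poly_(k < size p) (c' p`_k + (k%:R - d%:R) * (si / vi) * p`_k).
have rq : root (map_poly j r) q.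
  have pq : \sum_(k < size p) j p`_k * q ^+ k = 0.
    rewrite -[RHS](rootP rp) horner_coef size_map_poly; apply: eq_bigr => k _.
    by rewrite coef_map.
  have D'q : D' q = i s * q / v.
    by rewrite /D' -[D q](mulfK v0) Dq; field; rewrite v0 Dv.
  rewrite rootE (horner_coef_wide _ (n := size p)); last first.
    by rewrite size_map_poly size_poly.
  apply/eqP; transitivity (D' 0 - d%:R * (i s / v) * 0); last first.
    by rewrite (der0 dD') mulr0 subr0.
  rewrite -[in D' _]pq -[X in _ - _ * X]pq (der_sum dD') mulr_sumr -sumrB.
  apply: eq_bigr => k _; rewrite coef_map coef_poly ltn_ord /=.
  rewrite rmorphD !rmorphM rmorphB !rmorph_nat /= fmorphV c'E dD'.2 (derX dD') D'q viE siE.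
  case: (k : nat) => [|m]; first by rewrite !mulr0n; ring.
  by rewrite exprS /=; ring.
have sr : (size r < size p)%N.
  rewrite -[X in (_ < X)%N](prednK (ltnW sp1)) ltnS -/d; apply/leq_sizeP => k.
  rewrite leq_eqVlt => /orP[/eqP <-|dk]; rewrite coef_poly; last first.
    by case: ltnP => //; rewrite -(prednK (ltnW sp1)) ltnS leqNgt dk.
  rewrite subrr !mul0r addr0 prednK ?leqnn ?(ltnW sp1) //.
  apply: (fmorph_inj j); rewrite c'E rmorph0.
  by rewrite -[p`_d]/(lead_coef p) (monicP pm) rmorph1 (der1 dD').
have /polyP/(_ 0%N) := minp r sr rq.
rewrite coef_poly (ltnW sp1) coef0 => /(congr1 j).
rewrite rmorphD !rmorphM rmorphB !rmorph_nat /= fmorphV c'E viE siE rmorph0 sub0r.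
(* Otherwise p / X would be a shorter polynomial vanishing at q, which is nonzero. *)
have p00 : p`_0 != 0.
  apply/eqP => p0.
  have pX : p = (p %/ 'X) * 'X.
    by rewrite divpK // -['X]subr0 -polyC0 dvdp_XsubCl rootE horner_coef0 p0.
  have p1n : p %/ 'X != 0.
    by apply: contraTneq pm => h; rewrite pX h mul0r monicE lead_coef0 eq_sym oner_eq0.
  have := minp (p %/ 'X); rewrite [in size p]pX size_mulX // ltnSn => /(_ isT) h.
  move: rp; rewrite pX rmorphM /= map_polyX rootM rootX (negPf q0) orbF => /h h'.
  by rewrite h' eqxx in p1n.
have [P [Q [Q0 pE]]] := ext_incP p`_0; rewrite -/j in pE.
have P0 : (map_poly i P).[v] != 0.
  by apply: contra_neq p00 => h; apply: (fmorph_inj j); rewrite pE h mul0r rmorph0.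
rewrite pE => E.
have D'P (S : {poly L}) : D' (map_poly i S).[v] = (map_poly i S^`()).[v].
  by rewrite /D' (der_horner_map dD Di) mulrAC divff // mul1r.
have E1 : D' ((map_poly i P).[v] / (map_poly i Q).[v]) * (map_poly i Q).[v] =
   (map_poly i P^`()).[v] - (map_poly i P).[v] / (map_poly i Q).[v] * (map_poly i Q^`()).[v].
  by rewrite -!D'P -[in RHS](divfK Q0 (map_poly i P).[v]) [in RHS]dD'.2 divfK // [X in _ = _ + X - _]mulrC; ring.
(* With P / Q the constant term as a function of v, the relation holds at the transcendental element
   v and is therefore an identity of polynomials. *)
have E2 : P^`() * Q * 'X - P * Q^`() * 'X - (d%:R * s)%:P * P * Q = 0.
  apply: vt0; rewrite !rmorphB /= !hornerD !hornerN !rmorphM /= map_polyX map_polyC /= !hornerM.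
  rewrite hornerX hornerC rmorph_nat.
  move: E => /eqP; rewrite addr_eq0 => /eqP E; rewrite E in E1.
  move: E1 P0 Q0; set a := (map_poly i P).[v]; set b := (map_poly i Q).[v].
  set a' := (map_poly i P^`()).[v]; set b' := (map_poly i Q^`()).[v] => E1 P0 Q0.
  have -> : a' = - (- d%:R * (i s / v) * (a / b)) * b + a / b * b'.
    by rewrite -[LHS](subrK (a / b * b')) -E1.
  by rewrite map_polyC hornerC; field; rewrite v0 Q0.
have Pn : P != 0 by apply: contraNneq P0 => ->; rewrite raddf0 horner0.
have Qn : Q != 0 by apply: contraNneq Q0 => ->; rewrite raddf0 horner0.
have [m [P1]] := multiplicity_XsubC P 0; rewrite Pn polyC0 subr0 /= => P10 PE.
have [n [Q1]] := multiplicity_XsubC Q 0; rewrite Qn polyC0 subr0 /= => Q10 QE.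
exists d.-1, (m%:Z - n%:Z); rewrite prednK ?rmorphB /=; last first.
  by rewrite /d -subn1 subn_gt0.
have dX k : ('X^k)^`() * 'X = k%:R * 'X^k :> {poly L}.
  by rewrite derivXn; case: k => [|k]; rewrite ?mulr0n ?mul0r // exprSr mulrA -mulr_natl.
(* After removal of the powers of X, evaluation at 0 leaves (m - n - d s) P1(0) Q1(0) = 0, with both
   values nonzero. *)
have E3 : 'X^m * 'X^n * (m%:R * P1 * Q1 + P1^`() * Q1 * 'X - n%:R * P1 * Q1
    - P1 * Q1^`() * 'X - (d%:R * s)%:P * P1 * Q1) = 0.
  rewrite -[RHS]E2 PE QE !derivM.
  transitivity (P1^`() * 'X^m * (Q1 * 'X^n) * 'X + P1 * (Q1 * 'X^n) * (('X^m)^`() * 'X)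
    - P1 * 'X^m * Q1^`() * 'X^n * 'X - P1 * 'X^m * Q1 * (('X^n)^`() * 'X)
    - (d%:R * s)%:P * (P1 * 'X^m) * (Q1 * 'X^n)); last by ring.
  by rewrite !dX; ring.
move: E3 => /eqP; rewrite !mulf_eq0 -!size_poly_eq0 !size_polyXn /= size_poly_eq0 => /eqP.
move=> /(congr1 (horner_eval 0)); rewrite !(rmorphB, rmorphD, rmorphM, rmorph_nat, rmorph0) /=.
rewrite /horner_eval hornerX !hornerC !mulr0 => E4.
apply/eqP; rewrite eq_sym -subr_eq0; apply/eqP.
apply: (mulIf (mulf_neq0 P10 Q10)); rewrite mul0r -[RHS]E4; ring.
Qed.

End RationalExponent.
End CharZeroDerivations.

(** * Function fields of plane curves *)

Lemma eval2_swapXY (L : fieldType) (A : comNzRingType) (i : {rmorphism L -> A}) x y g :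
  eval2 i y x (swapXY g) = eval2 i x y g.
Proof.
elim/poly_ind: g => [|g u IH]; first by rewrite !raddf0.
rewrite !rmorphD !rmorphM /= IH swapXY_X eval2_X eval2_Y.
by rewrite swapXY_polyC eval2_map_polyC eval2_polyC.
Qed.

Section AlgebraicClosure.
Variables (K F : fieldType) (j : {rmorphism K -> F}).

Lemma algebraic_poly_root (g : {poly F}) w :
  g != 0 -> root g w -> (forall k, algebraicOver j g`_k) -> algebraicOver j w.
Proof.
move=> g0 rw ag; apply/integral_algebraic; apply: (integral_root g0 rw) => u.
by move=> /(nthP 0)[k _ <-]; apply/integral_algebraic.
Qed.

Lemma algebraic_sum I (r : seq I) (P : pred I) (G : I -> F) :
  (forall k, algebraicOver j (G k)) -> algebraicOver j (\sum_(k <- r | P k) G k).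
Proof.
move=> aG; elim/big_ind: _ => //; first exact: algebraic0.
exact: algebraic_add.
Qed.

Lemma algebraic_exp w n : algebraicOver j w -> algebraicOver j (w ^+ n).
Proof.
move=> aw; elim: n => [|n IH]; first exact: algebraic1.
by rewrite exprS; apply: algebraic_mul.
Qed.

Lemma algebraic_horner (L : fieldType) (i : {rmorphism L -> F}) (P : {poly L}) w :
  (forall c, algebraicOver j (i c)) -> algebraicOver j w ->
  algebraicOver j (map_poly i P).[w].
Proof.
move=> ai aw; rewrite horner_coef; apply: algebraic_sum => k.
rewrite coef_map; apply: algebraic_mul; first exact: ai.
exact: algebraic_exp.
Qed.

End AlgebraicClosure.

(** * Exchange property for algebraic dependence *)

Section Exchange.
Variables (L F : fieldType) (i : {rmorphism L -> F}).

Lemma algebraic_ext_base z c : algebraicOver (ext_inc i z) (i c).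
Proof.
by have [w] := ext_ofpoly i z c%:P; rewrite map_polyC hornerC => <-; apply: algebraic_id.
Qed.

Lemma algebraic_ext_gen z : algebraicOver (ext_inc i z) z.
Proof.
have [w] := ext_ofpoly i z 'X; rewrite map_polyX hornerX => wE.
by have := algebraic_id (ext_inc i z) w; rewrite wE.
Qed.

Lemma algebraic_ext_poly t z : algebraicOver (ext_inc i t) z ->
  exists2 H : {poly {poly L}}, H != 0 & eval2 i t z H = 0.
Proof.
move=> [p p0 rp].
have [N NE] := choice (@ext_incP _ _ i t).
have [M ME] := choice NE.
pose n := size p.
(* Denominators are cleared: each numerator is multiplied by the denominators of all other
   coefficients. *)
pose H := \poly_(k < n) (N p`_k * \prod_(l < n | l != k :> nat) M p`_l).
exists H.
  have n0 : (0 < n)%N by rewrite size_poly_gt0.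
  apply/eqP => /polyP/(_ n.-1)/eqP; rewrite coef0 coef_poly prednK // leqnn.
  rewrite mulf_eq0 => /orP[/eqP Nz|/eqP/(congr1 (fun u => (map_poly i u).[t]))/eqP].
    have [_] := ME p`_n.-1; rewrite Nz raddf0 horner0 mul0r => /eqP.
    by rewrite fmorph_eq0 -[_`_ _]/(lead_coef p) lead_coef_eq0 (negPf p0).
  rewrite raddf0 horner0 rmorph_prod horner_prod => /eqP/eqP/prodf_eq0[l _].
  by have [/negPf ->] := ME p`_l.
have -> : eval2 i t z H = (\prod_(l < n) (map_poly i (M p`_l)).[t]) * (map_poly (ext_inc i t) p).[z].
  rewrite horner_coef size_map_poly mulr_sumr -/n.
  rewrite /H poly_def rmorph_sum; apply: eq_bigr => k _.
  rewrite -mul_polyC rmorphM rmorphXn /= eval2_Y eval2_polyC rmorphM hornerM rmorph_prod horner_prod.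
  rewrite coef_map [in RHS](bigD1 k) //= (ME p`_k).2 mulrA; congr (_ * _).
  by rewrite [RHS]mulrC mulrA divfK //; apply: (ME _).1.
by rewrite (rootP rp) mulr0.
Qed.

(** A relation H(t, z) = 0 is read as an equation for t with coefficients in L[z]. It stays
    nontrivial because a nonzero polynomial over L cannot vanish at the transcendental z. *)
Lemma algebraic_exchange t z : ~ algebraicOver i z ->
  algebraicOver (ext_inc i t) z -> algebraicOver (ext_inc i z) t.
Proof.
move=> zt /algebraic_ext_poly[H H0 Hz].
pose g := map_poly (fun u => (map_poly i u).[z]) (swapXY H).
pose h := horner_eval z \o map_poly i.
have gE k : g`_k = (map_poly i (swapXY H)`_k).[z].
  by rewrite /g -[map_poly _ _]/(map_poly h _) coef_map.
apply: (@algebraic_poly_root _ _ _ g).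
- apply/eqP => /polyP g0.
  move: H0; rewrite -swapXY_eq0 => /negP; apply; apply/eqP/polyP => k.
  have := g0 k; rewrite gE !coef0 => uz; apply/eqP/negP => /negP un.
  by apply: zt; exists (swapXY H)`_k => //; apply/eqP.
- by apply/rootP; have := eval2_swapXY i t z H; rewrite Hz.
- move=> k; rewrite gE; apply: algebraic_horner; first exact: algebraic_ext_base.
  exact: algebraic_ext_gen.
Qed.

End Exchange.

Section FunctionField.
Variable L : fieldType.
Variables (f : {poly {poly L}}) (hf : irreducible_elt f) (FC : functionField f).
Local Notation ev := (eval2 (ff_inc FC) (ff_x FC) (ff_y FC)).
Local Notation inc := (ff_inc FC).

(** Transcendence degree at most one: t is x when x is transcendental, since f(x, Y) is then a
    nonzero polynomial killing y, and y otherwise. *)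
Lemma ff_gen : exists t : FC, forall w, algebraicOver (ext_inc inc t) w.
Proof.
suff [t [ax ay]] : exists t : FC, algebraicOver (ext_inc inc t) (ff_x FC) /\
    algebraicOver (ext_inc inc t) (ff_y FC).
  have aev g : algebraicOver (ext_inc inc t) (ev g).
    rewrite eval2_sum; apply: algebraic_sum => k; apply: algebraic_mul.
      by apply: algebraic_horner => // c; apply: algebraic_ext_base.
    exact: algebraic_exp.
  exists t => w; have [g [k [_ ->]]] := ff_frac w.
  exact: algebraic_div.
have [[p p0 rx]|nx] := pselect (algebraicOver inc (ff_x FC)).
  exists (ff_y FC); split; last exact: algebraic_ext_gen.
  apply: algebraic_poly_root rx _; first by rewrite map_poly_eq0.
  by move=> k; rewrite coef_map; apply: algebraic_ext_base.
exists (ff_x FC); split; first exact: algebraic_ext_gen.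
pose h := horner_eval (ff_x FC) \o map_poly inc.
apply: (@algebraic_poly_root _ _ _ (map_poly h f)).
- apply/eqP => /polyP h0; have [f0 _ _] := hf; move/eqP: f0; apply; apply/polyP => k.
  have := h0 k; rewrite coef_map !coef0 => uz; apply/eqP/negP => /negP un.
  by apply: nx; exists f`_k => //; apply/eqP.
- by apply/rootP; apply/(ff_ker FC f).2; exists 1; rewrite mulr1.
- move=> k; rewrite coef_map; apply: algebraic_horner; first exact: algebraic_ext_base.
  exact: algebraic_ext_gen.
Qed.

Lemma ff_algebraic (z : FC) : ~ algebraicOver inc z ->
  forall w, algebraicOver (ext_inc inc z) w.
Proof.
move=> zt w; have [t at_] := ff_gen.
have tz := algebraic_exchange zt (at_ z).
have [p p0 rp] := at_ w.
apply: algebraic_poly_root rp _; first by rewrite map_poly_eq0.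
move=> k; rewrite coef_map /=; have [P [Q [_ ->]]] := ext_incP p`_k.
by apply: algebraic_div; apply: algebraic_horner => // c; apply: algebraic_ext_base.
Qed.

(** The Hamiltonian vector field of f. It kills f, so it is tangent to the curve and involves no
    division, even at singular points. *)
Definition curve_der (g : {poly {poly L}}) := f^`() * pderX g - pderX f * g^`().

Lemma curve_der_derivation : derivation curve_der.
Proof.
have h := derivation_comb f^`() (- pderX f) (pderX_derivation L) (deriv_derivation _).
by split=> u v; rewrite /curve_der -!mulNr ?h.1 ?h.2.
Qed.

Lemma curve_der_ideal k : curve_der (f * k) = f * curve_der k.
Proof.
have f0 : curve_der f = 0 by rewrite /curve_der mulrC subrr.
by rewrite curve_der_derivation.2 f0 mul0r add0r.
Qed.

Lemma ev_eq0_der g : ev g = 0 -> ev (curve_der g) = 0.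
Proof.
by move=> /ff_ker[k ->]; rewrite curve_der_ideal; apply/ff_ker; exists (curve_der k).
Qed.

Lemma ff_derivation : exists D : FC -> FC,
  [/\ derivation D, forall c, D (inc c) = 0 & forall g, D (ev g) = ev (curve_der g)].
Proof.
have [N NE] := choice (@ff_frac _ _ FC).
have [M ME] := choice NE.
pose q g k := (ev (curve_der g) * ev k - ev g * ev (curve_der k)) / ev k ^+ 2.
pose D z := q (N z) (M z).
have dc := curve_der_derivation.
(* [D] is defined by the quotient rule on chosen representatives. Independence of the choice: g k' -
   g' k is a multiple of f, so its image under [curve_der] also vanishes on the curve. *)
have wd g k g' k' : ev k != 0 -> ev k' != 0 -> ev g / ev k = ev g' / ev k' ->
    q g' k' = q g k.
  move=> k0 M0 /eqP; rewrite eqr_div // => /eqP E0.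
  have E : ev (g * k' - g' * k) = 0 by rewrite !eval2E E0 subrr.
  rewrite /q; have := ev_eq0_der E; rewrite (derB dc) !dc.2.
  move: (curve_der g) (curve_der k) (curve_der g') (curve_der k') => dg dk dg' dk'.
  rewrite !eval2E => E2.
  have Eg : ev g = ev g' * ev k / ev k' by rewrite -E0 mulfK.
  rewrite Eg in E2 *.
  have Ed : ev dg = (ev dg' * ev k + ev g' * ev dk
       - ev g' * ev k / ev k' * ev dk') / ev k'.
    apply: (mulIf M0); rewrite divfK //; apply/eqP; rewrite -subr_eq0 -E2; apply/eqP.
    by ring.
  by rewrite Ed; field; rewrite M0 k0.
have DE g k : ev k != 0 -> D (ev g / ev k) = q g k.
  by move=> k0; apply: wd => //; [apply: (ME _).1|apply: (ME _).2].
have D1 g : D (ev g) = ev (curve_der g).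
  rewrite -[ev g]divr1 -[1](eval2_1 inc (ff_x FC) (ff_y FC)) DE ?eval2_1 ?oner_neq0 //.
  by rewrite /q (der1 dc) eval2_0 eval2_1 mulr0 subr0 mulr1 expr1n divr1.
exists D; split=> //.
  split=> u v; have [u0 uE] := ME u; have [v0 vE] := ME v.
    rewrite [in LHS]uE [in LHS]vE.
    rewrite (_ : _ + _ = ev (N u * M v + N v * M u) / ev (M u * M v)); last first.
      by rewrite !eval2E; field; rewrite u0 v0.
    rewrite DE ?eval2M ?mulf_neq0 // /q /D /q dc.1 !dc.2.
    move: (curve_der _) (curve_der _) (curve_der _) (curve_der _) => d1 d2 d3 d4.
    rewrite !eval2E; by field; rewrite u0 v0.
  rewrite [in LHS]uE [in LHS]vE.
  rewrite (_ : _ * _ = ev (N u * N v) / ev (M u * M v)); last first.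
    by rewrite !eval2E; field; rewrite u0 v0.
  rewrite DE ?eval2M ?mulf_neq0 // [in RHS]uE [in RHS]vE !DE //.
  rewrite /q !dc.2.
  move: (curve_der _) (curve_der _) (curve_der _) (curve_der _) => d1 d2 d3 d4.
  rewrite !eval2E; by field; rewrite u0 v0.
move=> c; rewrite -(eval2_const inc (ff_x FC) (ff_y FC)) D1 /curve_der derivC.
by rewrite /pderX map_polyC /= derivC !mulr0 subrr eval2_0.
Qed.

End FunctionField.

Section FunctionFieldDerivation.
Variables (L : fieldType) (L0 : forall n, n.+1%:R != 0 :> L).
Variables (f : {poly {poly L}}) (hf : irreducible_elt f) (FC : functionField f).
Local Notation ev := (eval2 (ff_inc FC) (ff_x FC) (ff_y FC)).
Local Notation inc := (ff_inc FC).

(** Generic smoothness in characteristic zero. If f divides f_y, comparing degrees in y gives f_y =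
    0, so f is a polynomial in x. If it also divides its x-derivative, it is a nonzero constant,
    hence a unit. *)
Lemma ff_smooth : ~ (ev f^`() = 0 /\ ev (pderX f) = 0).
Proof.
have [f0 fu _] := hf.
case=> /ff_ker[k fk] /ff_ker[l fl].
have f'0 : f^`() = 0.
  apply/eqP/negP => /negP f'n.
  have := lt_size_deriv f0; rewrite fk ltnNge; case/negP.
  have k0 : k != 0 by apply: contraNneq f'n => k0; rewrite fk k0 mulr0.
  by rewrite size_mul // -(prednK (n := size k)) ?size_poly_gt0 // addnS /= leq_addr.
have LP0 n : n.+1%:R != 0 :> {poly L} by rewrite -polyC_natr polyC_eq0.
have fE := size1_polyC (size_deriv0 LP0 f'0).
move: f0 fu fl; rewrite {}fE; set u := f`_0 => f0 fu fl.
rewrite polyC_eq0 in f0.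
have u'0 : u^`() = 0.
  have u'E : u^`() = u * l`_0.
    by move/polyP/(_ 0%N): fl; rewrite /pderX map_polyC /= coefC eqxx coefCM.
  apply/eqP/negP => /negP u'n.
  have := lt_size_deriv f0; rewrite u'E ltnNge; case/negP.
  have k0 : l`_0 != 0 by apply: contraNneq u'n => k0; rewrite u'E k0 mulr0.
  by rewrite size_mul // -(prednK (n := size l`_0)) ?size_poly_gt0 // addnS /= leq_addr.
have uE := size1_polyC (size_deriv0 L0 u'0).
case/negP: fu; rewrite uE rmorph_unit // rmorph_unit // unitfE.
by move: f0; rewrite {1}uE polyC_eq0.
Qed.

(** If z were transcendental, D would vanish on L(z), over which the whole function field is
    algebraic, and so D would be zero. *)
Lemma ff_der_eq0 (D : FC -> FC) (z : FC) : derivation D -> (forall c, D (inc c) = 0) ->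
  (exists w, D w != 0) -> D z = 0 -> algebraicOver inc z.
Proof.
move=> dD Di [w Dw] Dz; have [//|zt] := pselect (algebraicOver inc z).
have Dext c : D (ext_inc inc z c) = 0.
  have [P [Q [Q0 cE]]] := ext_incP c.
  have h : ext_inc inc z c * (map_poly inc Q).[z] = (map_poly inc P).[z] by rewrite cE divfK.
  move: (congr1 D h); rewrite dD.2 !(der_horner_map dD Di) Dz !mul0r mulr0 addr0.
  by move/eqP; rewrite mulf_eq0 (negPf Q0) orbF => /eqP.
have K0 n : n.+1%:R != 0 :> ext_field inc z.
  rewrite -(fmorph_eq0 (ext_inc inc z)) rmorph_nat.
  by rewrite -(rmorph_nat inc) fmorph_eq0.
by have := der_algebraic K0 dD Dext (ff_algebraic hf zt w) => /eqP; rewrite (negPf Dw).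
Qed.

Definition poly2C : {rmorphism L -> {poly {poly L}}} := polyC \o polyC.

(** A substitute for the resultant: when T is transcendental on the curve, g is algebraic over L(T),
    and the constant coefficient of its equation, a polynomial in T, lies in the ideal (g, f). *)
Lemma ff_elim g T : ev g != 0 -> exists (rho : {poly L}) al be,
  rho != 0 /\ (map_poly poly2C rho).[T] = g * be + f * al.
Proof.
move=> g0.
have evC c : ev (poly2C c) = inc c by rewrite /poly2C /= eval2_const.
have evh (rho : {poly L}) : ev (map_poly poly2C rho).[T] = (map_poly inc rho).[ev T].
  by rewrite -horner_map -map_poly_comp; congr (_.[_]); apply: eq_map_poly => c; apply: evC.
suff [rho [be [r0 E]]] : exists (rho : {poly L}) be, rho != 0 /\
    (map_poly inc rho).[ev T] = ev (g * be).
  have /ff_ker[al alE] : ev ((map_poly poly2C rho).[T] - g * be) = 0.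
    by rewrite eval2B evh E subrr.
  by exists rho, al, be; split=> //; rewrite -alE; ring.
have [[p p0 /rootP rp]|tt] := pselect (algebraicOver inc (ev T)).
  by exists p, 0; rewrite mulr0 rp raddf0.
have [H H0 HE] := algebraic_ext_poly (ff_algebraic hf tt (ev g)).
(* The outer variable of H stands for g, which is nonzero on the curve. Dividing by its highest
   power leaves a relation with nonzero constant coefficient [H1.[0]], the required polynomial in
   T. *)
have [m [H1]] := multiplicity_XsubC H 0.
rewrite H0 polyC0 subr0 /= => H10 Hm.
have {}HE : eval2 inc (ev T) (ev g) H1 = 0.
  move: HE; rewrite Hm eval2M rmorphXn /= eval2_Y => /eqP.
  by rewrite mulf_eq0 expf_eq0 (negPf g0) andbF orbF => /eqP.
have [H2 H2E] : exists H2, H1 = H2 * 'X + H1.[0]%:P.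
  have /factor_theorem[H2] : root (H1 - H1.[0]%:P) 0.
    by rewrite rootE hornerD hornerN hornerC subrr.
  by rewrite polyC0 subr0 => h; exists H2; rewrite -h subrK.
exists H1.[0], (- eval2 poly2C T g H2); split=> //.
move: HE; rewrite {1}H2E !eval2E eval2_Y eval2_polyC => /eqP.
rewrite addrC addr_eq0 => /eqP ->.
rewrite mulrN.
have -> := rmorph_eval2 (i := poly2C) (j := inc) (h := ev) T g H2 evC.
by rewrite mulrC.
Qed.

End FunctionFieldDerivation.

(** * Powers of ideals *)

(** Generated inductively rather than by finite sums of products, so that each closure property is
    an induction. The zeroth power is the whole ring. *)
Inductive ideal_pow (R : comNzRingType) (I : set R) : nat -> R -> Prop :=
| ideal_pow0 u : ideal_pow I 0 u
| ideal_powM N a u : I a -> ideal_pow I N u -> ideal_pow I N.+1 (a * u)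
| ideal_powD N u v : ideal_pow I N.+1 u -> ideal_pow I N.+1 v -> ideal_pow I N.+1 (u + v)
| ideal_pow_0 N : ideal_pow I N.+1 0.

Section IdealPow.
Variables (R : comNzRingType) (I : set R).

Lemma ideal_pow_add N u v : ideal_pow I N u -> ideal_pow I N v -> ideal_pow I N (u + v).
Proof. by case: N => [*|N]; [apply: ideal_pow0 | apply: ideal_powD]. Qed.

Lemma ideal_pow_mul N c u : ideal_pow I N u -> ideal_pow I N (c * u).
Proof.
move=> Iu; elim: Iu c => [v c|n a v Ia _ IH c|n v w _ IHv _ IHw c|n c].
- exact: ideal_pow0.
- by rewrite mulrCA; apply: ideal_powM.
- by rewrite mulrDr; apply: ideal_powD.
- by rewrite mulr0; apply: ideal_pow_0.
Qed.

Lemma ideal_powS N u : ideal_pow I N.+1 u -> ideal_pow I N u.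
Proof.
move nE : N.+1 => n Iu; elim: Iu N nE => // {n} [n a v Ia Iv _ N [->]|n v w _ IHv _ IHw N nE|n N _].
- exact: ideal_pow_mul.
- by apply: ideal_pow_add; [apply: IHv|apply: IHw].
- by case: N => [|N]; [apply: ideal_pow0|apply: ideal_pow_0].
Qed.

Lemma ideal_powW m N u : (m <= N)%N -> ideal_pow I N u -> ideal_pow I m u.
Proof.
move=> /subnK <-; elim: (N - m)%N => // k IH; rewrite addSn => /ideal_powS; exact: IH.
Qed.

(** By the Leibniz rule a derivation spoils one factor of a product and keeps the others, whether or
    not it preserves I. *)
Lemma ideal_pow_der (d : R -> R) N u : derivation d ->
  ideal_pow I N.+1 u -> ideal_pow I N (d u).
Proof.
move=> dd; move nE : N.+1 => n Iu; elim: Iu N nE => // {n}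
  [n a v Ia Iv IH N [nN]|n v w _ IHv _ IHw N nE|n N _].
- rewrite nN dd.2; apply: ideal_pow_add; first exact: ideal_pow_mul.
  case: n Iv IH nN => [|n] Iv IH nN; first exact: ideal_pow0.
  by apply: ideal_powM => //; apply: IH.
- by rewrite dd.1; apply: ideal_pow_add; [apply: IHv|apply: IHw].
- rewrite (der0 dd); case: N => [|N]; [exact: ideal_pow0|exact: ideal_pow_0].
Qed.

Lemma ideal_pow_iter_der (d : R -> R) N k u : derivation d ->
  ideal_pow I (N + k) u -> ideal_pow I N (iter k d u).
Proof.
move=> dd; elim: k N => [|k IH] N; rewrite ?addn0 // addnS -addSn => Iu /=.
by apply: ideal_pow_der => //; apply: IH.
Qed.

Lemma ideal_pow1 u : I 0 -> (forall u v, I u -> I v -> I (u + v)) ->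
  (forall c v, I v -> I (c * v)) -> ideal_pow I 1 u -> I u.
Proof.
move=> I0 ID IM; move nE : 1%N => n Iu.
elim: Iu nE => // [m a v Ia _ _ _|m v w _ IHv _ IHw h]; first by rewrite mulrC; apply: IM.
by apply: ID; [apply: IHv|apply: IHw].
Qed.

End IdealPow.

Lemma ideal_pow_morph (R S : comNzRingType) (h : {rmorphism R -> S}) (I : set R) (J : set S) N u :
  (forall u, I u -> J (h u)) -> ideal_pow I N u -> ideal_pow J N (h u).
Proof.
move=> hI; elim=> [v|n a v Ia _ IH|n v w _ IHv _ IHw|n].
- exact: ideal_pow0.
- by rewrite rmorphM; apply: ideal_powM => //; apply: hI.
- by rewrite rmorphD; apply: ideal_powD.
- by rewrite rmorph0; apply: ideal_pow_0.
Qed.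

Lemma iter_derM (S : comNzRingType) (D : S -> S) (dD : derivation D) n u v :
  iter n D (u * v) = \sum_(k < n.+1) 'C(n, k)%:R * (iter (n - k) D u * iter k D v).
Proof.
elim: n => [|n IH]; first by rewrite big_ord1 bin0 subn0 mul1r.
rewrite /= IH (der_sum dD).
have E (k : 'I_n.+1) : D ('C(n, k)%:R * (iter (n - k) D u * iter k D v)) =
    'C(n, k)%:R * (iter (n.+1 - k) D u * iter k D v) +
    'C(n, k)%:R * (iter (n - k) D u * iter k.+1 D v).
  by rewrite dD.2 (der_nat dD) mul0r add0r dD.2 mulrDr subSn // -ltnS.
rewrite (eq_bigr _ (fun k _ => E k)) big_split /=.
rewrite [in LHS]big_ord_recl [X in _ + X]big_ord_recr /=.
rewrite [RHS]big_ord_recl [in RHS]big_ord_recr /=.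
rewrite /bump /= !add1n !bin0 !binn subSS !subnn !add0n -addrA; congr (_ + _).
rewrite addrA; congr (_ + _); rewrite -big_split /=; apply: eq_bigr => k _.
by rewrite !add1n !add0n subSS binS natrD mulrDl.
Qed.

Lemma map_derivation (R : comNzRingType) (d : R -> R) :
  derivation d -> derivation (map_poly d).
Proof.
move=> dd; split=> p q; apply/polyP => n.
  by rewrite coefD !(coef_map_id0 _ _ (der0 dd)) coefD dd.1.
rewrite coefD (coef_map_id0 _ _ (der0 dd)) !coefM (der_sum dd) -big_split /=.
by apply: eq_bigr => j _; rewrite dd.2 !(coef_map_id0 _ _ (der0 dd)).
Qed.


Lemma map_derivationC (R : comNzRingType) (d : R -> R) u :
  derivation d -> map_poly d u%:P = (d u)%:P.
Proof.
move=> dd; apply/polyP => n; rewrite (coef_map_id0 _ _ (der0 dd)) !coefC.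
by case: ifP => // _; apply: der0.
Qed.

(** * Leading forms at a point of the plane *)

Section DomainPoly.
Variables (k : comNzRingType) (kdom : forall u v : k, u * v = 0 -> u = 0 \/ v = 0).

Lemma size_mul_dom (p q : {poly k}) : p != 0 -> q != 0 ->
  size (p * q) = (size p + size q).-1.
Proof.
move=> p0 q0; apply: size_proper_mul; apply/eqP => /kdom.
by case=> /eqP; rewrite lead_coef_eq0 ?(negPf p0) ?(negPf q0).
Qed.

Lemma mulf_neq0_dom (p q : {poly k}) : p != 0 -> q != 0 -> p * q != 0.
Proof.
move=> p0 q0; rewrite -size_poly_eq0 size_mul_dom // -lt0n.
by move: p0 q0; rewrite -!size_poly_gt0; case: (size p) (size q) => [|?] [|?] //; rewrite addnS.
Qed.

End DomainPoly.

Section LeadingForms.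
Variables (L : fieldType) (L0 : forall n, n.+1%:R != 0 :> L).
Variables (R k : comNzRingType) (iota : {rmorphism L -> R}) (pi : {rmorphism R -> k}).
Hypothesis kdom : forall u v : k, u * v = 0 -> u = 0 \/ v = 0.
Variables (dx dy : R -> R) (ddx : derivation dx) (ddy : derivation dy).
Hypotheses (dxi : forall c, dx (iota c) = 0) (dyi : forall c, dy (iota c) = 0).
Variables (x y : R).
Hypotheses (dxx : dx x = 1) (dxy : dx y = 0) (dyx : dy x = 0) (dyy : dy y = 1).

(* the derivative in the direction (z, 1), where z is the polynomial variable *)
Let D (p : {poly R}) := 'X * map_poly dx p + 1 * map_poly dy p.
Let dD : derivation D.
Proof. exact: derivation_comb (map_derivation ddx) (map_derivation ddy). Qed.

(* the part of degree n of the Taylor expansion of u at the point of pi, up to a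
   factor n!, as a polynomial in z *)
Let form n (u : R) : {poly k} := map_poly pi (iter n D u%:P).

Let D_C u : D u%:P = 'X * (dx u)%:P + (dy u)%:P.
Proof. by rewrite /D mul1r !map_derivationC. Qed.

Let DX : D 'X = 0.
Proof.
have E d : derivation d -> map_poly d 'X = 0.
  move=> dd; apply/polyP => n; rewrite (coef_map_id0 _ _ (der0 dd)) coefX coef0.
  exact: der_nat.
by rewrite /D !E // !mulr0 addr0.
Qed.

Let size_form n u : (size (form n u) <= n.+1)%N.
Proof.
apply: leq_trans (size_poly _ _) _.
elim: n => [|n IH] /=; first exact: size_polyC_leq1.
apply: leq_trans (size_polyD _ _) _; rewrite mul1r geq_max; apply/andP; split.
  rewrite mulrC; have [->|h] := eqVneq (map_poly dx (iter n D u%:P)) 0.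
    by rewrite mul0r size_poly0.
  by rewrite size_mulX // ltnS (leq_trans (size_poly _ _)).
by rewrite (leq_trans (size_poly _ _)) // (leq_trans IH).
Qed.

Let formM n u v :
  form n (u * v) = \sum_(j < n.+1) 'C(n, j)%:R * (form (n - j) u * form j v).
Proof.
rewrite /form polyCM (iter_derM dD) rmorph_sum; apply: eq_bigr => j _.
by rewrite !rmorphM rmorph_nat.
Qed.

Let char0k n : n.+1%:R != 0 :> {poly k}.
Proof.
rewrite -polyC_natr polyC_eq0 -(rmorph_nat (pi \o iota)).
by rewrite (fmorph_eq0 (pi \o iota)).
Qed.

Let natM_neq0 n (p : {poly k}) : (0 < n)%N -> p != 0 -> n%:R * p != 0.
Proof. by case: n => // n _ p0; apply: mulf_neq0_dom. Qed.

(** Leading forms multiply: over a domain of characteristic zero the order of a product is the sum m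
    + j of the orders, and its leading form is the product up to a nonzero binomial coefficient,
    which comes from the n! in [form]. *)
Let form_least n u v : form n (u * v) != 0 -> (forall i, (i < n)%N -> form i (u * v) = 0) ->
  exists m j, [/\ (m + j)%N = n, form m u != 0, forall i, (i < m)%N -> form i u = 0,
    form j v != 0 & form n (u * v) = 'C(n, j)%:R * (form m u * form j v)].
Proof.
move=> fn fi.
have [m m0 mmin] : exists2 m, form m u != 0 & forall i, (i < m)%N -> form i u = 0.
  have [|m m0 mmin] := @ex_minnP (fun m => form m u != 0).
    apply: contrapT => h; case/eqP: fn; rewrite formM big1 // => j _.
    suff -> : form (n - j) u = 0 by rewrite mul0r mulr0.
    by apply/eqP/negP => /negP g; apply: h; exists (n - j)%N.
  exists m => // i im; apply/eqP/negP => /negP /mmin; by rewrite leqNgt im.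
have [j j0 jmin] : exists2 j, form j v != 0 & forall i, (i < j)%N -> form i v = 0.
  have [|j j0 jmin] := @ex_minnP (fun m => form m v != 0).
    apply: contrapT => h; case/eqP: fn; rewrite formM big1 // => j _.
    suff -> : form j v = 0 by rewrite !mulr0.
    by apply/eqP/negP => /negP g; apply: h; exists j.
  exists j => // i im; apply/eqP/negP => /negP /jmin; by rewrite leqNgt im.
(* Only the index j survives in the Leibniz sum: a smaller index kills the form of v, a larger one
   the form of u. *)
have E : form (m + j) (u * v) = 'C(m + j, j)%:R * (form m u * form j v).
  rewrite formM (bigD1 (inord j)) //= inordK ?ltnS ?leq_addl // addnK big1 ?addr0 // => i.
  move=> ij; have {}ij : (i != j :> nat).
    by apply: contraNneq ij => ij; apply/eqP/val_inj; rewrite /= inordK ?ltnS ?leq_addl.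
  case: (ltngtP i j) ij => // ij _; first by rewrite (jmin i ij) !mulr0.
  by rewrite (mmin (m + j - i)%N) ?mul0r ?mulr0 //; have := ltn_ord i; lia.
have mjn : (m + j)%N = n.
  case: (ltngtP (m + j) n) => // h.
    have /eqP := fi _ h; rewrite E (negPf (natM_neq0 _ _)) // ?bin_gt0 ?leq_addl //.
    exact: mulf_neq0_dom.
  case/eqP: fn; rewrite formM big1 // => i _.
  case: (ltnP i j) => ij; first by rewrite (jmin i ij) !mulr0.
  by rewrite (mmin (n - i)%N) ?mul0r ?mulr0 //; have := ltn_ord i; lia.
by exists m, j; split=> //; rewrite -mjn.
Qed.

(** Each application of D lowers the order of vanishing by at most one, so after j < N steps all
    coefficients still vanish at the point. *)
Let form_pow N j m : (j < N)%N -> ideal_pow [set u | pi u = 0] N m -> form j m = 0.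
Proof.
move=> jN Im; pose J : set {poly R} := fun p => map_poly pi p = 0.
have Jm : ideal_pow J N m%:P.
  apply: (ideal_pow_morph _ Im) => u /= pu; rewrite /J /=.
  by rewrite map_polyC /= pu.
have : ideal_pow J 1 (iter j D m%:P).
  apply: ideal_pow_iter_der => //; apply: ideal_powW Jm; by rewrite add1n.
apply: (@ideal_pow1 _ J); rewrite /J /=; first by rewrite rmorph0.
- by move=> u v hu hv; rewrite rmorphD /= hu hv addr0.
- by move=> c v hv; rewrite rmorphM /= hv mulr0.
Qed.

Let formB n u v : form n (u - v) = form n u - form n v.
Proof.
rewrite /form.
suff -> : iter n D (u - v)%:P = iter n D u%:P - iter n D v%:P by rewrite rmorphB.
elim: n => [|n IH] /=; first exact: polyCB.
by rewrite IH (derB dD).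
Qed.

(** D sends x to z and y to 1. Hence polynomials in x have forms that are multiples of powers of z,
    while polynomials in y have constant forms; [no_common_axes] plays these against each other. *)
Let iterD_x (rho : {poly L}) n :
  iter n D (map_poly iota rho).[x]%:P = 'X^n * (map_poly iota rho^`(n)).[x]%:P.
Proof.
elim: n => [|n IH]; first by rewrite mul1r.
rewrite /= IH dD.2 (derX dD) DX mulr0 mul0r add0r D_C !(der_horner_map ddx dxi) !(der_horner_map ddy dyi).
by rewrite dxx dyx mul1r mul0r addr0 mulrA -exprSr ?derivnS.
Qed.

Let iterD_y (rho : {poly L}) n :
  iter n D (map_poly iota rho).[y]%:P = (map_poly iota rho^`(n)).[y]%:P.
Proof.
elim: n => [//|n IH] /=.
rewrite IH D_C !(der_horner_map ddx dxi) !(der_horner_map ddy dyi).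
by rewrite dxy dyy mul1r mul0r mulr0 add0r ?derivnS.
Qed.

(** In characteristic zero repeated differentiation ends in a nonzero constant, so a nonzero
    polynomial has a finite order of vanishing at the point. *)
Let derivative_neq0 (rho : {poly L}) w : rho != 0 ->
  exists2 n, pi (map_poly iota rho^`(n)).[w] != 0 &
    forall i, (i < n)%N -> pi (map_poly iota rho^`(i)).[w] = 0.
Proof.
move=> r0.
suff ex : exists n, pi (map_poly iota rho^`(n)).[w] != 0.
  have [n n0 nmin] := ex_minnP ex.
  by exists n => // i ni; apply/eqP/negP => /negP /nmin; rewrite leqNgt ni.
have [s] := ubnP (size rho); elim: s rho r0 => // s IH rho r0 sr.
have [r'0|r'0] := eqVneq rho^`() 0.
  exists 0%N; have rE := size1_polyC (size_deriv0 L0 r'0).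
  rewrite /= rE map_polyC hornerC (fmorph_eq0 (pi \o iota)).
  by move: r0; rewrite {1}rE polyC_eq0.
have [|n hn] := IH _ r'0; last by exists n.+1; rewrite derivSn.
by rewrite (leq_trans (lt_size_deriv r0)) // -ltnS.
Qed.

(* If f, vanishing at the point, divided up to high order both a polynomial in x
   and a polynomial in y, its leading form would divide both a power of z and a
   constant, so would have degree 0. *)
Lemma no_common_axes (F : R) (rho rho' : {poly L}) : pi F = 0 -> rho != 0 -> rho' != 0 ->
  (forall N, exists t m, ideal_pow [set u | pi u = 0] N m /\
     (map_poly iota rho).[x] = F * t + m) ->
  (forall N, exists t m, ideal_pow [set u | pi u = 0] N m /\
     (map_poly iota rho').[y] = F * t + m) -> False.
Proof.
move=> F0 r0 r0' hx hy.
have [n n0 nmin] := derivative_neq0 x r0.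
have [n' n0' nmin'] := derivative_neq0 y r0'.
(* Precision n + 1 suffices: an error in that power of the ideal does not affect the forms of degree
   at most n. *)
have [t [m [Im E]]] := hx n.+1.
have [t' [m' [Im' E']]] := hy n'.+1.
have fE i : (i <= n)%N -> form i (F * t) = 'X^i * (pi (map_poly iota rho^`(i)).[x])%:P.
  move=> le_in; rewrite -[F * t](addrK m) -E formB (form_pow _ Im) // subr0 /form iterD_x.
  by rewrite rmorphM /= map_polyXn map_polyC.
have fE' i : (i <= n')%N -> form i (F * t') = (pi (map_poly iota rho'^`(i)).[y])%:P.
  move=> le_in; rewrite -[F * t'](addrK m') -E' formB (form_pow _ Im') // subr0 /form iterD_y.
  by rewrite map_polyC.
have X0 : 'X^n * (pi (map_poly iota rho^`(n)).[x])%:P != 0.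
  by rewrite mulf_neq0_dom ?polyC_eq0 // -size_poly_eq0 size_polyXn.
have [|i ni|M [j [Mj FM Fmin tj]]] := @form_least n F t.
- by rewrite fE.
- by rewrite fE 1?ltnW // nmin // polyC0 mulr0.
rewrite fE // => EE.
have [|i ni|M' [j' [Mj' FM' Fmin' tj']]] := @form_least n' F t'.
- by rewrite fE' // polyC_eq0.
- by rewrite fE' 1?ltnW // nmin' // polyC0.
rewrite fE' // => EE'.
have MM : M' = M.
  by case: (ltngtP M' M) => // h; [move: FM'; rewrite Fmin|move: FM; rewrite Fmin']; rewrite ?eqxx.
rewrite {}MM in EE' FM' Mj' Fmin'.
have sN a (p : {poly k}) : (a != 0%N) -> p != 0 -> size (a%:R * p) = size p.
  case: a => // a _ p0; rewrite size_mul_dom // -polyC_natr size_polyC.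
  by rewrite -polyC_eq0 polyC_natr char0k.
have sF : size (form M F) = 1%N.
  have : size (form M F * form j' t') = 1%N.
    rewrite -(sN 'C(n', j')) ?mulf_neq0_dom // -?EE' ?size_polyC ?n0' //.
    by rewrite -lt0n bin_gt0 -Mj' leq_addl.
  rewrite size_mul_dom //; move: FM' tj'; rewrite -!size_poly_gt0.
  by lia.
have : size (form M F * form j t) = n.+1.
  rewrite -(sN 'C(n, j)) ?mulf_neq0_dom // -?EE; last first.
    by rewrite -lt0n bin_gt0 -Mj leq_addl.
  by rewrite mulrC size_mul_dom ?polyC_eq0 // -?size_poly_eq0 size_polyXn // size_polyC n0.
rewrite size_mul_dom // sF add1n /= => sT.
(* The leading form of F is constant, so the degree n of z^n comes from the form of t, whose degree
   is at most j = n - M. Thus M = 0, although the form of degree 0 is the value of F at the point,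
   which is 0. *)
have := size_form j t; rewrite sT ltnS -Mj -{2}[j]add0n leq_add2r leqn0 => /eqP M0.
by move: FM; rewrite M0 /form /= map_polyC /= F0 eqxx.
Qed.

End LeadingForms.

(** * Exponential identities on a formal curve *)

Section Core.
Variables (L : fieldType) (L0 : forall n, n.+1%:R != 0 :> L).
Variables (f : {poly {poly L}}) (hf : irreducible_elt f) (FC : functionField f).
Variables (R k : comNzRingType) (iota : {rmorphism L -> R}) (pi : {rmorphism R -> k}).
Hypothesis kdom : forall u v : k, u * v = 0 -> u = 0 \/ v = 0.
Variables (dx dy : R -> R) (ddx : derivation dx) (ddy : derivation dy).
Hypotheses (dxi : forall c, dx (iota c) = 0) (dyi : forall c, dy (iota c) = 0).
Variables (x y : R).
Hypotheses (dxx : dx x = 1) (dxy : dx y = 0) (dyx : dy x = 0) (dyy : dy y = 1).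

Local Notation ev := (eval2 iota x y).
Local Notation evF := (eval2 (ff_inc FC) (ff_x FC) (ff_y FC)).

Hypothesis (f0 : pi (ev f) = 0).

(* the kernel of R -> completion of R / (f) at the point of pi *)
Definition local_zero (s : R) : Prop := forall N, exists t m,
  ideal_pow [set u | pi u = 0] N m /\ s = ev f * t + m.

Lemma local_zeroD s t : local_zero s -> local_zero t -> local_zero (s + t).
Proof.
move=> hs ht N; have [a [m [Im ->]]] := hs N; have [b [n [In ->]]] := ht N.
by exists (a + b), (m + n); split; [apply: ideal_pow_add|ring].
Qed.

Lemma local_zeroM c s : local_zero s -> local_zero (c * s).
Proof.
move=> hs N; have [a [m [Im ->]]] := hs N.
by exists (c * a), (c * m); split; [apply: ideal_pow_mul|ring].
Qed.

Lemma local_zeroN s : local_zero s -> local_zero (- s).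
Proof. by rewrite -mulN1r; apply: local_zeroM. Qed.

Lemma local_zeroB s t : local_zero s -> local_zero t -> local_zero (s - t).
Proof. by move=> hs /local_zeroN; apply: local_zeroD. Qed.

Lemma ev_ff g : evF g = 0 -> local_zero (ev g).
Proof.
move=> /ff_ker[h ->] N; exists (ev h), 0; split.
  by case: N => [|N]; [apply: ideal_pow0|apply: ideal_pow_0].
by rewrite eval2M addr0.
Qed.

(** The passage from congruences in R to equalities in the function field; [ev_ff] is the converse.
    It makes primality of [local_zero] unnecessary. *)
Lemma local_zero_ev g : local_zero (ev g) -> evF g = 0.
Proof.
move=> gz; apply/eqP/negP => /negP g0.
have lz T : exists2 rho : {poly L}, rho != 0 & local_zero (map_poly iota rho).[ev T].
  have [rho [al [be [r0 E]]]] := ff_elim hf T g0.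
  exists rho => //.
  have -> : (map_poly iota rho).[ev T] = ev (map_poly (@poly2C L) rho).[T].
    rewrite -horner_map -map_poly_comp; congr (_.[_]); apply: eq_map_poly => c /=.
    by rewrite eval2_const.
  rewrite E !eval2E; apply: local_zeroD; first by rewrite mulrC; apply: local_zeroM.
  rewrite mulrC; apply: local_zeroM; apply: ev_ff; apply/ff_ker; exists 1.
  by rewrite mulr1.
have [rho r0 h] := lz 'X%:P; have [rho' r0' h'] := lz 'X.
rewrite eval2_X in h; rewrite eval2_Y in h'.
exact: (no_common_axes L0 kdom ddx ddy dxi dyi dxx dxy dyx dyy f0 r0 r0' h h').
Qed.

Let delta u := ev f^`() * dx u + (- ev (pderX f)) * dy u.

Let ddelta : derivation delta.
Proof. exact: derivation_comb. Qed.

Let delta_ev g : delta (ev g) = ev (curve_der f g).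
Proof.
rewrite /delta (der_eval2 x y ddx dxi) (der_eval2 x y ddy dyi) dxx dxy dyx dyy.
by rewrite /curve_der !eval2E; ring.
Qed.

Lemma local_zero_der s : local_zero s -> local_zero (delta s).
Proof.
move=> hs N; have [t [m [Im ->]]] := hs N.+1.
exists (delta t), (delta m); split; first exact: ideal_pow_der.
have E : delta (ev f) = 0 by rewrite delta_ev /curve_der mulrC subrr eval2_0.
by rewrite ddelta.1 ddelta.2 E mul0r add0r.
Qed.

Variables (a b A B r : L) (U V W Z x' y' : R).
Hypotheses (A0 : A != 0) (B0 : B != 0) (r0 : r != 0) (ab0 : (a, b) <> (0, 0)).
Hypotheses (UV : U * V = 1) (WZ : W * Z = 1) (xx' : x * x' = 1) (yy' : y * y' = 1).
Hypotheses (xU : x * dx U = iota a * U) (yU : y * dy U = iota b * U).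
Hypotheses (xW : x * dx W = iota b * W) (yW : y * dy W = iota a * W).
Hypothesis eqn : local_zero (iota A * U + iota B * W - iota r).

(** Rationality with the denominator cleared, which descends directly along field embeddings. *)
Definition commensurable (s : L) := exists (n : nat) (m : int), n.+1%:R * s = m%:~R.

Lemma curve_core :
  (commensurable (a - b) /\ commensurable (a + b)) \/
  (a + b = 0 /\ algebraicOver (ff_inc FC) (ff_x FC / ff_y FC)) \/
  (a - b = 0 /\ algebraicOver (ff_inc FC) (ff_x FC * ff_y FC)).
Proof.
have [D [dD Di Dev]] := ff_derivation FC.
set X := ff_x FC in Dev *; set Y := ff_y FC in Dev *; set inc := ff_inc FC in Di Dev *.
have DX : D X = evF f^`().
  rewrite -[X](eval2_X inc X Y) Dev /curve_der /pderX map_polyC /= derivX.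
  by rewrite derivC mulr0 subr0 mulr1.
have DY : D Y = - evF (pderX f).
  rewrite -[Y](eval2_Y inc X Y) Dev /curve_der derivX mulr1 eval2B eval2M.
  have -> : pderX 'X = 0 :> {poly {poly L}}.
    apply/polyP => n; rewrite /pderX coef_map coefX coef0.
    exact: der_nat (deriv_derivation _) _.
  by rewrite eval2_0 mulr0 sub0r.
(* For (s, t) = (a, b) and (b, a) the quotient E / (x y) is the logarithmic derivative of U and of W
   along the curve. *)
have wE (s t : L) : exists E, ev E = iota s * y * ev f^`() - iota t * x * ev (pderX f) /\
    evF E = inc s * Y * D X + inc t * X * D Y.
  exists (s%:P%:P * 'X * f^`() - t%:P%:P * 'X%:P * pderX f).
  rewrite !eval2E !eval2_const !eval2_X !eval2_Y DX DY; split=> //.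
  by rewrite mulrN.
have [E1 [evE1 FE1]] := wE a b; have [E2 [evE2 FE2]] := wE b a.
have [G [evG FG]] : exists G, ev G = ev E2 - ev E1 /\
    evF G = (inc b - inc a) * (Y * D X - X * D Y).
  by exists (E2 - E1); rewrite !eval2B FE1 FE2; split=> //; ring.
pose S := iota A * U + iota B * W - iota r.
have delta_i c : delta (iota c) = 0 by rewrite /delta dxi dyi; ring.
have dU : x * y * delta U = U * ev E1.
  transitivity (y * ev f^`() * (x * dx U) - x * ev (pderX f) * (y * dy U)).
    by rewrite /delta; ring.
  by rewrite xU yU evE1; ring.
have dW : x * y * delta W = W * ev E2.
  transitivity (y * ev f^`() * (x * dx W) - x * ev (pderX f) * (y * dy W)).
    by rewrite /delta; ring.
  by rewrite xW yW evE2; ring.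
have dS : x * y * delta S = iota A * U * ev E1 + iota B * W * ev E2.
  rewrite /S (derB ddelta) ddelta.1 !ddelta.2 !delta_i.
  transitivity (iota A * (x * y * delta U) + iota B * (x * y * delta W)); first by ring.
  by rewrite dU dW; ring.
have lzdS : local_zero (x * y * delta S) by apply: local_zeroM; apply: local_zero_der.
rewrite dS in lzdS.
(* Cramer's rule for A U + B W = r and A U E1 + B W E2 = 0, whose determinant is G = E2 - E1. *)
pose S1 := iota A * U * ev G - iota r * ev E2.
pose S2 := iota B * W * ev G + iota r * ev E1.
have lz1 : local_zero S1.
  have -> : S1 = ev E2 * S - (iota A * U * ev E1 + iota B * W * ev E2).
    by rewrite /S1 /S evG; ring.
  by apply: local_zeroB => //; apply: local_zeroM.
have lz2 : local_zero S2.
  have -> : S2 = (iota A * U * ev E1 + iota B * W * ev E2) - ev E1 * S.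
    by rewrite /S2 /S evG; ring.
  by apply: local_zeroB => //; apply: local_zeroM.
have unitL c s : c != 0 -> local_zero (iota c * s) -> local_zero s.
  move=> c0 /(local_zeroM (iota c^-1)).
  by rewrite mulrA -rmorphM mulVf // rmorph1 mul1r.
have lz1' : local_zero 1 -> False.
  by rewrite -(eval2_1 iota x y) => /local_zero_ev; rewrite eval2_1 => /eqP; rewrite oner_eq0.
have X0 : X != 0.
  apply/eqP => X0; apply: lz1'; rewrite -xx' mulrC; apply: local_zeroM.
  by rewrite -(eval2_X iota x y); apply: ev_ff; rewrite eval2_X.
have Y0 : Y != 0.
  apply/eqP => Y0; apply: lz1'; rewrite -yy' mulrC; apply: local_zeroM.
  by rewrite -(eval2_Y iota x y); apply: ev_ff; rewrite eval2_Y.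
have FE12 : evF E1 + evF E2 = (inc a + inc b) * (Y * D X + X * D Y).
  by rewrite FE1 FE2; ring.
have Dn0 : exists w, D w != 0.
  apply: contrapT => h; apply: (ff_smooth L0 hf (FC := FC)).
  have {}h w : D w = 0 by apply/eqP/negP => /negP hw; apply: h; exists w.
  by rewrite -DX h; split=> //; apply/eqP; rewrite -oppr_eq0 -DY h.
have DXY : D (X * Y) = Y * D X + X * D Y by rewrite dD.2; ring.
have DXVY : D (X / Y) * Y ^+ 2 = Y * D X - X * D Y.
  have : D (X / Y * Y) = D X by rewrite divfK.
  rewrite dD.2 => <-; field; exact: Y0.
(* Degenerate case: the system gives E1 = E2 = 0 on C, as r is nonzero. Moreover G is (b - a) times
   y D(x) - x D(y), and the vanishing of the first or the second factor leads to the alternative on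
   x y or on x / y. *)
have [G0|G0] := eqVneq (evF G) 0.
  have e2 : evF E2 = 0.
    apply: local_zero_ev; apply: (unitL r) => //.
    have -> : iota r * ev E2 = iota A * U * ev G - S1 by rewrite /S1; ring.
    by apply: local_zeroB => //; apply: local_zeroM; apply: ev_ff.
  have e1 : evF E1 = 0.
    apply: local_zero_ev; apply: (unitL r) => //.
    have -> : iota r * ev E1 = S2 - iota B * W * ev G by rewrite /S2; ring.
    by apply: local_zeroB => //; apply: local_zeroM; apply: ev_ff.
  right; move/eqP: G0; rewrite FG mulf_eq0 -rmorphB fmorph_eq0 => /orP[/eqP ba|/eqP h].
    have ab : a = b by apply/eqP; rewrite eq_sym -subr_eq0 ba.
    right; rewrite ab subrr; split=> //.
    apply: (ff_der_eq0 L0 hf dD Di Dn0); rewrite DXY.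
    move/eqP: e1; rewrite FE1 ab.
    have -> : inc b * Y * D X + inc b * X * D Y = inc b * (Y * D X + X * D Y) by ring.
    rewrite mulf_eq0 fmorph_eq0 => /orP[/eqP b0|/eqP //].
    by case: ab0; rewrite ab b0.
  left; split; last first.
    apply: (ff_der_eq0 L0 hf dD Di Dn0); apply/eqP.
    by rewrite -(mulIr_eq0 _ (mulIf (expf_neq0 2 Y0))) DXVY h.
  have DX0 : D X != 0.
    apply/eqP => DX0; move: h; rewrite DX0 mulr0 sub0r => /eqP.
    rewrite oppr_eq0 mulf_eq0 (negPf X0) /= => /eqP DY0.
    apply: (ff_smooth L0 hf (FC := FC)); rewrite -DX DX0; split=> //.
    by apply/eqP; rewrite -oppr_eq0 -DY DY0.
  have E : inc (a + b) * (Y * D X) = evF E1 + inc b * (Y * D X - X * D Y).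
    by rewrite FE1 rmorphD; ring.
  apply/eqP; rewrite -(fmorph_eq0 inc); move/eqP: E; rewrite e1 h mulr0 addr0.
  by rewrite !mulf_eq0 (negPf Y0) (negPf DX0) !orbF.
have XY0 : X * Y * evF G != 0 by rewrite !mulf_neq0.
(* If E2 or E1 vanished on C, then U G or W G would lie in [local_zero]. Since U and W are units, so
   would G. *)
have e20 : evF E2 != 0.
  apply/eqP => e2; case/eqP: G0; apply: local_zero_ev.
  apply: (unitL A) => //; rewrite -[X in local_zero X]mul1r -UV.
  have -> : U * V * (iota A * ev G) = V * (S1 + iota r * ev E2) by rewrite /S1; ring.
  apply: local_zeroM; apply: local_zeroD => //; apply: local_zeroM; exact: ev_ff.
have e10 : evF E1 != 0.
  apply/eqP => e1; case/eqP: G0; apply: local_zero_ev.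
  apply: (unitL B) => //; rewrite -[X in local_zero X]mul1r -WZ.
  have -> : W * Z * (iota B * ev G) = Z * (S2 - iota r * ev E1) by rewrite /S2; ring.
  apply: local_zeroM; apply: local_zeroB => //; apply: local_zeroM; exact: ev_ff.
have [XX [evXX evFXX]] : exists XX, ev XX = x * y /\ evF XX = X * Y.
  by exists ('X%:P * 'X); rewrite !eval2M !eval2_X !eval2_Y.
have dE g : exists h, evF h = D (evF g) /\ ev h = delta (ev g).
  by exists (curve_der f g); rewrite Dev delta_ev.
have [dG [FdG dGE]] := dE G; have [d1 [Fd1 d1E]] := dE E1; have [d2 [Fd2 d2E]] := dE E2.
(* The logarithmic derivative of A U G = r E2, with U eliminated: D(E2) / E2 = E1 / (x y) + D(G) /
   G. [K2] is its analogue for W. *)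
have K1 : evF E2 * (evF E1 * evF G + X * Y * D (evF G)) = X * Y * evF G * D (evF E2).
  rewrite -FdG -?Fd1 -?Fd2 -evFXX; apply/eqP; rewrite -subr_eq0 -!(eval2M, eval2D, eval2B); apply/eqP.
  apply: local_zero_ev; apply: (unitL r) => //.
  rewrite !eval2E dGE ?d1E ?d2E evXX.
  have -> : iota r * (ev E2 * (ev E1 * ev G + x * y * delta (ev G)) - x * y * ev G * delta (ev E2)) =
     ev G * (x * y) * delta S1 - (ev E1 * ev G + x * y * delta (ev G)) * S1.
    rewrite /S1 (derB ddelta) !ddelta.2 !delta_i.
    transitivity (ev G * (iota A * ev G * (x * y * delta U) + iota A * U * (x * y) * delta (ev G)
       - iota r * (x * y) * delta (ev E2)) - (ev E1 * ev G + x * y * delta (ev G)) * (iota A * U * ev G - iota r * ev E2)); last by ring.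
    by rewrite dU; ring.
  by apply: local_zeroB; apply: local_zeroM => //; apply: local_zero_der.
have K2 : evF E1 * (evF E2 * evF G + X * Y * D (evF G)) = X * Y * evF G * D (evF E1).
  rewrite -FdG -?Fd1 -?Fd2 -evFXX; apply/eqP; rewrite -subr_eq0 -!(eval2M, eval2D, eval2B); apply/eqP.
  apply: local_zero_ev; apply: (unitL r) => //.
  rewrite !eval2E dGE ?d1E ?d2E evXX.
  have -> : iota r * (ev E1 * (ev E2 * ev G + x * y * delta (ev G)) - x * y * ev G * delta (ev E1)) =
     (ev E2 * ev G + x * y * delta (ev G)) * S2 - ev G * (x * y) * delta S2.
    rewrite /S2 ddelta.1 !ddelta.2 !delta_i.
    transitivity ((ev E2 * ev G + x * y * delta (ev G)) * (iota B * W * ev G + iota r * ev E1) -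
      ev G * (iota B * ev G * (x * y * delta W) + iota B * W * (x * y) * delta (ev G)
       + iota r * (x * y) * delta (ev E1))); last by ring.
    by rewrite dW; ring.
  by apply: local_zeroB; apply: local_zeroM => //; apply: local_zero_der.
have FG' : evF G = evF E2 - evF E1 by rewrite FG FE1 FE2; ring.
have DXVYn : D (X / Y) != 0.
  apply: contraNneq G0 => h; apply/eqP.
  by move: DXVY; rewrite h mul0r FG => <-; rewrite mulr0.
have K12 := FE12; rewrite -DXY in K12.
move: K1 K2 G0 e10 e20 FG FG' K12; set e1 := evF E1; set e2 := evF E2; set g := evF G.
set P := X * Y => K1 K2 G0 e10 e20 FG FG' K12.
have P0 : P != 0 by rewrite mulf_neq0.
(* If x y had derivative zero, then e2 = - e1 and g = - 2 e1, and [K1] would collapse to 2 e1^3 =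
   0. *)
have DPn : D P != 0.
  apply/eqP => DP; move: K12; rewrite DP mulr0 => /eqP; rewrite addrC addr_eq0 => /eqP e21.
  have Dg : D g = - (D e1 + D e1) by rewrite FG' (derB dD) e21 (derN dD); ring.
  have De2 : D e2 = - D e1 by rewrite e21 (derN dD).
  move: K1; rewrite Dg De2 FG' e21 => /eqP; rewrite -subr_eq0 => /eqP K1.
  have : 2%:R * e1 ^+ 3 = 0 by rewrite -[RHS]K1; ring.
  move/eqP; rewrite mulf_eq0 expf_eq0 (negPf e10) andbF orbF.
  by rewrite -(rmorph_nat inc) fmorph_eq0 (negPf (L0 1)).
left; split.
  have vt : ~ algebraicOver inc (X / Y).
    by move/(der_algebraic L0 dD Di) => h; rewrite h eqxx in DXVYn.
  (* Up to a constant e2 / e1 is U / W, which stands for (x / y)^(a - b). *)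
  apply: (rational_exponent dD Di vt (ff_algebraic hf vt (e2 / e1))) => //.
    by rewrite mulf_neq0 ?invr_eq0.
  have Dq : D (e2 / e1) * e1 = D e2 - e2 / e1 * D e1.
    have : D (e2 / e1 * e1) = D e2 by rewrite divfK.
    by rewrite dD.2 => <-; rewrite addrK.
  have Dq1 : D (e2 / e1) * (e1 * P) = - (e2 * g).
    apply: (mulIf G0).
    transitivity (P * g * D e2 - e2 / e1 * (P * g * D e1)); first by rewrite mulrA Dq; ring.
    have gE : e1 - e2 = - g by rewrite FG' opprB.
    rewrite -K1 -K2; transitivity (e2 * g * (e1 - e2)); first by field.
    by rewrite gE; ring.
  apply: (mulIf (mulf_neq0 (mulf_neq0 e10 P0) (expf_neq0 2 Y0))).
  transitivity (D (e2 / e1) * (e1 * P) * (X * Y)); first by field.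
  transitivity (inc (a - b) * e2 * P * (D (X / Y) * Y ^+ 2)); last by field.
  rewrite Dq1 DXVY rmorphB -/P FG; ring.
have vt : ~ algebraicOver inc P.
  by move/(der_algebraic L0 dD Di) => h; rewrite h eqxx in DPn.
have g20 : g ^+ 2 != 0 by rewrite expf_neq0.
(* Up to a constant e1 e2 / g^2 is U W, which stands for (x y)^(a + b). *)
apply: (rational_exponent dD Di vt (ff_algebraic hf vt (e1 * e2 / g ^+ 2))) => //.
  by rewrite !mulf_neq0 ?invr_eq0.
set q := e1 * e2 / g ^+ 2.
have qg : q * g ^+ 2 = e1 * e2 by rewrite divfK.
have Dq : D q * g ^+ 2 = D e1 * e2 + e1 * D e2 - q * (2%:R * g * D g).
  by rewrite -dD.2 -qg dD.2 (derX dD) addrK.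
apply: (mulIf (mulf_neq0 G0 g20)).
transitivity (D q * g ^+ 2 * (P * g)); first by ring.
rewrite Dq; transitivity (e2 * (P * g * D e1) + e1 * (P * g * D e2) - (q * g ^+ 2) * (2%:R * P * D g)); first by ring.
transitivity (q * g ^+ 2 * g * (inc (a + b) * D P)); last by ring.
by rewrite -K1 -K2 qg rmorphD -K12; ring.
Qed.

End Core.

(** * Formal power series *)

Definition fps (R : Type) := nat -> R.

HB.instance Definition _ (R : Type) := gen_eqMixin (fps R).
HB.instance Definition _ (R : Type) := gen_choiceMixin (fps R).

Section FpsRing.
Variable R : comNzRingType.
Implicit Types u v w : fps R.

Let add u v : fps R := fun n => u n + v n.
Let opp u : fps R := fun n => - u n.
Let zero : fps R := fun=> 0.

Let addA : associative add.
Proof. by move=> u v w; apply/funext => n; rewrite /add addrA. Qed.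
Let addC : commutative add.
Proof. by move=> u v; apply/funext => n; rewrite /add addrC. Qed.
Let add0 : left_id zero add.
Proof. by move=> u; apply/funext => n; rewrite /add add0r. Qed.
Let addN : left_inverse zero opp add.
Proof. by move=> u; apply/funext => n; rewrite /add addNr. Qed.

HB.instance Definition _ := GRing.isZmodule.Build (fps R) addA addC add0 addN.

Definition fps_mul u v : fps R := fun n => \sum_(i < n.+1) u i * v (n - i)%N.
Definition fpsC (c : R) : fps R := fun n => if n == 0%N then c else 0.
Definition fps_trunc N u : {poly R} := \poly_(i < N) u i.

Lemma coef_fps_trunc N u n : (n < N)%N -> (fps_trunc N u)`_n = u n.
Proof. by move=> nN; rewrite coef_poly nN. Qed.

(** Each coefficient of a product depends on finitely many terms, so the ring axioms and the Leibniz
    rule are inherited from polynomials. *)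
Lemma fps_mul_trunc N u v n : (n < N)%N ->
  fps_mul u v n = (fps_trunc N u * fps_trunc N v)`_n.
Proof.
move=> nN; rewrite coefM; apply: eq_bigr => i _.
by rewrite !coef_fps_trunc // (leq_trans _ nN) // ltnS ?leq_subr // -ltnS.
Qed.

Let mulC : commutative fps_mul.
Proof.
by move=> u v; apply/funext => n; rewrite !(fps_mul_trunc _ _ (ltnSn n)) mulrC.
Qed.

Lemma fps_mul_truncl N u v w n : (n < N)%N ->
  fps_mul (fps_mul u v) w n = (fps_trunc N u * fps_trunc N v * fps_trunc N w)`_n.
Proof.
move=> nN; rewrite coefM; apply: eq_bigr => i _.
have iN : (i < N)%N by rewrite (leq_trans (ltn_ord i)).
by rewrite (@fps_mul_trunc N) // coef_fps_trunc // (leq_ltn_trans (leq_subr _ _)).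
Qed.

Let mulA : associative fps_mul.
Proof.
move=> u v w; apply/funext => n.
rewrite [in LHS]mulC !(fps_mul_truncl _ _ _ (ltnSn n)).
by rewrite [X in polyseq X]mulrC mulrA.
Qed.

Let mul1 : left_id (fpsC 1) fps_mul.
Proof.
move=> u; apply/funext => n; rewrite /fps_mul big_ord_recl subn0 mul1r big1 ?addr0 //.
by move=> i _; rewrite mul0r.
Qed.

Let mulD : left_distributive fps_mul +%R.
Proof.
move=> u v w; apply/funext => n; transitivity (fps_mul u w n + fps_mul v w n); last by [].
by rewrite /fps_mul -big_split; apply: eq_bigr => i _; rewrite mulrDl.
Qed.

Let one_neq0 : fpsC 1 != 0.
Proof. by apply/eqP => /(congr1 (@^~ 0%N)) /eqP; rewrite /= oner_eq0. Qed.

HB.instance Definition _ := GRing.Zmodule_isComNzRing.Build (fps R) mulA mulC mul1 mulD one_neq0.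

Lemma fpsD u v n : (u + v) n = u n + v n. Proof. by []. Qed.
Lemma fps1 n : (1 : fps R) n = (n == 0%N)%:R. Proof. by case: n. Qed.
Lemma fpsM u v n : (u * v) n = \sum_(i < n.+1) u i * v (n - i)%N. Proof. by []. Qed.
Lemma fps_sum I (r : seq I) (P : pred I) (F : I -> fps R) n :
  (\sum_(i <- r | P i) F i) n = \sum_(i <- r | P i) F i n.
Proof. by elim/big_rec2: _ => // i a b _ <-. Qed.

Definition fps_poly (p : {poly R}) : fps R := fun n => p`_n.
Lemma fps_poly_is_zmod_morphism : zmod_morphism fps_poly.
Proof. by move=> p q; apply/funext => n; rewrite /fps_poly coefB. Qed.
Lemma fps_poly_is_monoid_morphism : monoid_morphism fps_poly.
Proof.
split; first by apply/funext => n; rewrite /fps_poly coef1 fps1.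
by move=> p q; apply/funext => n; rewrite /fps_poly coefM.
Qed.
HB.instance Definition _ := GRing.isZmodMorphism.Build _ _ fps_poly fps_poly_is_zmod_morphism.
HB.instance Definition _ := GRing.isMonoidMorphism.Build _ _ fps_poly fps_poly_is_monoid_morphism.

Definition fps_der u : fps R := fun n => n.+1%:R * u n.+1.

Lemma fps_der_derivation : derivation fps_der.
Proof.
split=> u v; apply/funext => n; first by rewrite /fps_der fpsD mulrDr.
have dE w m : (m < n.+2)%N -> (m < n.+1)%N -> fps_der w m = (fps_trunc n.+2 w)^`()`_m.
  by move=> _ mn; rewrite coef_deriv coef_fps_trunc ?ltnS // /fps_der mulr_natl.
have -> : fps_der (u * v) n = (fps_trunc n.+2 u * fps_trunc n.+2 v)^`()`_n.
  by rewrite coef_deriv -fps_mul_trunc // /fps_der mulr_natl.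
rewrite derivM coefD !coefM fpsD !fpsM; congr (_ + _).
  by apply: eq_bigr => i _; rewrite -dE ?coef_fps_trunc //; have := ltn_ord i; lia.
by apply: eq_bigr => i _; rewrite -dE ?coef_fps_trunc //; have := ltn_ord i; lia.
Qed.

Definition fps_map (d : R -> R) u : fps R := fun n => d (u n).

Lemma fps_map_derivation d : derivation d -> derivation (fps_map d).
Proof.
move=> dd; split=> u v; apply/funext => n; first by rewrite /fps_map dd.1.
rewrite /fps_map fpsM (der_sum dd) fpsD !fpsM -big_split.
by apply: eq_bigr => i _; rewrite dd.2.
Qed.

End FpsRing.

(** * The Tate algebra in two variables *)

Section NonarchAbs.
Variables (R : realType) (F : fieldType) (v : nonarchAbs R F).

Lemma nabs0 : v 0 = 0. Proof. exact/nabs_eq0. Qed.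

Lemma nabs_gt0 x : x != 0 -> 0 < v x.
Proof.
by move=> x0; rewrite lt_neqAle nabs_ge0 andbT eq_sym; apply: contraNneq x0 => /nabs_eq0 ->.
Qed.

Lemma nabs1 : v 1 = 1.
Proof.
apply: (mulIf (lt0r_neq0 (nabs_gt0 (oner_neq0 F)))).
by rewrite -nabsM mulr1 mul1r.
Qed.

Lemma nabsX x n : v (x ^+ n) = v x ^+ n.
Proof. by elim: n => [|n IH]; rewrite ?nabs1 // !exprS nabsM IH. Qed.

Lemma nabsN x : v (- x) = v x.
Proof.
rewrite -mulN1r nabsM (_ : v (-1) = 1) ?mul1r //.
by apply/eqP; rewrite -(@pexpr_eq1 _ _ 2) ?nabs_ge0 // -nabsX sqrrN expr1n nabs1.
Qed.

Lemma nabsV x : v x^-1 = (v x)^-1.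
Proof.
have [->|x0] := eqVneq x 0; first by rewrite invr0 nabs0 invr0.
apply: (mulIf (lt0r_neq0 (nabs_gt0 x0))).
by rewrite -nabsM mulVf // nabs1 mulVf // lt0r_neq0 ?nabs_gt0.
Qed.

Lemma nabsB x y : v (x - y) <= Num.max (v x) (v y).
Proof. by rewrite -[v y]nabsN nabsD. Qed.

Lemma nabs_sum_lt I (r : seq I) (P : pred I) (G : I -> F) e : 0 < e ->
  (forall i, P i -> v (G i) < e) -> v (\sum_(i <- r | P i) G i) < e.
Proof.
move=> e0 Ge; elim/big_rec: _ => [|i x Pi xe]; first by rewrite nabs0.
by rewrite (le_lt_trans (nabsD _ _ _)) // gt_max Ge.
Qed.

Lemma nabs_nat n : v n%:R <= 1.
Proof.
elim: n => [|n IH]; first by rewrite nabs0.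
by rewrite -natr1 (le_trans (nabsD _ _ _)) // ge_max IH nabs1 lexx.
Qed.

End NonarchAbs.

Section TateRing.
Variables (R : realType) (L : fieldType) (v : nonarchAbs R L).

(* the Tate algebra in X and Y; the coefficient of X^i Y^j is s j i *)
Definition tate_pred : {pred fps (fps L)} := fun s => `[< forall e : R, 0 < e ->
  exists N, forall i j, (N <= i + j)%N -> v (s j i) < e >].

Lemma tateP (s : fps (fps L)) : reflect (forall e : R, 0 < e ->
  exists N, forall i j, (N <= i + j)%N -> v (s j i) < e) (s \in tate_pred).
Proof. exact: asboolP. Qed.

Lemma tate_bounded (s : fps (fps L)) : s \in tate_pred ->
  exists2 C, 0 < C & forall i j, v (s j i) <= C.
Proof.
move=> /tateP/(_ 1 ltr01)[N sN].
pose S := \sum_(i < N) \sum_(j < N) v (s j i).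
have S0 : 0 <= S by do 2 (apply: sumr_ge0 => ? _); apply: nabs_ge0.
exists (1 + S) => [|i j]; first by rewrite ltr_pwDl.
have [/sN/ltW h|ij] := leqP N (i + j); first by rewrite (le_trans h) // lerDl.
have iN : (i < N)%N by rewrite (leq_ltn_trans _ ij) // leq_addr.
have jN : (j < N)%N by rewrite (leq_ltn_trans _ ij) // leq_addl.
apply: (@le_trans _ _ S); last by rewrite lerDr.
rewrite /S (bigD1 (Ordinal iN)) //= (bigD1 (Ordinal jN)) //= -addrA lerDl.
rewrite addr_ge0 ?sumr_ge0 // => [? _|? _]; first exact: nabs_ge0.
by rewrite sumr_ge0 // => ? _; apply: nabs_ge0.
Qed.

Lemma tate_finite (s : fps (fps L)) N :
  (forall i j, (N <= i + j)%N -> s j i = 0) -> s \in tate_pred.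
Proof. by move=> h; apply/tateP => e e0; exists N => i j /h ->; rewrite nabs0. Qed.

(** In a product coefficient of total degree at least N + M, every term has one factor past its
    threshold and the other bounded. The ultrametric inequality makes the number of terms
    irrelevant. *)
Lemma tate_subring : subring_closed tate_pred.
Proof.
split=> [|s t /tateP hs /tateP ht|s t Ts Tt].
- by apply: (@tate_finite _ 1) => [[|i]] [|j].
- apply/tateP => e e0; have [N hN] := hs e e0; have [M hM] := ht e e0.
  exists (maxn N M) => i j; rewrite geq_max => /andP[ijN ijM].
  rewrite (_ : (s - t) j i = s j i - t j i) // (le_lt_trans (nabsB _ _ _)) //.
  by rewrite gt_max hN ?hM.
- have [C C0 sC] := tate_bounded Ts; have [D D0 tD] := tate_bounded Tt.
  apply/tateP => e e0.
  have [|N hN] := tateP _ Ts (e / D); first by rewrite divr_gt0.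
  have [|M hM] := tateP _ Tt (e / C); first by rewrite divr_gt0.
  exists (N + M)%N => i j ij; rewrite fpsM fps_sum; apply: nabs_sum_lt => // j' _.
  rewrite fpsM; apply: nabs_sum_lt => // i' _; rewrite nabsM.
  have [h|h] := leqP N (i' + j').
    have := hN i' j' h; rewrite ltr_pdivlMr // => h'.
    by rewrite (le_lt_trans _ h') // ler_wpM2l ?nabs_ge0.
  have h2 : (M <= (i - i') + (j - j'))%N by have := ltn_ord i'; have := ltn_ord j'; lia.
  have := hM _ _ h2; rewrite ltr_pdivlMr // => h'.
  by rewrite mulrC (le_lt_trans _ h') // ler_wpM2l ?nabs_ge0.
Qed.

HB.instance Definition _ := GRing.isSubringClosed.Build (fps (fps L)) tate_pred tate_subring.

Record tate := Tate { tate_val : fps (fps L); _ : tate_val \in tate_pred }.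
HB.instance Definition _ := [isSub for tate_val].
HB.instance Definition _ := [Choice of tate by <:].
HB.instance Definition _ := [SubChoice_isSubComNzRing of tate by <:].

Lemma tate_add (s t : tate) : tate_val (s + t) = tate_val s + tate_val t.
Proof. exact: (rmorphD (val : {rmorphism tate -> _})). Qed.
Lemma tate_mul (s t : tate) : tate_val (s * t) = tate_val s * tate_val t.
Proof. exact: (rmorphM (val : {rmorphism tate -> _})). Qed.
Lemma tate_sub (s t : tate) : tate_val (s - t) = tate_val s - tate_val t.
Proof. exact: (rmorphB (val : {rmorphism tate -> _})). Qed.
Lemma tate_valK (s : tate) : tate_val s \in tate_pred. Proof. exact: valP. Qed.
Lemma tate_inj : injective tate_val. Proof. exact: val_inj. Qed.

Definition tate_derX0 (s : fps (fps L)) : fps (fps L) := fps_map (@fps_der L) s.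
Definition tate_derY0 (s : fps (fps L)) : fps (fps L) := fps_der s.

(** Natural numbers have absolute value at most 1, so termwise differentiation preserves convergence
    on the closed disc. *)
Lemma tate_derXP (s : tate) : tate_derX0 (tate_val s) \in tate_pred.
Proof.
apply/tateP => e e0; have [N hN] := tateP _ (tate_valK s) _ e0; exists N => i j ij.
rewrite /tate_derX0 /fps_map /fps_der nabsM.
rewrite (le_lt_trans _ (hN i.+1 j _)) ?(leq_trans ij) ?leq_add // .
by rewrite ler_piMl ?nabs_ge0 ?nabs_nat.
Qed.

Lemma fps_natM (S : comNzRingType) n (u : fps S) m : (n%:R * u) m = n%:R * u m.
Proof.
rewrite !mulr_natl; elim: n => [|n IH]; first by rewrite !mulr0n.
by rewrite !mulrS fpsD IH.
Qed.

Lemma tate_derYP (s : tate) : tate_derY0 (tate_val s) \in tate_pred.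
Proof.
apply/tateP => e e0; have [N hN] := tateP _ (tate_valK s) _ e0; exists N => i j ij.
rewrite /tate_derY0 /fps_der fps_natM nabsM.
rewrite (le_lt_trans _ (hN i j.+1 _)) ?(leq_trans ij) ?leq_add // .
by rewrite ler_piMl ?nabs_ge0 ?nabs_nat.
Qed.

Definition tate_derX (s : tate) : tate := Tate (tate_derXP s).
Definition tate_derY (s : tate) : tate := Tate (tate_derYP s).

Lemma tate_derX_derivation : derivation tate_derX.
Proof.
have h := fps_map_derivation (fps_der_derivation L).
split=> s t; apply: tate_inj.
  by rewrite -[LHS]/(tate_derX0 (tate_val (s + t))) [RHS]tate_add tate_add; apply: h.1.
rewrite -[LHS]/(tate_derX0 (tate_val (s * t))) [RHS]tate_add !tate_mul; exact: h.2.
Qed.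

Lemma tate_derY_derivation : derivation tate_derY.
Proof.
have h := fps_der_derivation (fps L).
split=> s t; apply: tate_inj.
  by rewrite -[LHS]/(tate_derY0 (tate_val (s + t))) [RHS]tate_add tate_add; apply: h.1.
rewrite -[LHS]/(tate_derY0 (tate_val (s * t))) [RHS]tate_add !tate_mul; exact: h.2.
Qed.

Definition poly_series : {poly {poly L}} -> fps (fps L) :=
  @fps_poly (fps L) \o map_poly (@fps_poly L).

Lemma poly_seriesE g j i : poly_series g j i = g`_j`_i.
Proof.
suff -> : poly_series g j = fps_poly g`_j by [].
by rewrite -[LHS]/((map_poly (@fps_poly L) g)`_j) coef_map.
Qed.

Lemma poly_tate g : poly_series g \in tate_pred.
Proof.
pose N := (size g + \sum_(j < size g) size (g`_j)%R)%N.
apply: (@tate_finite _ N) => i j ij; rewrite poly_seriesE.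
have [h|h] := leqP (size g) j; first by rewrite [g`_j]nth_default // coef0.
rewrite nth_default //; apply: (@leq_trans (\sum_(j < size g) size (g`_j)%R)%N).
  by rewrite (bigD1 (Ordinal h)) //= leq_addr.
by rewrite /N in ij; lia.
Qed.

Definition tate_poly g : tate := Tate (poly_tate g).

Lemma tate_poly_is_zmod_morphism : zmod_morphism tate_poly.
Proof.
move=> g k; apply: tate_inj; rewrite [RHS]tate_sub.
exact: (rmorphB poly_series).
Qed.
Lemma tate_poly_is_monoid_morphism : monoid_morphism tate_poly.
Proof.
split; first by apply: tate_inj; exact: (rmorph1 poly_series).
by move=> g k; apply: tate_inj; rewrite tate_mul; exact: (rmorphM poly_series).
Qed.
HB.instance Definition _ := GRing.isZmodMorphism.Build _ _ tate_poly tate_poly_is_zmod_morphism.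
HB.instance Definition _ := GRing.isMonoidMorphism.Build _ _ tate_poly tate_poly_is_monoid_morphism.

Definition tateC : {rmorphism L -> tate} := tate_poly \o @poly2C L.

End TateRing.

(** * Generalized binomial coefficients *)

Section PowCoef.
Variables (E : fieldType) (E0 : forall n, n.+1%:R != 0 :> E).

Definition gen_bin (s : E) (k : nat) : E := \prod_(i < k) (s - i%:R) / k`!%:R.

Lemma fact_neq0 k : k`!%:R != 0 :> E.
Proof. by rewrite -(prednK (fact_gt0 k)). Qed.

Lemma gen_bin0 s : gen_bin s 0 = 1.
Proof. by rewrite /gen_bin big_ord0 fact0 divr1. Qed.

Lemma gen_binS s k : k.+1%:R * gen_bin s k.+1 = (s - k%:R) * gen_bin s k.
Proof.
rewrite /gen_bin big_ord_recr factS natrM invfM /=.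
have := E0 k; move: (k.+1%:R) => c c0; have := fact_neq0 k; move: (k`!%:R) => e e0.
by field; rewrite c0 e0.
Qed.

(** The truncation P of exp (s log (1 + T)) satisfies (1 + T) P' = s P modulo T^k, which is the
    recursion [gen_binS] for its coefficients up to degree k. *)
Lemma pow_coef_bin s k : pow_coef s k = gen_bin s k.
Proof.
have [l lD] : exists l, l = log_poly E k by exists (log_poly E k).
pose P := \sum_(0 <= n < k.+1) (n`!%:R)^-1 *: (s *: l) ^+ n.
have -> : pow_coef s k = P`_k.
  by rewrite /pow_coef -lD /P coef_sum; apply: eq_bigr => n _; rewrite coefZ mulrC.
have [l1 lE] : exists l1, l = 'X * l1.
  exists (\sum_(1 <= n < k.+1) ((-1) ^+ n.+1 / n%:R) *: 'X^(n.-1)).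
  rewrite lD /log_poly mulr_sumr !big_nat; apply: eq_bigr => n /andP[n0 _].
  by rewrite -scalerAr -exprS prednK.
have l'E : (1 + 'X) * l^`() = 1 - (- 'X) ^+ k.
  have -> : l^`() = \sum_(m < k) (- 'X) ^+ m.
    rewrite lD /log_poly raddf_sum /= big_add1 big_mkord; apply: eq_bigr => m _.
    rewrite derivZ derivXn /= -scaler_nat scalerA divfK //.
    by rewrite !exprS mulN1r mulN1r opprK -[- 'X]mulN1r exprMn -signr_odd -[in RHS]signr_odd; case: odd; rewrite ?scaleN1r ?mulN1r ?scale1r ?mul1r.
  by rewrite -opprB subrX1; ring.
pose Q := \sum_(0 <= n < k) (n`!%:R)^-1 *: (s *: l) ^+ n.
have PQ : P = Q + (k`!%:R)^-1 *: (s *: l) ^+ k by rewrite /P big_nat_recr.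
have P'E : P^`() = s *: (l^`() * Q).
  rewrite /P raddf_sum /= big_nat_recl //= expr0 derivZ derivC scaler0 add0r.
  rewrite /Q mulr_sumr scaler_sumr; apply: eq_bigr => n _.
  have e : (n.+1)`!%:R^-1 * n.+1%:R = n`!%:R^-1 :> E.
    by rewrite factS natrM invfM mulrAC mulVf ?mul1r.
  rewrite derivZ deriv_exp derivZ /= -scaler_nat scalerA e.
  by rewrite -!scalerAl -scalerAr !scalerA mulrC.
(* Two errors, both divisible by X^k: the tail of the geometric series for the derivative of l, and
   the last term of P, since l has no constant term. *)
have [T PT] : exists T, (1 + 'X) * P^`() = s *: P + 'X^k * T.
  exists (- (s *: ((-1) ^+ k * Q)) - s *: ((k`!%:R)^-1 *: (s *: l1) ^+ k)).
  rewrite P'E -scalerAr mulrA l'E PQ lE [(- 'X) ^+ k]exprNn.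
  have -> : (s *: ('X * l1)) ^+ k = 'X^k * (s *: l1) ^+ k by rewrite scalerAr exprMn.
  by rewrite -!mul_polyC; ring.
have rec m : (m < k)%N -> m.+1%:R * P`_m.+1 = (s - m%:R) * P`_m.
  move=> mk; have /polyP/(_ m) := PT.
  rewrite mulrDl mul1r coefD coefXM !coef_deriv coefD coefZ coefXnM mk addr0.
  case: m mk => [|m] mk /=; first by rewrite addr0 subr0 mulr1n mul1r.
  rewrite -(mulr_natl P`_m.+2) -(mulr_natl P`_m.+1) => h.
  by rewrite mulrBl -h; ring.
have P0 : P`_0 = 1.
  rewrite /P big_nat_recl // coefD coef_sum big1 => [|n _].
    by rewrite addr0 expr0 fact0 invr1 scale1r coef1.
  by rewrite coefZ exprS lE scalerAr -mulrA coefXM mulr0.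
have {rec}: forall m, (m <= k)%N -> P`_m = gen_bin s m.
  elim=> [|m IH] mk; first by rewrite P0 gen_bin0.
  by apply: (mulfI (E0 m)); rewrite gen_binS rec // IH // ltnW.
by apply.
Qed.

End PowCoef.

(** * Powers of the coordinates of the bidisc *)

Lemma fps_mul_linear (S : comNzRingType) (c : S) (u : fps S) n :
  (fps_poly (1 + c *: 'X) * u) n = u n + (if n is m.+1 then c * u m else 0).
Proof.
rewrite fpsM big_ord_recl /= subn0 {1}/fps_poly coefD coef1 coefZ coefX mulr0 addr0 mul1r.
congr (_ + _); case: n => [|n]; first by rewrite big_ord0.
rewrite big_ord_recl /= subSS subn0 {1}/fps_poly coefD coef1 coefZ coefX add0r mulr1.
rewrite big1 ?addr0 // => i _.
by rewrite /fps_poly coefD coef1 coefZ coefX /= mulr0 addr0 mul0r.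
Qed.

Lemma fps_mul_const (S : comNzRingType) (c : S) (u : fps S) n :
  (fps_poly c%:P * u) n = c * u n.
Proof.
rewrite fpsM big_ord_recl /= subn0 {1}/fps_poly coefC /= big1 ?addr0 // => i _.
by rewrite /fps_poly coefC mul0r.
Qed.

Section TatePowers.
Variables (R : realType) (L : fieldType) (v : nonarchAbs R L) (d : L).
Hypotheses (L0 : forall n, n.+1%:R != 0 :> L) (d0 : d != 0).
Local Notation T := (tate v).
Local Notation TC := (tateC v).

Definition tate_x : T := tate_poly v (1 + d *: 'X)%:P.
Definition tate_y : T := tate_poly v (1 + d%:P *: 'X).
(** The derivation d/dx; the factor 1/d comes from x = 1 + d X. *)
Definition tate_dx (s : T) : T := TC d^-1 * tate_derX s.
Definition tate_dy (s : T) : T := TC d^-1 * tate_derY s.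

Lemma tate_eqP (s t : T) : (forall j i, tate_val s j i = tate_val t j i) -> s = t.
Proof. by move=> h; apply: tate_inj; apply/funext => j; apply/funext => i. Qed.

Lemma tate_coefD (s t : T) j i : tate_val (s + t) j i = tate_val s j i + tate_val t j i.
Proof. by rewrite tate_add. Qed.

Lemma tate_coefC c j i : tate_val (TC c) j i = (if (j == 0%N) && (i == 0%N) then c else 0).
Proof.
rewrite -[LHS]/(poly_series (poly2C L c) j i) poly_seriesE /poly2C /= coefC.
by case: eqP; rewrite ?coef0 // coefC.
Qed.

Lemma tate_coefCM c (s : T) j i : tate_val (TC c * s) j i = c * tate_val s j i.
Proof.
rewrite tate_mul.
have -> : tate_val (TC c) = fps_poly (fps_poly c%:P)%:P.
  by rewrite -[LHS]/(fps_poly (map_poly (@fps_poly L) c%:P%:P)) map_polyC.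
by rewrite fps_mul_const fps_mul_const.
Qed.

Lemma tate_coef_x (s : T) j i : tate_val (tate_x * s) j i =
  tate_val s j i + (if i is i'.+1 then d * tate_val s j i' else 0).
Proof.
rewrite tate_mul.
have -> : tate_val tate_x = fps_poly (fps_poly (1 + d *: 'X))%:P.
  by rewrite -[LHS]/(fps_poly (map_poly (@fps_poly L) (1 + d *: 'X)%:P)) map_polyC.
by rewrite fps_mul_const fps_mul_linear.
Qed.

Lemma tate_coef_y (s : T) j i : tate_val (tate_y * s) j i =
  tate_val s j i + (if j is j'.+1 then d * tate_val s j' i else 0).
Proof.
rewrite tate_mul.
have -> : tate_val tate_y = fps_poly (1 + fps_poly d%:P *: 'X).
  rewrite -[LHS]/(fps_poly (map_poly (@fps_poly L) (1 + d%:P *: 'X))).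
  by rewrite rmorphD rmorph1 /= map_polyZ map_polyX.
rewrite fps_mul_linear; case: j => [//|j].
by rewrite -[LHS]/(_ + (fps_poly d%:P * tate_val s j) i) fps_mul_const.
Qed.

Lemma tate_dx_derivation : derivation tate_dx.
Proof. exact: derivation_scale (tate_derX_derivation v) _. Qed.
Lemma tate_dy_derivation : derivation tate_dy.
Proof. exact: derivation_scale (tate_derY_derivation v) _. Qed.

Lemma tate_coef_dx (s : T) j i :
  tate_val (tate_dx s) j i = d^-1 * (i.+1%:R * tate_val s j i.+1).
Proof. exact: tate_coefCM. Qed.

Lemma tate_coef_dy (s : T) j i :
  tate_val (tate_dy s) j i = d^-1 * (j.+1%:R * tate_val s j.+1 i).
Proof.
rewrite tate_coefCM; congr (_ * _).
by rewrite -[LHS]/((j.+1%:R * tate_val s j.+1) i) fps_natM.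
Qed.

Lemma tate_dx_poly g : tate_dx (tate_poly v g) = TC d^-1 * tate_poly v (pderX g).
Proof.
apply: tate_eqP => j i; rewrite tate_coef_dx tate_coefCM.
rewrite -[tate_val _ _ _]/(poly_series g j i.+1) -[tate_val _ _ _]/(poly_series (pderX g) j i).
by rewrite !poly_seriesE /pderX coef_map /= coef_deriv mulr_natl.
Qed.

Lemma tate_dy_poly g : tate_dy (tate_poly v g) = TC d^-1 * tate_poly v g^`().
Proof.
apply: tate_eqP => j i; rewrite tate_coef_dy tate_coefCM.
rewrite -[tate_val _ _ _]/(poly_series g j.+1 i) -[tate_val _ _ _]/(poly_series g^`() j i).
by rewrite !poly_seriesE coef_deriv coefMn mulr_natl.
Qed.

Lemma tate_dxC c : tate_dx (TC c) = 0.
Proof.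
rewrite tate_dx_poly /poly2C /= /pderX map_polyC /= derivC.
by rewrite (raddf0 (tate_poly v)) mulr0.
Qed.

Lemma tate_dyC c : tate_dy (TC c) = 0.
Proof. by rewrite tate_dy_poly derivC (raddf0 (tate_poly v)) mulr0. Qed.

Lemma tate_dxx : tate_dx tate_x = 1.
Proof.
rewrite tate_dx_poly /pderX map_polyC /= derivD derivZ derivX derivC add0r alg_polyC.
by rewrite -[tate_poly v d%:P%:P]/(TC d) -(rmorphM TC) mulVf // rmorph1.
Qed.

Lemma tate_dyx : tate_dy tate_x = 0.
Proof. by rewrite tate_dy_poly derivC (raddf0 (tate_poly v)) mulr0. Qed.

Lemma tate_dyy : tate_dy tate_y = 1.
Proof.
rewrite tate_dy_poly derivD derivZ derivX derivC add0r alg_polyC.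
by rewrite -[tate_poly v d%:P%:P]/(TC d) -(rmorphM TC) mulVf // rmorph1.
Qed.

Lemma tate_dxy : tate_dx tate_y = 0.
Proof.
rewrite tate_dx_poly (_ : pderX _ = 0) ?(raddf0 (tate_poly v)) ?mulr0 //.
apply/polyP => j; rewrite coef_map coefD coef1 coefZ coefX coef0 /=.
by case: j => [|[|j]]; rewrite /= ?mulr0 ?mulr1 ?addr0 ?add0r ?derivC // ?deriv0 // -polyC1 derivC.
Qed.

Lemma tate_eval2 g : eval2 TC tate_x tate_y g =
  tate_poly v (map_poly (fun u => u \Po (1 + d *: 'X)) g \Po (1 + d%:P *: 'X)).
Proof.
pose h := comp_poly (1 + d%:P *: 'X) \o map_poly (comp_poly (1 + d *: 'X)).
have gE : g = eval2 (poly2C L) 'X%:P 'X g.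
  elim/poly_ind: {1 2}g => [|g' u IH]; first by rewrite eval2_0.
  rewrite eval2D eval2M -IH eval2_Y eval2_polyC; congr (_ + _).
  rewrite /poly2C map_poly_comp_id0 ?raddf0 //= (horner_map polyC).
  by rewrite -[in LHS](comp_polyXr u).
have hC c : tate_poly v (h (poly2C L c)) = TC c.
  by rewrite /h /poly2C /= map_polyC /= comp_polyC comp_polyC.
rewrite {2}gE -[map_poly _ _ \Po _]/(h (eval2 (poly2C L) 'X%:P 'X g)).
have E := rmorph_eval2 (i := poly2C L) (j := TC) (h := tate_poly v \o h) 'X%:P 'X g hC.
apply: etrans (esym E); congr (eval2 TC _ _ g).
  by rewrite /h /= map_polyC /= comp_polyX comp_polyC.
by rewrite /h /= map_polyX comp_polyX.
Qed.

(** The factors x and y are removed coefficient by coefficient and not by inverting them, because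
    their invertibility is itself deduced from this lemma. *)
Lemma tate_const (h : T) : tate_x * tate_dx h = 0 -> tate_y * tate_dy h = 0 ->
  h = TC (tate_val h 0%N 0%N).
Proof.
move=> hx hy.
have X1 j i : tate_val (tate_dx h) j i = 0 -> tate_val h j i.+1 = 0.
  rewrite tate_coef_dx => /eqP; rewrite !mulf_eq0 invr_eq0 (negPf d0) (negPf (L0 i)) /=.
  by move/eqP.
have Y1 j i : tate_val (tate_dy h) j i = 0 -> tate_val h j.+1 i = 0.
  rewrite tate_coef_dy => /eqP; rewrite !mulf_eq0 invr_eq0 (negPf d0) (negPf (L0 j)) /=.
  by move/eqP.
have X j i : tate_val h j i.+1 = 0.
  apply: X1; elim: i => [|i IH]; have := tate_coef_x (tate_dx h) j; rewrite hx.
    by move=> /(_ 0%N); rewrite addr0 => <-.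
  by move=> /(_ i.+1); rewrite IH mulr0 addr0 => <-.
have Y j i : tate_val h j.+1 i = 0.
  apply: Y1; elim: j => [|j IH]; have := tate_coef_y (tate_dy h); rewrite hy.
    by move=> /(_ 0%N i); rewrite addr0 => <-.
  by move=> /(_ j.+1 i); rewrite IH mulr0 addr0 => <-.
by apply: tate_eqP => [[|j]] [|i]; rewrite tate_coefC.
Qed.

(** The condition for the binomial series of (1 + d X)^s to converge on the closed unit disc. *)
Definition pow_cvg (s : L) : Prop := forall e : R, 0 < e ->
  exists N, forall k, (N <= k)%N -> v (d ^+ k * gen_bin s k) < e.

Lemma pow_tate a b : pow_cvg a -> pow_cvg b ->
  (fun j i => d ^+ (i + j) * (gen_bin a i * gen_bin b j)) \in @tate_pred R L v.
Proof.
have bounded s : pow_cvg s -> exists2 C, 0 < C & forall k, v (d ^+ k * gen_bin s k) <= C.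
  move=> /(_ 1 ltr01)[N hN]; pose S := \sum_(k < N) v (d ^+ k * gen_bin s k).
  have S0 : 0 <= S by apply: sumr_ge0 => ? _; apply: nabs_ge0.
  exists (1 + S) => [|k]; first by rewrite ltr_pwDl.
  have [/hN/ltW h|kN] := leqP N k; first by rewrite (le_trans h) // lerDl.
  apply: (@le_trans _ _ S); last by rewrite lerDr.
  rewrite /S (bigD1 (Ordinal kN)) //= lerDl.
  by rewrite sumr_ge0 // => ? _; apply: nabs_ge0.
move=> pa pb; have [C C0 aC] := bounded _ pa; have [D D0 bD] := bounded _ pb.
apply/tateP => e e0.
have [|N hN] := pa (e / D); first by rewrite divr_gt0.
have [|M hM] := pb (e / C); first by rewrite divr_gt0.
exists (N + M)%N => i j ij; rewrite exprD mulrACA nabsM.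
have [h|h] := leqP N i.
  have := hN i h; rewrite ltr_pdivlMr // => h'.
  by rewrite (le_lt_trans _ h') // ler_wpM2l ?nabs_ge0.
have h2 : (M <= j)%N by rewrite -(leq_add2l N) (leq_trans ij) // leq_add2r ltnW.
have := hM j h2; rewrite ltr_pdivlMr // => h'.
by rewrite mulrC (le_lt_trans _ h') // ler_wpM2l ?nabs_ge0.
Qed.

Definition tate_pow a b (pa : pow_cvg a) (pb : pow_cvg b) : T := Tate (pow_tate pa pb).

Section Pow.
Variables (a b : L) (pa : pow_cvg a) (pb : pow_cvg b).

Lemma tate_coef_pow j i :
  tate_val (tate_pow pa pb) j i = d ^+ (i + j) * (gen_bin a i * gen_bin b j).
Proof. by []. Qed.

Lemma tate_pow_dx : tate_x * tate_dx (tate_pow pa pb) = TC a * tate_pow pa pb.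
Proof.
apply: tate_eqP => j i; rewrite tate_coef_x tate_coefCM tate_coef_dx !tate_coef_pow.
transitivity (d ^+ (i + j) * gen_bin b j * (i.+1%:R * gen_bin a i.+1) +
   i%:R * gen_bin a i * d ^+ (i + j) * gen_bin b j); last by rewrite gen_binS //; ring.
rewrite addSn exprS; congr (_ + _); first by field.
case: i => [|i]; first by rewrite !mul0r.
by rewrite tate_coef_dx tate_coef_pow; field.
Qed.

Lemma tate_pow_dy : tate_y * tate_dy (tate_pow pa pb) = TC b * tate_pow pa pb.
Proof.
apply: tate_eqP => j i; rewrite tate_coef_y tate_coefCM tate_coef_dy !tate_coef_pow.
transitivity (d ^+ (i + j) * gen_bin a i * (j.+1%:R * gen_bin b j.+1) +
   j%:R * gen_bin b j * d ^+ (i + j) * gen_bin a i); last by rewrite gen_binS //; ring.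
rewrite addnS exprS; congr (_ + _); first by field.
case: j => [|j]; first by rewrite !mul0r.
by rewrite tate_coef_dy tate_coef_pow; field.
Qed.

End Pow.

Lemma tate_coef00M (s t : T) :
  tate_val (s * t) 0%N 0%N = tate_val s 0%N 0%N * tate_val t 0%N 0%N.
Proof. by rewrite tate_mul fpsM big_ord1 fpsM big_ord1. Qed.

Lemma tate_coef00_pow a b (pa : pow_cvg a) (pb : pow_cvg b) :
  tate_val (tate_pow pa pb) 0%N 0%N = 1.
Proof. by rewrite tate_coef_pow !gen_bin0 !mulr1. Qed.

(** The product has zero derivatives and constant term 1, which avoids any convolution identity for
    binomial coefficients. *)
Lemma tate_pow_inv a b (pa : pow_cvg a) (pb : pow_cvg b) (pa' : pow_cvg (- a)) (pb' : pow_cvg (- b)) :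
  tate_pow pa pb * tate_pow pa' pb' = 1.
Proof.
set U := tate_pow pa pb; set V := tate_pow pa' pb'.
rewrite [LHS]tate_const ?tate_coef00M ?tate_coef00_pow ?mulr1 ?rmorph1 //.
  rewrite tate_dx_derivation.2.
  transitivity (tate_x * tate_dx U * V + U * (tate_x * tate_dx V)); first by ring.
  by rewrite !tate_pow_dx rmorphN -/U -/V; ring.
rewrite tate_dy_derivation.2.
transitivity (tate_y * tate_dy U * V + U * (tate_y * tate_dy V)); first by ring.
by rewrite !tate_pow_dy rmorphN -/U -/V; ring.
Qed.

Lemma tate_x_inv (p1 : pow_cvg (- 1)) (p0 : pow_cvg 0) : tate_x * tate_pow p1 p0 = 1.
Proof.
set V := tate_pow p1 p0.
rewrite [LHS]tate_const ?tate_coef00M ?tate_coef00_pow ?mulr1.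
- have -> : tate_val tate_x 0%N 0%N = 1; last exact: rmorph1.
  rewrite -[LHS]/(poly_series (1 + d *: 'X)%:P 0%N 0%N) poly_seriesE coefC /=.
  by rewrite coefD coefZ coefX coef1 mulr0 addr0.
- rewrite tate_dx_derivation.2 tate_dxx tate_pow_dx rmorphN rmorph1 -/V; ring.
- rewrite tate_dy_derivation.2 tate_dyx mul0r add0r.
  transitivity (tate_x * (tate_y * tate_dy V)); first by ring.
  by rewrite tate_pow_dy rmorph0 mul0r mulr0.
Qed.

Lemma tate_y_inv (p0 : pow_cvg 0) (p1 : pow_cvg (- 1)) : tate_y * tate_pow p0 p1 = 1.
Proof.
set V := tate_pow p0 p1.
rewrite [LHS]tate_const ?tate_coef00M ?tate_coef00_pow ?mulr1.
- have -> : tate_val tate_y 0%N 0%N = 1; last exact: rmorph1.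
  rewrite -[LHS]/(poly_series (1 + d%:P *: 'X) 0%N 0%N) poly_seriesE.
  by rewrite coefD coefZ coefX coef1 mulr0 addr0 coef1.
- rewrite tate_dx_derivation.2 tate_dxy mul0r add0r.
  transitivity (tate_y * (tate_x * tate_dx V)); first by ring.
  by rewrite tate_pow_dx rmorph0 mul0r mulr0.
- rewrite tate_dy_derivation.2 tate_dyy tate_pow_dy rmorphN rmorph1 -/V; ring.
Qed.

End TatePowers.

(** * Presentations by the Tate algebra *)

Section SeriesOfTate.
Variables (R : realType) (L : fieldType) (v : nonarchAbs R L).

(** Translates nested series, with Y as outer variable, into multi-indexed ones, where index [ord0]
    belongs to X and [ord_max] to Y. *)
Definition to_series (s : fps (fps L)) : series L 2 := fun nu => s (nu ord_max) (nu ord0).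
Definition of_series (t : series L 2) : fps (fps L) :=
  fun j i => t [ffun k => if k == ord0 then i else j].

Lemma mdegree2 (nu : mindex 2) : mdegree nu = (nu ord0 + nu ord_max)%N.
Proof.
rewrite /mdegree big_ord_recl big_ord1; congr (_ + nu _)%N; exact/val_inj.
Qed.

Lemma of_seriesK (t : series L 2) : to_series (of_series t) = t.
Proof.
apply/funext => nu; rewrite /to_series /of_series; congr t; apply/ffunP => k.
rewrite ffunE; case: eqP => [-> //|/eqP k0]; congr (nu _); apply/val_inj.
by case: k k0 => [[|[|]]].
Qed.

Lemma to_seriesP (s : tate v) : restricted v (to_series (tate_val s)).
Proof.
move=> e e0; have [N hN] := tateP v _ (tate_valK s) e e0; exists N => nu.
by rewrite mdegree2; apply: hN.
Qed.

Lemma of_seriesP (t : series L 2) : restricted v t -> of_series t \in @tate_pred R L v.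
Proof.
move=> ht; apply/tateP => e e0; have [N hN] := ht e e0; exists N => i j ij.
by apply: hN; rewrite mdegree2 !ffunE.
Qed.

Lemma to_series_mul (s t : fps (fps L)) :
  to_series (s * t) = series_mul (to_series s) (to_series t).
Proof.
apply/funext => nu; rewrite /to_series /series_mul.
set n := (mdegree nu).+1.
have n0 : (nu ord0 < n)%N by rewrite /n mdegree2 ltnS leq_addr.
have n1 : (nu ord_max < n)%N by rewrite /n mdegree2 ltnS leq_addl.
rewrite fpsM fps_sum.
pose G j i := s j i * t (nu ord_max - j)%N (nu ord0 - i)%N.
rewrite (eq_bigr (fun j : 'I__ => \sum_(i < (nu ord0).+1) G j i)); last by [].
rewrite (big_ord_widen n (fun j => \sum_(i < (nu ord0).+1) G j i)) //.
rewrite (eq_bigr (fun j : 'I_n => \sum_(i < n | (i < (nu ord0).+1)%N) G j i)); last first.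
  by move=> j _; rewrite (big_ord_widen n (fun i => G j i)).
rewrite pair_big /=.
pose h (mu : {ffun 'I_2 -> 'I_n}) := (mu ord_max, mu ord0).
pose h' (p : 'I_n * 'I_n) := [ffun k : 'I_2 => if k == ord0 then p.2 else p.1].
rewrite (reindex h) /=; last first.
  exists h' => [mu _|[a b] _]; last by rewrite /h !ffunE.
  apply/ffunP => k; rewrite ffunE /=; case: eqP => [-> //|/eqP k0]; congr (mu _).
  by apply/val_inj; case: k k0 => [[|[|]]].
apply: eq_big => [mu|mu _]; last by rewrite /G !ffunE.
rewrite !ltnS; apply/andP/forallP => [[h1 h2] k|hk]; last by split.
have [->|k0] := eqVneq k ord0; first exact: h2.
rewrite (_ : k = ord_max) //; apply/val_inj; by case: k k0 => [[|[|]]].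
Qed.

Lemma mindex2_eq0 (nu : mindex 2) :
  (nu == [ffun=> 0%N]) = (nu ord_max == 0%N) && (nu ord0 == 0%N).
Proof.
apply/eqP/andP => [->|[/eqP h /eqP h0]]; first by rewrite !ffunE.
apply/ffunP => k; rewrite ffunE; have [->//|k0] := eqVneq k ord0.
by rewrite (_ : k = ord_max) //; apply/val_inj; case: k k0 => [[|[|]]].
Qed.

Lemma to_series1 : to_series (tate_val (1 : tate v)) = @series_one L 2.
Proof.
apply/funext => nu; rewrite /series_one mindex2_eq0.
by rewrite -(rmorph1 (tateC v)) /to_series tate_coefC; case: ifP.
Qed.

Section Presentation.
Variables (A : comAlgType L) (phi : series L 2 -> A) (hphi : tate_presentation v phi).

(** The proof is kept as an argument so that the ring morphism structure can be attached to the
    map. *)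
Definition tate_phi (_ : tate_presentation v phi) (s : tate v) : A :=
  phi (to_series (tate_val s)).

Lemma tate_phi_lin x (s t : tate v) :
  phi (to_series (fun j i => x * tate_val s j i + tate_val t j i)) =
    x *: tate_phi hphi s + tate_phi hphi t.
Proof.
have [_ h _ _] := hphi.
by rewrite /tate_phi -(h x _ _ (to_seriesP s) (to_seriesP t)).
Qed.

Lemma tate_phi_is_zmod_morphism : zmod_morphism (tate_phi hphi).
Proof.
move=> s t; rewrite /tate_phi.
have -> : tate_val (s - t) = (fun j i => -1 * tate_val t j i + tate_val s j i).
  apply/funext => j; apply/funext => i; rewrite tate_sub mulN1r addrC; by [].
by rewrite tate_phi_lin scaleN1r addrC.
Qed.
Lemma tate_phi_is_monoid_morphism : monoid_morphism (tate_phi hphi).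
Proof.
have [h1 _ hM _] := hphi; split=> [|s t]; rewrite /tate_phi.
  by rewrite to_series1 h1.
by rewrite tate_mul to_series_mul hM //; apply: to_seriesP.
Qed.
HB.instance Definition _ := GRing.isZmodMorphism.Build _ _ (tate_phi hphi) tate_phi_is_zmod_morphism.
HB.instance Definition _ := GRing.isMonoidMorphism.Build _ _ (tate_phi hphi) tate_phi_is_monoid_morphism.

Lemma tate_phi_surj y : exists s, tate_phi hphi s = y.
Proof.
have [_ _ _ hs] := hphi; have [t rt <-] := hs y.
by exists (Tate (of_seriesP rt)); rewrite /tate_phi /= of_seriesK.
Qed.

End Presentation.

Lemma bidisc_seriesE (d : L) g : bidisc_series d g =
  to_series (tate_val (eval2 (tateC v) (tate_x v d) (tate_y v d) g)).
Proof.
apply/funext => nu; rewrite tate_eval2 /bidisc_series /to_series.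
by rewrite -[RHS]/(poly_series _ _ _) poly_seriesE.
Qed.

Lemma tate_phi_ker d f (A : comAlgType L) (phi : series L 2 -> A)
    (hphi : curve_bidisc_algebra v d f phi) (s : tate v) :
  tate_phi hphi.1 s = 0 ->
  exists t, s = eval2 (tateC v) (tate_x v d) (tate_y v d) f * t.
Proof.
move=> h; have [_ hk] := hphi.
have [t rt st] := (hk _ (to_seriesP s)).1 h.
exists (Tate (of_seriesP rt)).
apply: tate_inj; rewrite tate_mul /=.
have : to_series (tate_val s) = to_series (tate_val (eval2 (tateC v) (tate_x v d) (tate_y v d) f) * of_series t).
  by rewrite to_series_mul of_seriesK -bidisc_seriesE.
move=> E; apply/funext => j; apply/funext => i.
have := congr1 (fun u : series L 2 => u [ffun k => if k == ord0 then i else j]) E.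
by rewrite /to_series !ffunE.
Qed.

Lemma tate_phi_f d f (A : comAlgType L) (phi : series L 2 -> A)
    (hphi : curve_bidisc_algebra v d f phi) :
  tate_phi hphi.1 (eval2 (tateC v) (tate_x v d) (tate_y v d) f) = 0.
Proof.
have [_ hk] := hphi; apply/hk; first exact: to_seriesP.
exists (to_series (tate_val (1 : tate v))); first exact: to_seriesP.
by rewrite bidisc_seriesE -to_series_mul -tate_mul mulr1.
Qed.

End SeriesOfTate.

(** * Quotients of algebras by proper ideals *)

Section QuotientAlgebra.
Variables (L : fieldType) (A : comAlgType L) (I : set A).

Definition proper_ideal_pred (_ : is_ideal setT I /\ ~ I 1) : {pred A} := fun x => `[<I x>].
Hypothesis hI : is_ideal setT I /\ ~ I 1.

Lemma proper_ideal_closed : idealr_closed (proper_ideal_pred hI).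
Proof.
have [[_ [I0 ID IM]] I1] := hI; split.
- exact/asboolP.
- exact/asboolP.
- by move=> a u w /asboolP Iu /asboolP Iw; apply/asboolP; apply: ID => //; apply: IM.
Qed.
HB.instance Definition _ := isIdealr.Build A (proper_ideal_pred hI) proper_ideal_closed.

(** Equipped below with a scalar action, because the universal property of an affinoid subdomain is
    tested on L-algebras. *)
Definition quot_alg : Type := {ideal_quot (proper_ideal_pred hI)}.
HB.instance Definition _ := GRing.ComNzRing.on quot_alg.

Definition quot_alg_pi : {rmorphism A -> quot_alg} := \pi_quot_alg%qT.
Let scale (c : L) (q : quot_alg) : quot_alg := quot_alg_pi c%:A * q.
Let scaleA c1 c2 q : scale c1 (scale c2 q) = scale (c1 * c2) q.
Proof. by rewrite /scale mulrA -rmorphM -scalerAl mul1r scalerA. Qed.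
Let scale1 : left_id 1 scale.
Proof. by move=> q; rewrite /scale scale1r rmorph1 mul1r. Qed.
Let scaleDr : right_distributive scale +%R.
Proof. by move=> c q1 q2; rewrite /scale mulrDr. Qed.
Let scaleDl q : {morph scale^~ q : c1 c2 / c1 + c2}.
Proof. by move=> c1 c2; rewrite /scale scalerDl rmorphD mulrDl. Qed.
HB.instance Definition _ := GRing.Zmodule_isLmodule.Build L quot_alg scaleA scale1 scaleDr scaleDl.
HB.instance Definition _ := GRing.Lmodule_isLalgebra.Build L quot_alg
  (fun c q1 q2 => mulrA _ q1 q2).
HB.instance Definition _ := GRing.Lalgebra_isComAlgebra.Build L quot_alg.

End QuotientAlgebra.

(** * Germs at a point of an affinoid space *)

Section QuotientPi.
Variables (L : fieldType) (A : comAlgType L) (I : set A) (hI : is_ideal setT I /\ ~ I 1).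

Definition quot_proj (a : A) : quot_alg hI := quot_alg_pi hI a.

Lemma quot_proj_is_zmod_morphism : zmod_morphism quot_proj.
Proof. exact: rmorphB. Qed.
Lemma quot_proj_is_monoid_morphism : monoid_morphism quot_proj.
Proof. by split; [exact: rmorph1|exact: rmorphM]. Qed.
Lemma quot_proj_scalable : scalable quot_proj.
Proof.
move=> c x; rewrite -[c *: x]mul1r -scalerAr scalerAl quot_proj_is_monoid_morphism.2.
exact: erefl.
Qed.
HB.instance Definition _ :=
  GRing.isZmodMorphism.Build A (quot_alg hI) quot_proj quot_proj_is_zmod_morphism.
HB.instance Definition _ :=
  GRing.isMonoidMorphism.Build A (quot_alg hI) quot_proj quot_proj_is_monoid_morphism.
HB.instance Definition _ :=
  GRing.isScalable.Build L A (quot_alg hI) *:%R quot_proj quot_proj_scalable.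

Lemma quot_algP : exists pi : {lrmorphism A -> quot_alg hI},
  (forall y, exists x, pi x = y) /\ (forall x, pi x = 0 <-> I x).
Proof.
exists quot_proj; split.
  by move=> y; exists (generic_quotient.repr (y : {ideal_quot (proper_ideal_pred hI)})); apply: generic_quotient.reprK.
move=> x; have E : (quot_proj x == 0) = (x \in proper_ideal_pred hI).
  rewrite -[0](rmorph0 (quot_alg_pi hI)) -[X in _ = (X \in _)]subr0.
  by rewrite Quotient.idealrBE.
split=> [h|h]; first by apply/asboolP; rewrite -[asbool _]/(x \in proper_ideal_pred hI) -E h.
by apply/eqP; rewrite E; apply/asboolP.
Qed.

End QuotientPi.

Section MaximalIdeals.
Variables (A : comNzRingType) (M : set A) (hM : is_maximal_ideal setT M).

Lemma maximal_ideal_unit x : ~ M x -> exists m b, M m /\ 1 = m + b * x.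
Proof.
have [[_ [M0 MD MM]] M1 Mmax] := hM => Mx.
pose J : set A := [set z | exists m b, M m /\ z = m + b * x].
have iJ : is_ideal setT J.
  split=> //; split.
  - by exists 0, 0; split=> //; rewrite mul0r addr0.
  - move=> _ _ [m [b [Mm ->]]] [m' [b' [Mm' ->]]]; exists (m + m'), (b + b').
    by split; [apply: MD|ring].
  - move=> c _ _ [m [b [Mm ->]]]; exists (c * m), (c * b).
    by split; [apply: MM|ring].
have [|JM|//] := Mmax J iJ.
  by move=> m Mm; exists m, 0; rewrite mul0r addr0.
by case: Mx; rewrite -JM; exists 0, 1; rewrite mul1r add0r.
Qed.

Lemma maximal_ideal_prime x y : M (x * y) -> M x \/ M y.
Proof.
have [[_ [M0 MD MM]] M1 Mmax] := hM => Mxy.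
have [Mx|/maximal_ideal_unit[m [b [Mm E]]]] := pselect (M x); first by left.
right; rewrite -[y]mulr1 E; have -> : y * (m + b * x) = y * m + b * (x * y) by ring.
by apply: MD; apply: MM.
Qed.

Lemma maximal_ideal_exp x n : M (x ^+ n) -> M x.
Proof.
have [_ M1 _] := hM; elim: n => [//|n IH].
by rewrite exprS => /maximal_ideal_prime[].
Qed.

End MaximalIdeals.

Lemma ideal_pow_exp (A : comNzRingType) (I : set A) x N : I x -> ideal_pow I N (x ^+ N).
Proof.
by move=> Ix; elim: N => [|N IH]; [apply: ideal_pow0|rewrite exprS; apply: ideal_powM].
Qed.

Section Germs.
Variables (R : realType) (L : fieldType) (v : nonarchAbs R L).

Lemma affinoid_quotient (A B : comAlgType L) (pi : {lrmorphism A -> B}) :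
  is_affinoid v A -> (forall y, exists x, pi x = y) -> is_affinoid v B.
Proof.
move=> [n [phi [h1 hlin hM hs]]] surj; exists n, (pi \o phi); split.
- by rewrite /= h1 rmorph1.
- by move=> x s t rs rt; rewrite /= hlin // linearP.
- by move=> s t rs rt; rewrite /= hM // rmorphM.
- by move=> y; have [x <-] := surj y; have [s rs <-] := hs x; exists s.
Qed.

(* An affinoid subdomain containing M does not change the quotients by the powers
   of M, because Sp (A / M^N) has a single point, lying over M. *)
Lemma vanishing_ideal_pow (A : comAlgType L) (Omega : set (set A)) (x : A) M :
  is_affinoid v A -> admissible_open v Omega -> vanishes_on v Omega x -> Omega M ->
  forall N, ideal_pow M N x.
Proof.
(* Exponent 0 is separate, since the quotient by the whole ring is zero. *)
move=> affA [CU [CUsub OE _]] van OM [|N]; first exact: ideal_pow0.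
have /= [U CUU UM] : [set M | exists2 U, CU U & U M] M by rewrite -OE.
have [USp [A' [f rf]]] := CUsub _ CUU.
have MSp := USp _ UM; have [[_ [M0 MD MM]] M1 Mmax] := MSp.
have UO : U `<=` Omega by move=> M' UM'; rewrite OE; exists U.
have fx := van _ _ _ USp rf UO.
have hI : is_ideal setT (ideal_pow M N.+1 : set A) /\ ~ ideal_pow M N.+1 1.
  split; last first.
    move=> /(ideal_powW (isT : (1 <= N.+1)%N)) h.
    by apply: M1; apply: ideal_pow1 h => // c w; apply: MM.
  split=> //; split; first exact: ideal_pow_0.
    exact: ideal_powD.
  by move=> c w _; apply: ideal_pow_mul.
have [pi [surj kerpi]] := quot_algP hI.
have [_ _ univ] := rf.
have [|M' M'Sp|k kf _] := univ _ pi.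
- exact: affinoid_quotient surj.
- have [[_ [M'0 M'D M'M]] M'1 _] := M'Sp.
  suff -> : pi @^-1` M' = M by [].
  have [| |//|] := Mmax (pi @^-1` M').
  + split=> //; split=> /=; first by rewrite rmorph0.
      by move=> u w hu hw; rewrite rmorphD; apply: M'D.
    by move=> u w _ hw; rewrite rmorphM; apply: M'M.
  (* Elements of M become nilpotent in the quotient, so they lie in every maximal ideal of it. *)
  + move=> u Mu /=; apply: (maximal_ideal_exp (n := N.+1) M'Sp).
    suff -> : pi u ^+ N.+1 = 0 by [].
    by rewrite -(rmorphXn pi); apply/kerpi; apply: ideal_pow_exp.
  + by rewrite /= rmorph1.
(* The projection factors through the subdomain algebra, where x is already zero. *)
- by apply/kerpi; rewrite -kf fx rmorph0.
Qed.

End Germs.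

(** * p-adic estimates *)

Section PadicEstimates.
Variables (R : realType) (p : nat) (hp : prime p) (hodd : odd p).

(** Each factor p of n costs exactly 1/p, and a number prime to p has absolute value 1 by a Bezout
    relation. *)
Lemma nabs_nat_lower (F : fieldType) (v : nonarchAbs R F) :
  v p%:R = p%:R^-1 -> forall n, (0 < n)%N -> n%:R^-1 <= v n%:R.
Proof.
move=> vp n; have [m] := ubnP n; elim: m n => // m IH n nm n0.
have p1 := prime_gt1 hp.
have [/dvdnP[k kE]|npn] := boolP (p %| n)%N.
  have k0 : (0 < k)%N by move: n0; rewrite kE muln_gt0 => /andP[].
  rewrite kE !natrM nabsM vp invfM ler_wpM2r ?invr_ge0 ?ler0n //.
  apply: IH => //; rewrite (leq_trans _ (nm : (n <= m)%N)) // kE.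
  by rewrite ltn_Pmulr.
apply: (@le_trans _ _ 1); first by rewrite invf_le1 ?ltr0n // ler1n.
rewrite leNgt; apply/negP => vn.
case: (egcdnP p n0) => km kn E _.
have g1 : gcdn n p = 1%N by apply/eqP; rewrite -[_ == _]/(coprime n p) coprime_sym prime_coprime.
have : v 1 < 1.
  have -> : 1 = km%:R * n%:R - kn%:R * p%:R :> F.
    by rewrite -!natrM E g1 natrD addrAC subrr add0r.
  rewrite (le_lt_trans (nabsB _ _ _)) // gt_max !nabsM.
  rewrite !(le_lt_trans (ler_piMl _ (nabs_nat _ _))) ?nabs_ge0 //.
  by rewrite vp invf_lt1 ?ltr1n ?ltr0n // ltnW.
by rewrite nabs1 ltxx.
Qed.

Lemma nabs_char0 (F : fieldType) (v : nonarchAbs R F) :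
  v p%:R = p%:R^-1 -> forall n, n.+1%:R != 0 :> F.
Proof.
move=> vp n; apply/eqP => n0; have := nabs_nat_lower vp (ltn0Sn n).
by rewrite n0 nabs0 leNgt invr_gt0 ltr0n.
Qed.

Section Field.
Variables (F : fieldType) (v : nonarchAbs R F) (vp : v p%:R = p%:R^-1).

Definition null_seq (u : nat -> F) : Prop := forall e : R, 0 < e ->
  exists N, forall n, (N <= n)%N -> v (u n) < e.

Lemma cvg_sums_null (u : nat -> F) l :
  abs_cvg v (fun N => \sum_(0 <= n < N) u n) l -> null_seq u.
Proof.
move=> h e e0; have [N hN] := h e e0; exists N => n nN.
have -> : u n = (\sum_(0 <= i < n.+1) u i - l) - (\sum_(0 <= i < n) u i - l).
  by rewrite big_nat_recr //=; ring.
by rewrite (le_lt_trans (nabsB _ _ _)) // gt_max !hN // leqW.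
Qed.

(** The product s' (s' - 1) ... (s' - k + 1) is bounded by max(1, |s|)^k, so the binomial terms are
    dominated by exponential terms at d or at s d. *)
Lemma null_pow_cvg d s s' : null_seq (fun k => d ^+ k / k`!%:R) ->
  null_seq (fun k => (s * d) ^+ k / k`!%:R) -> v s' <= Num.max 1 (v s) ->
  pow_cvg v d s'.
Proof.
move=> n1 ns s's.
have bnd (C : R) k : 0 <= C -> v s' <= C -> 1 <= C ->
    v (d ^+ k * gen_bin s' k) <= C ^+ k * v (d ^+ k / k`!%:R).
  move=> C0 sC C1; rewrite /gen_bin mulrCA nabsM ler_wpM2r ?nabs_ge0 //.
  elim: k => [|k IH]; first by rewrite big_ord0 expr0 nabs1.
  rewrite big_ord_recr exprSr nabsM ler_pM ?nabs_ge0 //.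
  by rewrite (le_trans (nabsB _ _ _)) // ge_max sC (le_trans (nabs_nat _ _)).
move=> e e0; have [vs1|vs1] := leP (v s) 1.
  have [N hN] := n1 e e0; exists N => k /hN; apply: le_lt_trans.
  rewrite (le_trans (bnd 1 k _ _ _)) ?ler01 ?expr1n ?mul1r //.
  by move: s's; rewrite (max_l vs1).
have [N hN] := ns e e0; exists N => k /hN; apply: le_lt_trans.
rewrite (le_trans (bnd (v s) k _ _ _)) ?nabs_ge0 ?(ltW vs1) //.
  by move: s's; rewrite (max_r (ltW vs1)).
by rewrite -nabsX -nabsM mulrA exprMn.
Qed.

(** The linear term of the logarithm strictly dominates: for n > 1 the inequality n < p^(n-1), which
    at n = 2 needs p > 2, makes the term of degree n smaller than d. *)
Lemma nabs_log (h : nat) l : (0 < h)%N ->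
  abs_cvg v (log_sums (1 + p%:R ^+ h)) l -> v l = v (p%:R ^+ h).
Proof.
move=> h0 cl; set d := p%:R ^+ h in cl *.
have p3 : (2 < p)%N by apply: odd_prime_gt2.
have d0 : 0 < v d.
  by rewrite nabsX vp exprn_gt0 // invr_gt0 ltr0n prime_gt0.
have dp : v d <= p%:R^-1.
  rewrite nabsX vp -(prednK h0) exprS ler_piMr ?invr_ge0 ?ler0n //.
  by rewrite exprn_ile1 ?invr_ge0 ?ler0n // invf_le1 ?ler1n ?ltr0n prime_gt0.
have small_term n : (1 < n)%N -> v ((-1) ^+ n.+1 / n%:R * d ^+ n) < v d.
  move=> n1; rewrite !nabsM (nabsX v (-1)) nabsN nabs1 expr1n mul1r nabsV.
  have n0 : (0 < n)%N by rewrite ltnW.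
  have vn0 : 0 < v n%:R.
    by rewrite (lt_le_trans _ (nabs_nat_lower vp n0)) // invr_gt0 ltr0n.
  rewrite ltr_pdivrMl // (nabsX v d) -(prednK n0) exprS mulrC ltr_pM2r // prednK //.
  rewrite (lt_le_trans _ (nabs_nat_lower vp n0)) //.
  apply: (@le_lt_trans _ _ (p%:R^-1 ^+ n.-1)); first by rewrite lerXn2r ?nnegrE ?nabs_ge0 ?invr_ge0 ?ler0n.
  rewrite exprVn ltf_pV2 ?posrE ?exprn_gt0 ?ltr0n ?(prime_gt0 hp) //.
  rewrite -natrX ltr_nat.
  case: n n1 {n0 vn0} => [|[|n]] // _ /=.
  elim: n => [|n IH]; first by rewrite expn1.
  by rewrite expnS (leq_trans _ (leq_mul p3 IH)) //; lia.
have [N hN] := cl _ d0.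
pose m := maxn N 2.
have mN : (N <= m)%N by rewrite leq_maxl.
have m2 : (2 <= m)%N by rewrite leq_maxr.
have small : v (log_sums (1 + d) m - d) < v d.
  rewrite /log_sums (_ : 1 + d - 1 = d); last by ring.
  rewrite big_ltn // expr1 sqrrN expr1n divr1 mul1r addrAC subrr add0r.
  by rewrite big_nat; apply: nabs_sum_lt => // i /andP[i1 _]; apply: small_term.
have vld : v (l - d) < v d.
  have -> : l - d = (log_sums (1 + d) m - d) - (log_sums (1 + d) m - l) by ring.
  by rewrite (le_lt_trans (nabsB _ _ _)) // gt_max small hN.
apply/le_anti/andP; split.
  by rewrite -[l](subrK d) (le_trans (nabsD _ _ _)) // ge_max lexx (ltW vld).
rewrite leNgt; apply/negP => h'.
have : v d < v d; last by rewrite ltxx.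
have {1}-> : d = l - (l - d) by ring.
by rewrite (le_lt_trans (nabsB _ _ _)) // gt_max h' vld.
Qed.

End Field.
End PadicEstimates.

(** * Conclusion *)

Lemma is_rational_div (E : fieldType) (x : E) (n : nat) (m : int) :
  (forall n, n.+1%:R != 0 :> E) -> n.+1%:R * x = m%:~R -> is_rational x.
Proof.
move=> E0 xE; pose q : rat := m%:~R / n.+1%:R.
have int0 (z : int) : z != 0 -> z%:~R != 0 :> E.
  by case: z => [[|k]|k] // _; rewrite ?NegzE ?rmorphN ?oppr_eq0 /= -?pmulrn E0.
have qE : numq q * n.+1%:Z = m * denq q.
  apply: (@intr_inj rat); rewrite !rmorphM /= numqE /q -pmulrn.
  by rewrite mulrAC divfK // pnatr_eq0.
exists q; rewrite /ratr; apply: (mulfI (E0 n)).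
apply: (mulIf (int0 _ (denq_neq0 q))).
rewrite xE -[RHS]mulrA divfK ?int0 ?denq_neq0 // -rmorphM -qE rmorphM /= -pmulrn; ring.
Qed.

Lemma is_rational_half (E : fieldType) (a b : E) :
  (forall n, n.+1%:R != 0 :> E) -> commensurable (a - b) -> commensurable (a + b) ->
  is_rational a /\ is_rational b.
Proof.
move=> E0 [n [m h]] [n' [m' h']]; split.
  apply: (@is_rational_div _ _ (2 * n.+1 * n'.+1).-1 (n'.+1%:Z * m + n.+1%:Z * m')) => //.
  rewrite prednK ?muln_gt0 // !natrM rmorphD !rmorphM /= -h -h' -!pmulrn; ring.
apply: (@is_rational_div _ _ (2 * n.+1 * n'.+1).-1 (n.+1%:Z * m' - n'.+1%:Z * m)) => //.
rewrite prednK ?muln_gt0 // !natrM rmorphB !rmorphM /= -h -h' -!pmulrn; ring.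
Qed.

Section Units.
Variables (R : realType) (p : nat) (Qp : padicField R p) (K : fieldType)
  (iK : {rmorphism K -> algC}) (V : pPlaces Qp iK)
  (E : fieldExtType Qp) (vE : nonarchAbs R E) (chi : (algC -> algC) -> E).

Lemma nabs_unit_neq0 (x : E) : vE x = 1 -> x != 0.
Proof. by move=> x1; apply/eqP => x0; move: x1; rewrite x0 nabs0 => /esym/eqP; rewrite oner_eq0. Qed.

Lemma prod_char_neq0 (lam : forall i : pl_idx V, pl_fld V i -> E) x :
  is_galois_character iK vE chi -> (forall i, attached_char chi (pl_cft V i) (lam i)) ->
  x != 0 -> prod_char lam (diagKp V x) != 0.
Proof.
move=> [_ chi1 _] hlam x0; apply/prodf_neq0 => i _.
have [|s [Gs _ ->]] := hlam i (diagKp V x i); first by rewrite fmorph_eq0.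
exact/nabs_unit_neq0/chi1.
Qed.

(** A prime at which [chi] ramifies lies above p or divides the modulus, so on ideals prime to both
    [Psi] has absolute value 1. *)
Lemma ideal_character_neq0 (c : K -> K) (Psi : set K -> E) m I :
  is_ideal_character iK vE chi Psi -> is_modulus R iK p c chi m ->
  is_frac_ideal I -> prime_to_pm p m I -> Psi I != 0.
Proof.
move=> [Psi1 _ _] [_ _ _ ram _] fI pI; apply/nabs_unit_neq0/Psi1; split=> // q pq rq.
apply: pI => //; have [qp|qp] := pselect (q p%:R); [by left|right].
exact: ram.
Qed.

End Units.

Lemma ideal_pow_lift (S A : comNzRingType) (h : {rmorphism S -> A}) (I : set A) :
  (forall y, exists s, h s = y) -> forall N z, ideal_pow I N z ->
  exists s, h s = z /\ ideal_pow (h @^-1` I) N s.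
Proof.
move=> surj N z; elim=> [u|n a u Ia _ [s [<- Is]]|n u w _ [s [<- Is]] _ [t [<- It]]|n].
- by have [s <-] := surj u; exists s; split=> //; apply: ideal_pow0.
- have [t ta] := surj a; exists (t * s); rewrite rmorphM ta; split=> //.
  by apply: ideal_powM; rewrite //= ta.
- by exists (s + t); rewrite rmorphD; split=> //; apply: ideal_powD.
- by exists 0; rewrite rmorph0; split=> //; apply: ideal_pow_0.
Qed.

(** * The core argument over the Tate algebra of the bidisc *)

Section Transcendence.
Variables (R : realType) (L : fieldType) (v : nonarchAbs R L) (d : L).
Hypotheses (L0 : forall n, n.+1%:R != 0 :> L) (d0 : d != 0).
Variables (f : {poly {poly L}}) (hf : irreducible_elt f) (FC : functionField f).
Variables (O : comAlgType L) (phi : series L 2 -> O).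
Hypothesis hO : curve_bidisc_algebra v d f phi.
Variables (Omega : set (set O)) (hadm : admissible_open v Omega) (hne : Omega !=set0).
Variables (a b A B r : L).
Hypotheses (pa : pow_cvg v d a) (pb : pow_cvg v d b) (pa' : pow_cvg v d (- a))
  (pb' : pow_cvg v d (- b)) (p0 : pow_cvg v d 0) (p1 : pow_cvg v d (- 1)).
Hypotheses (A0 : A != 0) (B0 : B != 0) (r0 : r != 0) (ab0 : (a, b) <> (0, 0)).
Let S : tate v := tateC v A * tate_pow pa pb + tateC v B * tate_pow pb pa - tateC v r.
Hypothesis van : vanishes_on v Omega (tate_phi hO.1 S).

Lemma curve_transcendence :
  (commensurable (a - b) /\ commensurable (a + b)) \/
  (a + b = 0 /\ constant_on_curve (ff_x FC / ff_y FC)) \/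
  (a - b = 0 /\ constant_on_curve (ff_x FC * ff_y FC)).
Proof.
have [M OM] := hne.
have affO : is_affinoid v O by exists 2, phi; exact: hO.1.
have hpow := vanishing_ideal_pow affO hadm van OM.
have MSp : Sp M.
  have [CU [CUsub OE _]] := hadm.
  have /= [U CUU UM] : [set M | exists2 U, CU U & U M] M by rewrite -OE.
  by have [USp _] := CUsub _ CUU; apply: USp.
have hI : is_ideal setT M /\ ~ M 1 by case: MSp.
have [pi [surj kerpi]] := quot_algP hI.
pose pi' : {rmorphism tate v -> quot_alg hI} := pi \o tate_phi hO.1.
have kdom (u w : quot_alg hI) : u * w = 0 -> u = 0 \/ w = 0.
  have [x <-] := surj u; have [y <-] := surj w; rewrite -(rmorphM pi) => /kerpi.
  by move/(maximal_ideal_prime MSp) => [] /kerpi; [left|right].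
have kerE : [set u | pi' u = 0] = tate_phi hO.1 @^-1` M.
  by apply/funext => u; apply/propext; exact: kerpi.
apply: (curve_core L0 hf FC (pi := pi') kdom (tate_dx_derivation v d) (tate_dy_derivation v d)
  (tate_dxC v d) (tate_dyC v d) (tate_dxx v d0) (tate_dxy v d) (tate_dyx v d) (tate_dyy v d0)
  _ A0 B0 r0 ab0 (tate_pow_inv L0 d0 pa pb pa' pb') (tate_pow_inv L0 d0 pb pa pb' pa')
  (tate_x_inv L0 d0 p1 p0) (tate_y_inv L0 d0 p0 p1) (tate_pow_dx L0 d0 pa pb) (tate_pow_dy L0 d0 pa pb)
  (tate_pow_dx L0 d0 pb pa) (tate_pow_dy L0 d0 pb pa)).
- by rewrite /= tate_phi_f rmorph0.
- move=> N; rewrite kerE.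
  (* Membership in M^N lifts to the Tate algebra up to an element of the kernel of the presentation,
     that is, a multiple of f. *)
  have [s [sE Is]] := ideal_pow_lift (tate_phi_surj hO.1) (hpow N).
  have [t tE] : exists t, S - s = eval2 (tateC v) (tate_x v d) (tate_y v d) f * t.
    by apply: (tate_phi_ker (hphi := hO)); rewrite rmorphB sE subrr.
  by exists t, s; split=> //; rewrite -tE subrK.
Qed.

End Transcendence.

Lemma nabs_extends_nat (R : realType) (F : fieldType) (M : fieldExtType F)
    (v : nonarchAbs R F) (w : nonarchAbs R M) n :
  abs_extends (fun x : F => x%:A : M) v w -> w n%:R = v n%:R.
Proof.
by move=> vw; rewrite -vw; congr (w _); apply/esym; apply: (rmorph_nat (GRing.in_alg M)).
Qed.

Lemma commensurable_morph (E L : fieldType) (g : {rmorphism E -> L}) s :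
  commensurable (g s) -> commensurable s.
Proof.
move=> [n [z e]]; exists n, z; apply: (fmorph_inj g).
by rewrite rmorphM rmorph_nat rmorph_int.
Qed.

Lemma gen_bin_alg (E : fieldType) (L : fieldExtType E) (s : E) k :
  (gen_bin s k)%:A = gen_bin (s%:A : L) k.
Proof.
have [g alg] : exists g : {rmorphism E -> L}, forall x, x%:A = g x.
  by exists (GRing.in_alg L).
rewrite !alg /gen_bin fmorph_div rmorph_prod rmorph_nat; congr (_ / _).
by apply: eq_bigr => i _; rewrite rmorphB rmorph_nat.
Qed.

Lemma Phi_series_tate (R : realType) (E : fieldType) (L : fieldExtType E)
    (v : nonarchAbs R L) (A B a b d : E) (r : int) (d' : L)
    (pa : pow_cvg v d' (a%:A)) (pb : pow_cvg v d' (b%:A)) :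
  d%:A = d' ->
  (forall n, n.+1%:R != 0 :> E) ->
  series_base_change L (Phi_series A B a b r d) =
  to_series (tate_val (tateC v A%:A * tate_pow pa pb + tateC v B%:A * tate_pow pb pa -
    tateC v r%:~R)).
Proof.
move=> dE; subst d' => E0; apply/funext => nu; rewrite /series_base_change /Phi_series /to_series.
rewrite tate_sub -[RHS]/(_ - _) tate_coefD !tate_coefCM !tate_coef_pow tate_coefC.
rewrite /series_one mindex2_eq0 -!gen_bin_alg !pow_coef_bin //.
have [g alg] : exists g : {rmorphism E -> L}, forall x, x%:A = g x.
  by exists (GRing.in_alg L).
rewrite !alg rmorphB !(rmorphM, rmorphD, rmorphXn) rmorph_int rmorph_nat /=.
congr (_ - _); first by ring.
by case: (_ && _); rewrite ?mulr1 ?mulr0.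
Qed.

(** * From the depth conditions to convergence of binomial series *)

Section DepthConditions.
Variables (R : realType) (p : nat) (hp : prime p) (hodd : odd p).
Variables (E : fieldType) (L : fieldExtType E) (v : nonarchAbs R L).
Hypothesis vp : v p%:R = p%:R^-1.
Variable h : nat.
Let d : L := p%:R ^+ h.

(** For h = 0 the exponential terms are 1/n!, of absolute value at least 1, and do not tend to 0. *)
Lemma depth_pos l : abs_cvg v (exp_sums d) l -> (0 < h)%N.
Proof.
move=> /cvg_sums_null/(_ 1 ltr01)[N /(_ N (leqnn N))].
rewrite lt0n; apply: contraTneq => h0.
rewrite /d h0 expr0 expr1n mul1r nabsV -leNgt invf_ge1 ?nabs_nat //.
by apply: nabs_gt0; rewrite -(prednK (fact_gt0 N)); apply: (nabs_char0 hp vp).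
Qed.

(** As the logarithm of 1 + d has the absolute value of d, convergence of exp (s log (1 + d)) says
    that (s d)^n / n! tends to 0. *)
Lemma depth_pow_cvg (s s' : L) l0 l1 l2 : abs_cvg v (exp_sums d) l0 ->
  abs_cvg v (log_sums (1 + d)) l1 -> abs_cvg v (exp_sums (s * l1)) l2 ->
  v s' <= Num.max 1 (v s) -> pow_cvg v d s'.
Proof.
move=> c0 c1 c2; have h0 := depth_pos c0.
apply: null_pow_cvg; first exact: cvg_sums_null c0.
move=> e e0; have [N hN] := cvg_sums_null c2 e0; exists N => n /hN.
by rewrite !nabsM !nabsX !nabsM (nabs_log hp hodd vp h0 c1).
Qed.

End DepthConditions.
Unset Implicit Arguments.
Set Strict Implicit.
Set Printing Implicit Defensive.

Theorem theorem4p1 (R : realType) (p : nat) (hp : prime p) (hodd : odd p)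
    (Qp : padicField R p)
    (K : fieldExtType rat) (hK : imaginary_quadratic R K)
    (c : {rmorphism K -> K}) (hc : exists x, c x != x)
    (iK : {rmorphism K -> algC}) (V : pPlaces Qp iK)
    (E : fieldExtType Qp) (vE : nonarchAbs R E)
    (hvE : abs_extends (fun x : Qp => x%:A : E) (padic_abs Qp) vE)
    (tau : {rmorphism K -> E})
    (chi : (algC -> algC) -> E) (hchi : is_galois_character iK vE chi)
    (lam : forall i : pl_idx V, pl_fld V i -> E)
    (hlam : forall i, attached_char chi (pl_cft V i) (lam i))
    (kappa : KpHom V E)
    (hkappa : exists n : nat, exp_formula vE (prod_char lam) kappa n)
    (a b : E) (hab : has_weights tau c kappa a b)
    (r : int)
    (Psi : set K -> E) (hPsi : is_ideal_character iK vE chi Psi)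
    (m : set K) (hm : is_modulus R iK p c chi m)
    (J : nat) (aid : 'I_J -> set K) (haid : is_representative_list p c m aid)
    (h : nat) (hh : exp_formula vE (prod_char lam) kappa h)
    (hcvg : depth_cvg vE h a b)
    (j : 'I_J) (X : set K) (alpha0 : K)
    (hX : generator_class V chi m h (aid j) X alpha0)
    (A B : E)
    (hA : A = Psi (aid j) * (prod_char lam (diagKp V alpha0))^-1)
    (hB : B = Psi (c @` aid j) * (prod_char lam (diagKp V (c alpha0)))^-1)
    (hr : r != 0) (hab0 : (a, b) <> (0, 0))
    (L : fieldExtType E) (vL : nonarchAbs R L)
    (hvL : abs_extends (fun x : E => x%:A : L) vE vL)
    (f : {poly {poly L}}) (hf : irreducible_elt f) (FC : functionField f)
    (O : comAlgType L) (phi : series L 2 -> O)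
    (hO : curve_bidisc_algebra vL (p%:R ^+ h) f phi)
    (Omega : set (set O)) (hadm : admissible_open vL Omega) (hne : Omega !=set0)
    (hvan : vanishes_on vL Omega
       (phi (series_base_change L (Phi_series A B a b r (p%:R ^+ h))))) :
  (is_rational a /\ is_rational b) \/
  (a + b = 0 /\ constant_on_curve (ff_x FC / ff_y FC)) \/
  (a - b = 0 /\ constant_on_curve (ff_x FC * ff_y FC)).
Proof.
have vEp : vE p%:R = p%:R^-1 by rewrite (nabs_extends_nat _ hvE) padic_absp.
have vLp : vL p%:R = p%:R^-1 by rewrite (nabs_extends_nat _ hvL).
have E0 := nabs_char0 hp vEp; have L0 := nabs_char0 hp vLp.
pose d : L := p%:R ^+ h.
have dE : (p%:R ^+ h : E)%:A = d.
  by rewrite -[LHS]/(GRing.in_alg L _) rmorphXn rmorph_nat.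
have d0 : d != 0.
  have nat0 n : (0 < n)%N -> n%:R != 0 :> L by case: n.
  by rewrite expf_neq0 // nat0 ?prime_gt0.
(* The depth conditions are read off over L at the boundary points t = 1 + p^h and z = p^h of the
   two discs. *)
have [logc expc _ _ powc] := hcvg L vL hvL.
have [l0 c0] : exists l, abs_cvg vL (exp_sums d) l by apply: expc; exact: lexx.
have c1 : abs_cvg vL (log_sums (1 + d)) (abs_log vL (1 + d)).
  have [|l c1] := logc (1 + d); first by rewrite /= addrAC subrr add0r.
  exact: (xgetPex 0 (ex_intro _ l c1 : exists l, [set l | abs_cvg vL (log_sums (1 + d)) l] l)).
(* Besides a and b, this bound covers -a, -b, 0 and -1, the exponents in the inverses of U, W, x and
   y. *)
have pow s s' : s \in [:: a; b] -> vL s' <= Num.max 1 (vL s%:A) -> pow_cvg vL d s'.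
  move=> sab; have [| |l2] := powc s _ (1 + d).
  - by move: sab; rewrite !inE => /orP[->|->]; rewrite ?orbT.
  - by rewrite /= addrAC subrr add0r.
  rewrite -[s *: abs_log vL _]mulr_algl => c2; exact: (depth_pow_cvg hp hodd vLp c0 c1 c2).
have inA : a \in [:: a; b] by rewrite inE eqxx.
have inB : b \in [:: a; b] by rewrite !inE eqxx orbT.
have max_ge (x y : R) : y <= Num.max x y by rewrite le_max lexx orbT.
have pa : pow_cvg vL d a%:A by apply: (pow a).
have pb : pow_cvg vL d b%:A by apply: (pow b).
have pa' : pow_cvg vL d (- a%:A) by apply: (pow a) => //; rewrite nabsN.
have pb' : pow_cvg vL d (- b%:A) by apply: (pow b) => //; rewrite nabsN.
have p0 : pow_cvg vL d 0 by apply: (pow a) => //; rewrite nabs0 le_max ler01.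
have p1 : pow_cvg vL d (- 1) by apply: (pow a) => //; rewrite nabsN nabs1 le_max lexx.
have [fracI coverI conjI] := haid.
have al0 : alpha0 != 0 by case: hX => Xa /(_ alpha0)[/(_ Xa)[[[]]]].
have [Ifrac Iprime] := fracI j.
(* The conjugate ideal is again in the list, hence fractional and prime to p m, as the nonvanishing
   of B requires. *)
have [j' cI] := conjI j; have [Ifrac' Iprime'] := fracI j'.
have A0 : A%:A != 0 :> L.
  rewrite scaler_eq0 oner_eq0 orbF hA mulf_neq0 ?invr_eq0 //.
    exact: ideal_character_neq0 hPsi hm Ifrac Iprime.
  exact: prod_char_neq0 hchi hlam al0.
have B0 : B%:A != 0 :> L.
  rewrite scaler_eq0 oner_eq0 orbF hB mulf_neq0 ?invr_eq0 //.
    by rewrite cI; apply: ideal_character_neq0 hPsi hm Ifrac' Iprime'.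
  by apply: prod_char_neq0 hchi hlam _; rewrite fmorph_eq0.
have r0 : r%:~R != 0 :> L.
  by case: r hr {hvan} => [[|n]|n] // _; rewrite ?NegzE ?rmorphN ?oppr_eq0 /= -?pmulrn.
have alg_inj (s t : E) : s%:A = t%:A :> L -> s = t by apply: (fmorph_inj (GRing.in_alg L)).
have ab0 : (a%:A, b%:A) <> (0, 0) :> L * L.
  move=> [h1 h2]; apply: hab0; congr pair; apply: alg_inj; rewrite scale0r //.
have van : vanishes_on vL Omega (tate_phi hO.1
    (tateC vL A%:A * tate_pow pa pb + tateC vL B%:A * tate_pow pb pa - tateC vL r%:~R)).
  by rewrite /tate_phi -(Phi_series_tate A B r pa pb dE E0).
have com (s : E) : commensurable (s%:A : L) -> commensurable s.
  exact: (@commensurable_morph _ _ (GRing.in_alg L)).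
have [[h1 h2]|[[e cst]|[e cst]]] :=
  curve_transcendence L0 d0 hf FC hadm hne pa' pb' p0 p1 A0 B0 r0 ab0 van.
- by left; apply: is_rational_half => //; apply: com; rewrite ?scalerBl ?scalerDl.
- by right; left; split=> //; apply: alg_inj; rewrite scalerDl e scale0r.
- by right; right; split=> //; apply: alg_inj; rewrite scalerBl e scale0r.
Qed.
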